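(* Let $(X_0,X_1)$ and $(Y_0,Y_1)$ be compatible pairs of quasi-Banach lattices such that $Y_0$ and $Y_1$ have the $K_{\infty,1}$ property. Then for every linear operator of pairs $T:(X_0,X_1)\to(Y_0,Y_1)$ and every function $\varphi\in\mathcal P$, $T$ maps $\varphi^0(X_0,X_1)$ boundedly into $\varphi^0(Y_0,Y_1)$.
   Context: All spaces are real. A quasi-norm satisfies the norm axioms except that the triangle inequality is replaced by $\|x+y\|\le C(\|x\|+\|y\|)$ for some constant $C\ge1$. A quasi-Banach lattice is a vector lattice with a complete quasi-norm such that $\|x\|\le\|y\|$ whenever $|x|\le|y|$. Compatible pair: $(X_0,X_1)$ is a compatible pair of quasi-Banach lattices if there are a Hausdorff locally solid topological vector lattice $X$ and injective, continuous, interval preserving lattice homomorphisms $j_i:X_i\hookrightarrow X$ ($i=0,1$), where interval preserving means $j_i([0,x])=[0,j_i(x)]$ for $x\ge0$. One identifies $X_i$ with its image. Then $X_0+X_1=\{x_0+x_1: x_i\in X_i\}\subset X$ is a quasi-Banach lattice with quasi-norm $\|x\|=\inf\{\|x_0\|_{X_0}+\|x_1\|_{X_1}:x=x_0+x_1\}$, containing $X_0,X_1$ as (not necessarily closed) ideals. A linear operator of pairs $T:(X_0,X_1)\to(Y_0,Y_1)$ is a bounded linear map $T:X_0+X_1\to Y_0+Y_1$ such that $T|_{X_i}$ maps $X_i$ boundedly into $Y_i$ for $i=0,1$. The class $\mathcal P$: all functions $\varphi:(0,\infty)\times(0,\infty)\to[0,\infty)$ with $\varphi(\lambda s,\lambda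 t)=\lambda\varphi(s,t)$ for $s,t,\lambda>0$ and non-decreasing in each variable, normalized by $\varphi(1,1)=1$. Such $\varphi$ extends uniquely to a continuous function on $[0,\infty)^2$, still denoted $\varphi$. Functional calculus: for positive $x_0,x_1$ in a quasi-Banach lattice, $\varphi(x_0,x_1)$ is defined by Krivine's functional calculus; concretely, the (non-closed) ideal generated by $e=x_0\vee x_1$ is lattice isomorphic to some $C(\Omega)$, $\Omega$ compact Hausdorff, with $e$ corresponding to $1_\Omega$, and $\varphi(x_0,x_1)$ corresponds to the function $\omega\mapsto\varphi(\hat x_0(\omega),\hat x_1(\omega))$. Calderón–Lozanovskii space: $\varphi(X_0,X_1)=\{x\in X_0+X_1:|x|\le\varphi(x_0,x_1)\text{ for some }x_0\in X_0^+,x_1\in X_1^+\}$, a quasi-Banach lattice with quasi-norm $\|x\|_{\varphi(X_0,X_1)}=\inf\{\lambda>0:|x|\le\lambda\varphi(x_0,x_1),\ x_i\in X_i^+,\ \|x_0\|_{X_0}\le1,\ \|x_1\|_{X_1}\le1\}$. $\varphi^0(X_0,X_1)$ is the closure of $X_0\cap X_1$ in $\varphi(X_0,X_1)$, with the quasi-norm of $\varphi(X_0,X_1)$. A linear operator $T:E\to F$ between quasi-Banach lattices is $(\infty,1)$-regular if there is $K>0$ with $\big\|\bigvee_{i=1}^n|Tx_i|\big\|\le K\big\|\sum_{i=1}^n|x_i|\big\|$ for all finite families $(x_i)_{i=1}^n\subset E$; $\rho_{\infty,1}(T)$ denotes the smallest such $K$. A quasi-Banach lattice $F$ has the $K_{\infty,1}$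 property if there is a constant $C>0$ such that for every quasi-Banach lattice $E$, every bounded linear operator $T:E\to F$ is $(\infty,1)$-regular with $\rho_{\infty,1}(T)\le C\|T\|$. *)

(* Defs.v *)
From HB Require Import structures.
From mathcomp Require Import all_boot all_order all_algebra.
From mathcomp Require Import boolp classical_sets functions set_interval reals.
From mathcomp Require Import topology normedtype.

Set Implicit Arguments.
Unset Strict Implicit.
Unset Printing Implicit Defensive.

Import Order.TTheory GRing.Theory Num.Theory.
Import numFieldTopology.Exports.

Local Open Scope classical_set_scope.
Local Open Scope ring_scope.

(* The numeric structures of the library already join its order structures with
   its algebraic ones, and no new join can be inserted below them. The order of
   a vector lattice is therefore part of the mixin, and vector lattices get their
   latticeType structure afterwards, with the display of numeric types: the
   order is written as usual in ring_scope, and the lattice operations are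
   Order.join and Order.meet. *)

HB.mixin Record isVectorLattice (R : realType) V & GRing.Lmodule R V := {
  vle : rel V ;
  vmeet : V -> V -> V ;
  vjoin : V -> V -> V ;
  vle_refl : reflexive vle ;
  vle_anti : antisymmetric vle ;
  vle_trans : transitive vle ;
  vle_meet : forall x y z, vle x (vmeet y z) = vle x y && vle x z ;
  vle_join : forall x y z, vle (vjoin x y) z = vle x z && vle y z ;
  vle_add2r : forall z x y, vle x y -> vle (x + z) (y + z) ;
  vle_scale : forall (a : R) x y, 0 <= a -> vle x y -> vle (a *: x) (a *: y)
}.

#[short(type="vectorLatticeType")]
HB.structure Definition VectorLattice (R : realType) :=
  {V of isVectorLattice R V & GRing.Lmodule R V}.

Definition vlat (R : realType) (V : vectorLatticeType R) : Type := V.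

HB.instance Definition _ (R : realType) (V : vectorLatticeType R) :=
  Choice.copy (vlat V) V.
HB.instance Definition _ (R : realType) (V : vectorLatticeType R) :=
  Order.Le_isPOrder.Build ring_display (vlat V)
    (@vle_refl R V) (@vle_anti R V) (@vle_trans R V).
HB.instance Definition _ (R : realType) (V : vectorLatticeType R) :=
  Order.POrder_MeetJoin_isLattice.Build ring_display (vlat V)
    (@vle_meet R V) (@vle_join R V).

#[non_forgetful_inheritance]
HB.instance Definition _ (R : realType) (V : vectorLatticeType R) :=
  Order.Lattice.copy (VectorLattice.sort V) (vlat V).

Definition vabs (R : realType) (V : vectorLatticeType R) (x : V) : V :=
  Order.join x (- x).

HB.mixin Record isQuasiBanachLattice (R : realType) V & VectorLattice R V := {
  qnorm : V -> R ;
  qnorm_ge0 : forall x : V, 0 <= qnorm x ;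
  qnorm_eq0 : forall x : V, qnorm x = 0 -> x = 0 ;
  qnormZ : forall (a : R) (x : V), qnorm (a *: x) = `|a| * qnorm x ;
  qnormD : exists2 C : R, 1 <= C &
    forall x y : V, qnorm (x + y) <= C * (qnorm x + qnorm y) ;
  qnorm_mono : forall x y : V, vabs x <= vabs y -> qnorm x <= qnorm y ;
  qnorm_complete : forall u : nat -> V,
    (forall e : R, 0 < e -> exists N, forall m n,
       (N <= m)%N -> (N <= n)%N -> qnorm (u m - u n) < e) ->
    exists l : V, forall e : R, 0 < e -> exists N, forall n,
       (N <= n)%N -> qnorm (u n - l) < e
}.

#[short(type="quasiBanachLatticeType")]
HB.structure Definition QuasiBanachLattice (R : realType) :=
  {V of isQuasiBanachLattice R V & VectorLattice R V}.

#[non_forgetful_inheritance]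
HB.instance Definition _ (R : realType) (E : quasiBanachLatticeType R) :=
  Order.Lattice.copy (QuasiBanachLattice.sort E) (vlat E).

(* The neighbourhoods of a point in the topology of the quasi-norm. *)
Definition qnbhs (R : realType) (E : quasiBanachLatticeType R) (x : E) :
    set_system E :=
  filter_from [set e : R | 0 < e] (fun e => [set y | qnorm (y - x) < e]).

Definition solid (R : realType) (V : vectorLatticeType R) (A : set V) : Prop :=
  forall x y, A y -> vabs x <= vabs y -> A x.

HB.mixin Record isLocallySolid (R : realType) V
    & VectorLattice R V & TopologicalLmodule R V := {
  locally_solid : forall U : set V, nbhs 0 U ->
    exists W : set V, [/\ nbhs 0 W, solid W & W `<=` U]
}.

#[short(type="topVectorLatticeType")]
HB.structure Definition TopVectorLattice (R : realType) :=
  {V of isLocallySolid R V & VectorLattice R V & TopologicalLmodule R V}.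

#[non_forgetful_inheritance]
HB.instance Definition _ (R : realType) (X : topVectorLatticeType R) :=
  Order.Lattice.copy (TopVectorLattice.sort X) (vlat X).

Section VectorLatticeTheory.
Context {R : realType} {V : vectorLatticeType R}.
Implicit Types x y z t p q w : V.

Lemma vl_leD2r z x y : x <= y -> x + z <= y + z.
Proof. exact: vle_add2r. Qed.

Lemma vl_leZ (a : R) x y : 0 <= a -> x <= y -> a *: x <= a *: y.
Proof. exact: vle_scale. Qed.

Lemma vl_leD x y z t : x <= y -> z <= t -> x + z <= y + t :> V.
Proof.
move=> xy zt; apply: (le_trans (vl_leD2r z xy)).
by rewrite addrC [y + t]addrC vl_leD2r.
Qed.

Lemma vl_subr_ge0 x y : (0 <= y - x :> V) = (x <= y).
Proof.
apply/idP/idP => [/(vl_leD2r x)|/(vl_leD2r (- x))].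
  by rewrite add0r subrK.
by rewrite subrr.
Qed.

Lemma vl_leBlDr x y z : (x - y <= z :> V) = (x <= z + y).
Proof. by rewrite -vl_subr_ge0 opprB addrA vl_subr_ge0. Qed.

Lemma vl_leN x y : (- x <= - y :> V) = (y <= x).
Proof. by rewrite -vl_subr_ge0 opprK addrC vl_subr_ge0. Qed.

Lemma vl_joinDr x y z : Order.join x y + z = Order.join (x + z) (y + z).
Proof.
apply/le_anti/andP; split; last first.
  by rewrite leUx !vl_leD2r ?leUl ?leUr.
rewrite -[z in X in X <= _]opprK vl_leBlDr.
by rewrite leUx -!vl_leBlDr opprK leUl leUr.
Qed.

Lemma vl_joinN x y : - Order.join x y = Order.meet (- x) (- y).
Proof.
apply/le_anti/andP; split; first by rewrite lexI !vl_leN leUl leUr.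
by rewrite -[X in X <= _]opprK vl_leN leUx -vl_leN opprK leIl -vl_leN opprK leIr.
Qed.

Lemma vabs_ge x : x <= vabs x. Proof. exact: leUl. Qed.

Lemma vabs_ge0 x : 0 <= vabs x.
Proof.
have h : 0 <= vabs x + vabs x.
  by rewrite -(subrr x) vl_leD ?leUl ?leUr.
have h2 : 0 <= 2^-1 :> R by rewrite invr_ge0.
have := vl_leZ h2 h; rewrite scaler0 -[vabs x + _]mulr2n -scaler_nat.
by rewrite scalerA mulVf ?pnatr_eq0// scale1r.
Qed.

Lemma riesz_decomposition w p q : 0 <= w -> 0 <= p -> 0 <= q -> w <= p + q ->
  exists a b, [/\ w = a + b, 0 <= a <= p & 0 <= b <= q].
Proof.
move=> w0 p0 q0 wpq; exists (Order.meet w p), (w - Order.meet w p).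
split; first by rewrite addrC subrK.
  by rewrite lexI w0 p0 leIr.
rewrite vl_subr_ge0 leIl /=.
have -> : w - Order.meet w p = Order.join (0 : V) (w - p).
  rewrite -[X in Order.meet X p]opprK -[X in Order.meet _ X]opprK -vl_joinN opprK.
  by rewrite addrC vl_joinDr addNr addrC.
by rewrite leUx q0 vl_leBlDr addrC.
Qed.

End VectorLatticeTheory.

Record lattice_embedding (R : realType) (E : quasiBanachLatticeType R)
    (X : topVectorLatticeType R) (j : {linear E -> X}) : Prop := {
  embedding_inj : injective j ;
  embedding_continuous : forall x : E, j @ qnbhs x --> j x ;
  embedding_join : {morph j : x y / Order.join x y} ;
  embedding_meet : {morph j : x y / Order.meet x y} ;
  embedding_interval : forall x : E, 0 <= x ->
    j @` [set` `[0, x]] = [set` `[0, j x]]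
}.

Record compatible_pair (R : realType) (X0 X1 : quasiBanachLatticeType R) := {
  ambient : topVectorLatticeType R ;
  emb0 : {linear X0 -> ambient} ;
  emb1 : {linear X1 -> ambient} ;
  ambient_hausdorff : hausdorff_space ambient ;
  emb0P : lattice_embedding emb0 ;
  emb1P : lattice_embedding emb1
}.

Section SumSpace.
Context {R : realType} {X0 X1 : quasiBanachLatticeType R}.
Variable XX : compatible_pair X0 X1.

Definition sum_pred : {pred ambient XX} :=
  fun x => `[< exists x0 x1, x = emb0 XX x0 + emb1 XX x1 >].

Lemma sum_predP x :
  reflect (exists x0 x1, x = emb0 XX x0 + emb1 XX x1) (x \in sum_pred).
Proof. exact: asboolP. Qed.

Lemma sum_pred_submod : submod_closed sum_pred.
Proof.
split=> [|a x y /sum_predP[x0 [x1 ->]] /sum_predP[y0 [y1 ->]]].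
  by apply/sum_predP; exists 0, 0; rewrite !linear0 addr0.
apply/sum_predP; exists (a *: x0 + y0), (a *: x1 + y1).
by rewrite !linearP scalerDr addrACA.
Qed.

HB.instance Definition _ :=
  GRing.isSubmodClosed.Build R (ambient XX) sum_pred sum_pred_submod.

Lemma sum_pred_pos (x : ambient XX) :
  x \in sum_pred -> Order.join x 0 \in sum_pred.
Proof.
have vabs_emb (E : quasiBanachLatticeType R) (j : {linear E -> ambient XX}) c :
    lattice_embedding j -> j c <= j (vabs c).
  by case=> _ _ jU _ _; rewrite jU leUl.
have emb_ge0 (E : quasiBanachLatticeType R) (j : {linear E -> ambient XX}) c :
    lattice_embedding j -> 0 <= j (vabs c).
  case=> _ _ jU _ _; have -> : 0 = j 0 :> ambient XX by rewrite linear0.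
  by rewrite -(join_r (vabs_ge0 c)) jU leUl.
move=> /sum_predP[c0 [c1 xE]].
have [| | | |a [b [wE aI bI]]] := @riesz_decomposition _ (ambient XX)
    (Order.join x 0) (emb0 XX (vabs c0)) (emb1 XX (vabs c1)).
- exact: leUr.
- exact: emb_ge0 (emb0P XX).
- exact: emb_ge0 (emb1P XX).
- rewrite leUx xE vl_leD ?vabs_emb //; try exact: emb0P; try exact: emb1P.
  rewrite -[X in X <= _]addr0.
  by rewrite vl_leD ?emb_ge0//; [exact: emb0P|exact: emb1P].
have : [set` `[0, emb0 XX (vabs c0)]] a by rewrite /= in_itv.
rewrite -(embedding_interval (emb0P XX)) ?vabs_ge0// => -[x0 _ x0a].
have : [set` `[0, emb1 XX (vabs c1)]] b by rewrite /= in_itv.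
rewrite -(embedding_interval (emb1P XX)) ?vabs_ge0// => -[x1 _ x1b].
by apply/sum_predP; exists x0, x1; rewrite wE x0a x1b.
Qed.

Lemma sum_pred_join x y :
  x \in sum_pred -> y \in sum_pred -> Order.join x y \in sum_pred.
Proof.
move=> xS yS; have -> : Order.join x y = Order.join (x - y : ambient XX) 0 + y.
  by rewrite vl_joinDr subrK add0r.
by rewrite rpredD// sum_pred_pos// rpredB.
Qed.

Lemma sum_pred_meet x y :
  x \in sum_pred -> y \in sum_pred -> Order.meet x y \in sum_pred.
Proof.
move=> xS yS; rewrite -[x]opprK -[y]opprK -vl_joinN.
by rewrite rpredN sum_pred_join// rpredN.
Qed.

(* X0 + X1, with the linear and lattice operations of the ambient space. *)
Record sum_space := SumSpace {
  sum_val :> ambient XX ;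
  sum_valP : sum_val \in sum_pred
}.

HB.instance Definition _ := [isSub for sum_val].
HB.instance Definition _ := [Choice of sum_space by <:].
HB.instance Definition _ := [SubChoice_isSubLmodule of sum_space by <:].
HB.instance Definition _ := Order.SubChoice_isSubLattice.Build
  ring_display (ambient XX) sum_pred ring_display sum_space
  sum_pred_meet sum_pred_join.

Lemma sum_space_leD2r (z x y : sum_space) : x <= y -> x + z <= y + z.
Proof. by rewrite !leEsub !raddfD; exact: vl_leD2r. Qed.

Lemma sum_space_leZ (a : R) (x y : sum_space) :
  0 <= a -> x <= y -> a *: x <= a *: y.
Proof. by rewrite !leEsub !linearZ; exact: vl_leZ. Qed.

HB.instance Definition _ :=
  isVectorLattice.Build R sum_space
    (@lexx _ sum_space) (@le_anti _ sum_space) (@le_trans _ sum_space)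
    (@lexI _ sum_space) (@leUx _ sum_space) sum_space_leD2r sum_space_leZ.

Lemma sum_in0_subproof x0 : emb0 XX x0 \in sum_pred.
Proof. by apply/sum_predP; exists x0, 0; rewrite linear0 addr0. Qed.

Lemma sum_in1_subproof x1 : emb1 XX x1 \in sum_pred.
Proof. by apply/sum_predP; exists 0, x1; rewrite linear0 add0r. Qed.

Definition sum_in0 (x0 : X0) : sum_space := SumSpace (sum_in0_subproof x0).
Definition sum_in1 (x1 : X1) : sum_space := SumSpace (sum_in1_subproof x1).

Definition sum_qnorm (x : sum_space) : R :=
  inf [set r | exists x0 x1,
    x = sum_in0 x0 + sum_in1 x1 /\ r = qnorm x0 + qnorm x1].

(* The intersection of X0 and X1 inside X0 + X1. *)
Definition pair_cap : set sum_space := range sum_in0 `&` range sum_in1.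

End SumSpace.

Section PairOperator.
Context {R : realType} {X0 X1 Y0 Y1 : quasiBanachLatticeType R}.

Record pair_operator (XX : compatible_pair X0 X1) (YY : compatible_pair Y0 Y1)
    (T : {linear sum_space XX -> sum_space YY}) : Prop := {
  pair_operator_bounded :
    exists K, forall x, sum_qnorm (T x) <= K * sum_qnorm x ;
  pair_operator_bounded0 : exists K, forall x0, exists2 y0,
    T (sum_in0 XX x0) = sum_in0 YY y0 & qnorm y0 <= K * qnorm x0 ;
  pair_operator_bounded1 : exists K, forall x1, exists2 y1,
    T (sum_in1 XX x1) = sum_in1 YY y1 & qnorm y1 <= K * qnorm x1
}.

End PairOperator.

Section Regular.
Context {R : realType}.

Definition bounded_operator (E F : quasiBanachLatticeType R)
    (T : {linear E -> F}) : Prop :=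
  exists K, forall x, qnorm (T x) <= K * qnorm x.

Definition operator_qnorm (E F : quasiBanachLatticeType R)
    (T : {linear E -> F}) : R :=
  sup [set qnorm (T x) | x in [set x | qnorm x <= 1]].

(* The iterated join starts from 0, which is harmless because moduli are
   nonnegative. *)
Definition regular_infty1_constant (E F : quasiBanachLatticeType R)
    (T : {linear E -> F}) (K : R) : Prop :=
  forall n (x : 'I_n -> E),
    qnorm (\big[Order.join/0]_(i < n) vabs (T (x i))) <=
    K * qnorm (\sum_(i < n) vabs (x i)).

Definition regular_infty1 (E F : quasiBanachLatticeType R)
    (T : {linear E -> F}) : Prop :=
  exists2 K, 0 < K & regular_infty1_constant T K.

Definition rho_infty1 (E F : quasiBanachLatticeType R) (T : {linear E -> F}) : R :=
  inf [set K | 0 < K /\ regular_infty1_constant T K].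

Definition K_infty1_property (F : quasiBanachLatticeType R) : Prop :=
  exists2 C, 0 < C &
    forall (E : quasiBanachLatticeType R) (T : {linear E -> F}),
      bounded_operator T ->
      regular_infty1 T /\ rho_infty1 T <= C * operator_qnorm T.

End Regular.

Section FunctionalCalculus.
Context {R : realType}.

(* Only the values on the open quadrant matter. *)
Record class_P (phi : R -> R -> R) : Prop := {
  class_P_ge0 : forall s t, 0 < s -> 0 < t -> 0 <= phi s t ;
  class_P_homogeneous : forall l s t, 0 < l -> 0 < s -> 0 < t ->
    phi (l * s) (l * t) = l * phi s t ;
  class_P_homol : forall s s' t, 0 < s -> 0 < t -> s <= s' ->
    phi s t <= phi s' t ;
  class_P_homor : forall s t t', 0 < s -> 0 < t -> t <= t' ->
    phi s t <= phi s t' ;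
  class_P_normalized : phi 1 1 = 1
}.

(* The continuous extension of phi to the closed quadrant. *)
Definition extension (phi : R -> R -> R) (s t : R) : R :=
  lim ((fun z : R * R => phi z.1 z.2) @
       within [set z : R * R | 0 < z.1 /\ 0 < z.2] (nbhs (s, t))).

Definition principal_ideal (V : vectorLatticeType R) (e : V) : set V :=
  [set x | exists2 n : R, 0 <= n & vabs x <= n *: e].

(* h restricts to a lattice isomorphism of the ideal generated by e onto
   C(Omega) sending e to 1. *)
Record ideal_isomorphism (V : vectorLatticeType R) (e : V)
    (Omega : topologicalType) (h : V -> Omega -> R) : Prop := {
  ideal_iso_bij :
    set_bij (principal_ideal e) [set f : Omega -> R | continuous f] h ;
  ideal_iso_linear : forall (a : R) x y w,
    principal_ideal e x -> principal_ideal e y ->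
    h (a *: x + y) w = a * h x w + h y w ;
  ideal_iso_join : forall x y w,
    principal_ideal e x -> principal_ideal e y ->
    h (Order.join x y) w = Num.max (h x w) (h y w) ;
  ideal_iso_meet : forall x y w,
    principal_ideal e x -> principal_ideal e y ->
    h (Order.meet x y) w = Num.min (h x w) (h y w) ;
  ideal_iso_unit : forall w, h e w = 1
}.

(* functional_calculus phi x0 x1 y means y = phi(x0, x1), for x0, x1 >= 0. *)
Definition functional_calculus (V : vectorLatticeType R) (phi : R -> R -> R)
    (x0 x1 y : V) : Prop :=
  exists (Omega : topologicalType) (h : V -> Omega -> R),
    [/\ compact [set: Omega], hausdorff_space Omega,
        ideal_isomorphism (Order.join x0 x1) h,
        principal_ideal (Order.join x0 x1) y &
        forall w, h y w = extension phi (h x0 w) (h x1 w)].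

End FunctionalCalculus.

Section CalderonLozanovskii.
Context {R : realType} {X0 X1 : quasiBanachLatticeType R}.
Variables (phi : R -> R -> R) (XX : compatible_pair X0 X1).

Definition CL_space : set (sum_space XX) :=
  [set x | exists (x0 : X0) (x1 : X1) (y : sum_space XX),
    [/\ 0 <= x0, 0 <= x1,
        functional_calculus phi (sum_in0 XX x0) (sum_in1 XX x1) y &
        vabs x <= y]].

Definition CL_qnorm (x : sum_space XX) : R :=
  inf [set l : R | 0 < l /\ exists (x0 : X0) (x1 : X1) (y : sum_space XX),
    [/\ 0 <= x0, 0 <= x1, qnorm x0 <= 1 /\ qnorm x1 <= 1,
        functional_calculus phi (sum_in0 XX x0) (sum_in1 XX x1) y &
        vabs x <= l *: y]].

Definition CL0_space : set (sum_space XX) :=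
  [set x | CL_space x /\ forall e : R, 0 < e ->
    exists2 z, pair_cap z & CL_qnorm (x - z) < e].

End CalderonLozanovskii.

(* Main.v *)
(* For x in the intersection of X0 and X1 with |x| <= phi(x0, x1), the ratio x1 / x0
   may be truncated to a compact interval. Choosing nodes c_j along which phi(1, c_j)
   grows and phi(1, c_j) / c_j decays geometrically, one writes x as a finite sum of
   phi(1, c_j) v_j where sum |v_j| and sum c_j |v_j| are controlled by x0 and x1. Then
   y0 = sup |T v_j| and y1 = sup c_j |T v_j| are bounded in Y0 and Y1 by
   (infinity,1)-regularity, and |T x| <= sum phi(1, c_j) min(y0, y1 / c_j), which is
   O(phi(y0, y1)) by the geometric growth along the nodes. The bound passes to the
   closure of the intersection by summing a fast approximating sequence. The values
   phi(y0, y1) exist because principal ideals of Y0 + Y1 are uniformly complete, hence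
   of the form C(Omega) by Kakutani's theorem. *)
Require Import Defs.
From HB Require Import structures.
From mathcomp Require Import all_boot all_order all_algebra.
From mathcomp Require Import boolp classical_sets functions set_interval reals.
From mathcomp Require Import topology normedtype.
From mathcomp Require Import ring lra.

Set Implicit Arguments.
Unset Strict Implicit.
Unset Printing Implicit Defensive.

Import Order.TTheory GRing.Theory Num.Theory.
Import numFieldNormedType.Exports.

Local Open Scope classical_set_scope.
Local Open Scope ring_scope.

(** * Vector lattices *)

(** Regularity concerns finite families, with a constant blind to their length, so every other
    estimate must also be independent of the number of nodes. All dyadic points would not do; this
    is why the nodes are thinned out until [phi 1 c] and [phi 1 c / c] both vary geometrically.
    Lying in the intersection is what makes the family finite: [|x|] belongs to both spaces, so [x0]
    and [x1] may be joined with [eps |x|] at bounded cost in quasi-norm, and cutting them at [M |x|]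
    loses only a factor 2 in phi. Both [eps] and [M] depend on [x], the final constant does not. Two
    obstacles shape the rest. The quasi-triangle inequality makes constants accumulate in infinite
    sums, so series carry geometric weights adapted to its constant, and telescoping is done in the
    order whenever possible. The functional calculus is a relation that allows any representation of
    the ideal; values coming from different ideals are compared through the infimum over r of
    [phi 1 r] times the join of x0 and x1 / r, which does not mention a representation. *)

Section VectorLatticeBasics.
Context {R : realType} {V : vectorLatticeType R}.
Implicit Types (x y z : V) (a b : R).

Lemma vabs_le x y : (vabs x <= y) = (x <= y) && (- x <= y).
Proof. exact: leUx. Qed.

Lemma vabs_geN x : - x <= vabs x. Proof. exact: leUr. Qed.

Lemma vabsN x : vabs (- x) = vabs x.
Proof. by rewrite /vabs opprK joinC. Qed.

Lemma ge0_vabs x : 0 <= x -> vabs x = x.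
Proof.
by move=> x0; apply: join_l; apply: (le_trans _ x0); rewrite -[X in _ <= X]oppr0 vl_leN.
Qed.

Lemma vabs0 : vabs (0 : V) = 0. Proof. exact: ge0_vabs. Qed.

Lemma vabs_vabs x : vabs (vabs x) = vabs x.
Proof. exact/ge0_vabs/vabs_ge0. Qed.

Lemma vabs_le0 x : vabs x <= 0 -> x = 0.
Proof.
rewrite vabs_le => /andP[x0 nx0]; apply/le_anti; rewrite x0 /=.
by rewrite -vl_leN oppr0.
Qed.

Lemma vabsD x y : vabs (x + y) <= vabs x + vabs y.
Proof. by rewrite vabs_le opprD !vl_leD ?vabs_ge ?vabs_geN. Qed.

Lemma vabs_distrC x y : vabs (x - y) = vabs (y - x).
Proof. by rewrite -vabsN opprB. Qed.

Lemma vl_scale_joinr a x y :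
  0 <= a -> a *: Order.join x y = Order.join (a *: x) (a *: y).
Proof.
move=> a0; have [->|an0] := eqVneq a 0; first by rewrite !scale0r joinxx.
apply/le_anti/andP; split; last by rewrite leUx !vl_leZ ?leUl ?leUr.
rewrite -[X in _ <= X]scale1r -(mulfV an0) -scalerA vl_leZ// leUx.
have ai0 : 0 <= a^-1 by rewrite invr_ge0.
apply/andP; split.
  by rewrite -[X in X <= _]scale1r -(mulVf an0) -scalerA vl_leZ// leUl.
by rewrite -[X in X <= _]scale1r -(mulVf an0) -scalerA vl_leZ// leUr.
Qed.

Lemma vl_meetE x y : Order.meet x y = - Order.join (- x) (- y).
Proof. by rewrite vl_joinN !opprK. Qed.

Lemma vabsZ a x : vabs (a *: x) = `|a| *: vabs x.
Proof.
have [a0|a0] := leP 0 a; rewrite /vabs vl_scale_joinr// scalerN.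
  by rewrite ger0_norm.
have -> : - (`|a| *: x) = a *: x by rewrite -scaleNr ltr0_norm// opprK.
by rewrite ltr0_norm// scaleNr joinC.
Qed.

Lemma vl_leZl a b x : 0 <= x -> a <= b -> a *: x <= b *: x.
Proof.
move=> x0 ab; rewrite -vl_subr_ge0 -scalerBl -[X in X <= _](scaler0 _ (b - a)).
by rewrite vl_leZ// subr_ge0.
Qed.

Lemma vl_scale_ge0 a x : 0 <= a -> 0 <= x -> 0 <= a *: x.
Proof. by move=> a0 x0; rewrite -[X in X <= _](scaler0 _ a) vl_leZ. Qed.

Lemma vl_add_ge0 x y : 0 <= x -> 0 <= y -> 0 <= x + y.
Proof. by move=> x0 y0; rewrite -[X in X <= _]addr0 vl_leD. Qed.

Lemma vl_leDl x y : 0 <= y -> x <= x + y.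
Proof. by move=> y0; rewrite -[X in X <= _]addr0 vl_leD. Qed.

Lemma vl_leDr x y : 0 <= y -> x <= y + x.
Proof. by rewrite addrC; exact: vl_leDl. Qed.

Lemma vl_sum_le I (r : seq I) (P : pred I) (F G : I -> V) :
  (forall i, P i -> F i <= G i) ->
  \sum_(i <- r | P i) F i <= \sum_(i <- r | P i) G i.
Proof.
by move=> FG; elim/big_ind2 : _ => // x1 y1 x2 y2 h1 h2; exact: vl_leD.
Qed.

Lemma vl_sum_ge0 I (r : seq I) (P : pred I) (F : I -> V) :
  (forall i, P i -> 0 <= F i) -> 0 <= \sum_(i <- r | P i) F i.
Proof. by move=> F0; elim/big_ind : _ => // x y; exact: vl_add_ge0. Qed.

Lemma vabs_sum I (r : seq I) (P : pred I) (F : I -> V) :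
  vabs (\sum_(i <- r | P i) F i) <= \sum_(i <- r | P i) vabs (F i).
Proof.
elim/big_ind2 : _ => [|x1 y1 x2 y2 h1 h2|//]; first by rewrite vabs0.
exact: (le_trans (vabsD _ _) (vl_leD h1 h2)).
Qed.

Lemma vl_riesz_sum I (r : seq I) (w : V) (p : I -> V) :
  0 <= w -> (forall i, 0 <= p i) -> w <= \sum_(i <- r) p i ->
  exists u : seq V, [/\ size u = size r, w = \sum_(v <- u) v &
    forall k, (k < size r)%N -> forall i0, 0 <= u`_k <= p (nth i0 r k)].
Proof.
move=> + p0; elim: r w => [|i r IH] w w0.
  rewrite big_nil => w0'; exists [::]; split => //; rewrite big_nil.
  by apply/le_anti; rewrite w0 w0'.
rewrite big_cons => wle.
have [] := riesz_decomposition w0 (p0 i) _ wle.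
  by apply: vl_sum_ge0.
move=> a [b [wE aI /andP[b0 bI]]].
have [u [su bE uP]] := IH _ b0 bI; exists (a :: u); split.
- by rewrite /= su.
- by rewrite big_cons -bE.
- by case=> [|k] //= kr i0; exact: uP.
Qed.

(** The positive and negative parts of [x] are decomposed separately. Since [u i] and [v i] both lie
    between 0 and [p i], their difference is bounded by [p i] and no factor 2 appears. *)
Lemma vl_riesz_signed n (x : V) (p : 'I_n -> V) :
  (forall i, 0 <= p i) -> vabs x <= \sum_i p i ->
  exists u : 'I_n -> V, x = \sum_i u i /\ forall i, vabs (u i) <= p i.
Proof.
move=> p0 xp.
pose xp' := Order.join x 0; pose xn := Order.join (- x) 0.
have xpn : x = xp' - xn.
  have <- : xn + x = xp' by rewrite /xn vl_joinDr addNr add0r joinC.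
  by rewrite addrAC subrr add0r.
have ap0 : 0 <= xp' by rewrite leUr.
have an0 : 0 <= xn by rewrite leUr.
have lep : xp' <= \sum_i p i.
  by rewrite leUx (le_trans (vabs_ge x))//= vl_sum_ge0.
have len : xn <= \sum_i p i.
  by rewrite leUx (le_trans (vabs_geN x))//= vl_sum_ge0.
have [u [su uE uP]] := vl_riesz_sum ap0 p0 lep.
have [v [sv vE vP]] := vl_riesz_sum an0 p0 len.
have sE : size (index_enum 'I_n) = n by rewrite -[index_enum _]enumT size_enum_ord.
rewrite sE in su sv.
exists (fun i => u`_i - v`_i); split.
  rewrite sumrB {1}xpn; congr (_ - _).
    by rewrite {1}uE (big_nth 0) su big_mkord.
  by rewrite {1}vE (big_nth 0) sv big_mkord.
move=> i; have /= ni : nth i (index_enum 'I_n) i = i.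
  by rewrite -[index_enum _]enumT nth_ord_enum.
have /= := uP i; rewrite sE => /(_ (ltn_ord i) i); rewrite ni => /andP[u0 up].
have /= := vP i; rewrite sE => /(_ (ltn_ord i) i); rewrite ni => /andP[v0 vp].
rewrite vabs_le opprB !vl_leBlDr; apply/andP; split.
  by apply: (le_trans up); exact: vl_leDl.
by apply: (le_trans vp); exact: vl_leDl.
Qed.

End VectorLatticeBasics.

Definition vl_archimedean {R : realType} (V : vectorLatticeType R) : Prop :=
  forall x z : V, (forall e : R, 0 < e -> x <= e *: z) -> x <= 0.

(** Relative uniform completeness, tested on geometrically fast sequences; the rate for the limit is
    the tail of the geometric series. *)
Definition uniformly_complete {R : realType} (V : vectorLatticeType R) : Prop :=
  forall (e : V) (u : nat -> V), 0 <= e ->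
    (forall n, vabs (u n.+1 - u n) <= 2^-1 ^+ n *: e) ->
    exists x, forall n, vabs (x - u n) <= (2 * 2^-1 ^+ n) *: e.

(** * Kakutani representation of principal ideals *)

Section PrincipalIdeal.
Context {R : realType} {V : vectorLatticeType R} (e : V).
Hypothesis e0 : 0 <= e.
Local Notation I := (principal_ideal e).

Lemma pid_solid x y : vabs x <= vabs y -> I y -> I x.
Proof. by move=> xy [n n0 yn]; exists n => //; exact: le_trans yn. Qed.

Lemma pid_le x y : 0 <= x -> x <= y -> I y -> I x.
Proof.
move=> x0 xy; apply: pid_solid; rewrite ge0_vabs//.
by rewrite ge0_vabs// (le_trans x0).
Qed.

Lemma pid0 : I 0.
Proof. by exists 0 => //; rewrite scale0r vabs0. Qed.

Lemma pid_unit : I e.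
Proof. by exists 1 => //; rewrite scale1r ge0_vabs. Qed.

Lemma pidZ a x : I x -> I (a *: x).
Proof.
move=> [n n0 xn]; exists (`|a| * n); first by rewrite mulr_ge0.
by rewrite vabsZ -scalerA vl_leZ.
Qed.

Lemma pidD x y : I x -> I y -> I (x + y).
Proof.
move=> [n n0 xn] [m m0 ym]; exists (n + m); first by rewrite addr_ge0.
by rewrite scalerDl (le_trans (vabsD _ _))// vl_leD.
Qed.

Lemma pidN x : I x -> I (- x).
Proof. by rewrite -scaleN1r; exact: pidZ. Qed.

Lemma pidB x y : I x -> I y -> I (x - y).
Proof. by move=> Ix /pidN; exact: pidD. Qed.

Lemma pid_vabs x : I x -> I (vabs x).
Proof. by apply: pid_solid; rewrite vabs_vabs. Qed.

Lemma pid_join x y : I x -> I y -> I (Order.join x y).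
Proof.
move=> Ix Iy; apply: (@pid_solid _ (vabs x + vabs y)); last first.
  by apply: pidD; exact: pid_vabs.
rewrite [X in _ <= X]ge0_vabs ?vl_add_ge0 ?vabs_ge0// vabs_le leUx.
rewrite (le_trans (vabs_ge x)) ?vl_leDl ?vabs_ge0//=.
rewrite (le_trans (vabs_ge y)) ?vl_leDr ?vabs_ge0//=.
apply: (@le_trans _ _ (- x)); first by rewrite vl_leN leUl.
by rewrite (le_trans (vabs_geN x)) ?vl_leDl ?vabs_ge0.
Qed.

Lemma pid_meet x y : I x -> I y -> I (Order.meet x y).
Proof. by move=> Ix Iy; rewrite vl_meetE; apply/pidN/pid_join; exact/pidN. Qed.

End PrincipalIdeal.

(** * Lattice homomorphisms on a principal ideal, by Zorn's lemma *)

Section Gauge.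
Context {R : realType} {V : vectorLatticeType R} (e : V).
Hypothesis e0 : 0 <= e.
Hypothesis en0 : e <> 0.
Local Notation I := (principal_ideal e).

(** In the representation this is the maximum of the function itself, not of its modulus, so it may
    be negative. *)
Definition unit_gauge (x : V) : R := inf [set n | x <= n *: e].

(* Gauges are the suprema of nonempty families of lattice homomorphisms
   normalized at e; the minimal ones are the homomorphisms themselves. *)
Record gauge (q : V -> R) : Prop := {
  gaugeD : forall x y, I x -> I y -> q (x + y) <= q x + q y ;
  gaugeZ : forall a x, 0 <= a -> I x -> q (a *: x) <= a * q x ;
  gauge_join : forall x y, I x -> I y ->
    q (Order.join x y) <= Num.max (q x) (q y) ;
  gauge_le : forall x, I x -> q x <= unit_gauge x
}.

Lemma scale_unit_ge0 a : 0 <= a *: e -> 0 <= a.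
Proof.
move=> ae; have [//|a0] := leP 0 a; exfalso; apply: en0.
have ai : 0 <= (- a)^-1 by rewrite invr_ge0 oppr_ge0 ltW.
have := vl_leZ ai ae; rewrite scaler0 scalerA invrN mulNr mulVf ?lt_eqF//.
by rewrite scaleN1r -vl_leN oppr0 opprK => en; apply/le_anti; rewrite e0 en.
Qed.

Lemma unit_gauge_has_inf x : I x -> has_inf [set n | x <= n *: e].
Proof.
move=> [N N0 xN]; split; first by exists N; rewrite /= (le_trans (vabs_ge x)).
exists (- N) => n /= xn; rewrite -subr_ge0 opprK; apply: scale_unit_ge0.
by rewrite scalerDl -(subrr x) vl_leD// (le_trans (vabs_geN x)).
Qed.

Lemma unit_gauge_ub x n : I x -> x <= n *: e -> unit_gauge x <= n.
Proof. by move=> /unit_gauge_has_inf[_ lb] xn; apply: ge_inf. Qed.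

Lemma unit_gauge_lt x n : I x -> unit_gauge x < n -> x <= n *: e.
Proof.
move=> Ix; rewrite -subr_gt0 => /(inf_adherent)/(_ (unit_gauge_has_inf Ix)).
move=> [m /= xm]; rewrite addrC subrK => mn; apply: (le_trans xm).
by rewrite vl_leZl// ltW.
Qed.

(** The unit gauge, the faces and the infima of chains are all infima of sets of reals; this reduces
    their gauge axioms to inequalities between chosen elements of those sets. *)
Lemma gauge_inf (S : V -> set R) :
  (forall x, I x -> has_inf (S x)) ->
  (forall x y n m, I x -> I y -> S x n -> S y m ->
     exists2 k, S (x + y) k & k <= n + m) ->
  (forall a x n, 0 <= a -> I x -> S x n -> exists2 k, S (a *: x) k & k <= a * n) ->
  (forall x y n m, I x -> I y -> S x n -> S y m ->
     exists2 k, S (Order.join x y) k & k <= Num.max n m) ->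
  (forall x, I x -> inf (S x) <= unit_gauge x) ->
  gauge (fun x => inf (S x)).
Proof.
move=> Sinf SD SZ SU Sle.
have infle x k : I x -> S x k -> inf (S x) <= k.
  by move=> /Sinf[_ lb] Sk; exact: ge_inf.
have adh x (d : R) : I x -> 0 < d -> exists2 n, S x n & n < inf (S x) + d.
  by move=> Ix d0; exact: inf_adherent (Sinf _ Ix).
split=> [x y Ix Iy|a x a0 Ix|x y Ix Iy|//].
- apply/ler_addgt0Pr => d d0; have d2 : 0 < d / 2 by rewrite divr_gt0.
  have [n Sn nd] := adh _ _ Ix d2; have [m Sm md] := adh _ _ Iy d2.
  have [k Sk kle] := SD _ _ _ _ Ix Iy Sn Sm.
  apply: (le_trans (infle _ _ (pidD Ix Iy) Sk)); lra.
- have [az|an0] := eqVneq a 0.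
    have [[n Sn] _] := Sinf _ Ix; have [k Sk kle] := SZ _ _ _ a0 Ix Sn.
    apply: (le_trans (infle _ _ (pidZ _ Ix) Sk)).
    by rewrite (le_trans kle)// az !mul0r.
  have a1 : 0 < a by rewrite lt_neqAle eq_sym an0.
  apply/ler_addgt0Pr => d d0; have d2 : 0 < d / a by rewrite divr_gt0.
  have [n Sn nd] := adh _ _ Ix d2; have [k Sk kle] := SZ _ _ _ a0 Ix Sn.
  apply: (le_trans (infle _ _ (pidZ _ Ix) Sk)); apply: (le_trans kle).
  by rewrite -(ler_pdivlMl _ _ a1) mulrDr mulKf// [_ * d]mulrC ltW.
- apply/ler_addgt0Pr => d d0.
  have [n Sn nd] := adh _ _ Ix d0; have [m Sm md] := adh _ _ Iy d0.
  have [k Sk kle] := SU _ _ _ _ Ix Iy Sn Sm.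
  apply: (le_trans (infle _ _ (pid_join Ix Iy) Sk)); apply: (le_trans kle).
  by rewrite addr_maxl ge_max !le_max (ltW nd) (ltW md) orbT.
Qed.

Lemma unit_gauge_gauge : gauge unit_gauge.
Proof.
apply: (@gauge_inf (fun x => [set n | x <= n *: e])) => //=.
- by move=> x; exact: unit_gauge_has_inf.
- by move=> x y n m _ _ xn ym; exists (n + m) => //; rewrite scalerDl vl_leD.
- by move=> a x n a0 _ xn; exists (a * n) => //; rewrite -scalerA vl_leZ.
- move=> x y n m _ _ xn ym; exists (Num.max n m) => //.
  rewrite leUx (le_trans xn) ?(le_trans ym)// vl_leZl//.
    by rewrite le_max lexx orbT.
  by rewrite le_max lexx.
Qed.

Section GaugeProps.
Variables (q : V -> R) (qG : gauge q).

Lemma gauge0 : q 0 = 0.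
Proof.
apply/le_anti/andP; split.
  by have := gaugeZ qG (lexx 0) (pid0 e); rewrite mul0r scale0r.
by have := gaugeD qG (pid0 e) (pid0 e); rewrite addr0; lra.
Qed.

(** The bound does not depend on [q], so the infimum of a chain of gauges is finite. *)
Lemma gauge_lb x : I x -> - unit_gauge (- x) <= q x.
Proof.
move=> Ix; have := gaugeD qG Ix (pidN Ix); rewrite subrr gauge0.
have := gauge_le qG (pidN Ix); lra.
Qed.

Lemma gaugeZE a x : 0 <= a -> I x -> q (a *: x) = a * q x.
Proof.
move=> a0 Ix; have [->|an0] := eqVneq a 0; first by rewrite scale0r mul0r gauge0.
have a1 : 0 < a by rewrite lt_neqAle eq_sym an0.
apply/le_anti; rewrite (gaugeZ qG)//= -(ler_pdivlMl _ _ a1).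
have ai : 0 <= a^-1 by rewrite invr_ge0.
rewrite -{1}[x]scale1r -{1}(mulVf an0) -scalerA.
by apply: (gaugeZ qG) => //; exact: pidZ.
Qed.

(* Restricts the supremum q to the homomorphisms that attain it at u. *)
Definition gauge_face (u x : V) : R :=
  inf [set q (x + t *: u) - t * q u | t in [set t | 0 <= t]].

Lemma gauge_face_has_inf u x : I u -> I x ->
  has_inf [set q (x + t *: u) - t * q u | t in [set t | 0 <= t]].
Proof.
move=> Iu Ix; split; first by exists (q (x + 0 *: u) - 0 * q u); exists 0 => /=.
exists (- q (- x)) => _ [t /= t0 <-].
have := gaugeD qG (pidD Ix (pidZ t Iu)) (pidN Ix).
by rewrite addrAC subrr add0r gaugeZE//; lra.
Qed.

Lemma gauge_face_le u x t : I u -> I x -> 0 <= t ->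
  gauge_face u x <= q (x + t *: u) - t * q u.
Proof.
by move=> Iu Ix t0; have [_ lb] := gauge_face_has_inf Iu Ix; apply: ge_inf => //; exists t.
Qed.

Lemma gauge_face_gauge u : I u -> gauge (gauge_face u).
Proof.
move=> Iu; apply: gauge_inf.
- by move=> x; exact: gauge_face_has_inf.
- move=> x y _ _ Ix Iy [t /= t0 <-] [s /= s0 <-].
  exists (q (x + y + (t + s) *: u) - (t + s) * q u).
    by exists (t + s) => //=; rewrite addr_ge0.
  have := gaugeD qG (pidD Ix (pidZ t Iu)) (pidD Iy (pidZ s Iu)).
  by rewrite scalerDl [x + y + _]addrACA; lra.
- move=> a x _ a0 Ix [t /= t0 <-].
  exists (q (a *: x + (a * t) *: u) - (a * t) * q u).
    by exists (a * t) => //=; rewrite mulr_ge0.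
  rewrite -scalerA -scalerDr mulrBr mulrA lerD2r.
  by apply: (gaugeZ qG) => //; exact: pidD (pidZ _ _).
- move=> x y _ _ Ix Iy [t /= t0 <-] [s /= s0 <-].
  pose T := Num.max t s; have T0 : 0 <= T by rewrite le_max t0.
  exists (q (Order.join x y + T *: u) - T * q u); first by exists T.
  (* The expression defining the face is nonincreasing in its parameter, so the larger parameter [T]
     serves both [x] and [y]. *)
  have mono z r : I z -> 0 <= r -> r <= T ->
      q (z + T *: u) - T * q u <= q (z + r *: u) - r * q u.
    move=> Iz r0 rT; have -> : z + T *: u = (z + r *: u) + (T - r) *: u.
      by rewrite -addrA -scalerDl addrC [r + _]addrC subrK addrC.
    have Tr : 0 <= T - r by rewrite subr_ge0.
    have := gaugeD qG (pidD Iz (pidZ r Iu)) (pidZ (T - r) Iu).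
    by rewrite (gaugeZE Tr Iu); lra.
  rewrite vl_joinDr.
  have tT : t <= T by rewrite le_max lexx.
  have sT : s <= T by rewrite le_max lexx orbT.
  have h3 := gauge_join qG (pidD Ix (pidZ T Iu)) (pidD Iy (pidZ T Iu)).
  have hx := mono _ _ Ix t0 tT; have hy := mono _ _ Iy s0 sT.
  rewrite le_max; move: h3; rewrite le_max => /orP[h3|h3]; apply/orP.
    by left; lra.
  by right; lra.
- move=> x Ix; apply: le_trans (gauge_le qG Ix).
  by have := gauge_face_le Iu Ix (lexx 0); rewrite scale0r addr0 mul0r subr0.
Qed.

End GaugeProps.

Lemma gauge_minimal (q0 : V -> R) : gauge q0 -> exists q : V -> R,
  [/\ gauge q, forall x, I x -> q x <= q0 x &
      forall r, gauge r -> (forall x, I x -> r x <= q x) ->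
                forall x, I x -> q x <= r x].
Proof.
move=> q0G.
pose G (q : V -> R) := gauge q /\ forall x, I x -> q x <= q0 x.
pose T := {q | G q}.
(* The order is reversed: the maximal element provided by Zorn's lemma is a minimal gauge. *)
pose Ord (q r : T) : bool := `[< forall x, I x -> sval r x <= sval q x >].
have t0 : T by exists q0; split => // x _.
have [| | |[q [qG qq0]] qmin] := @ZL_preorder T t0 Ord.
- by move=> t; apply/asboolP.
- move=> r s t /asboolP rs /asboolP st; apply/asboolP => x Ix.
  exact: le_trans (st _ Ix) (rs _ Ix).
- move=> A Atot.
  have [[a Aa]|A0] := pselect (exists a, A a); last first.
    by exists t0 => s As; exfalso; apply: A0; exists s.
  pose S x := [set sval s x | s in A].
  have Slb x : I x -> has_inf (S x).
    move=> Ix; split; first by exists (sval a x); exists a.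
    by exists (- unit_gauge (- x)) => _ [[s [sG ?]] _ <-]; exact: gauge_lb.
  have Sle x s : I x -> A s -> inf (S x) <= sval s x.
    by move=> Ix As; have [_ lb] := Slb _ Ix; apply: ge_inf => //; exists s.
  have common s t : A s -> A t ->
      exists2 r, A r & forall x, I x -> sval r x <= sval s x /\ sval r x <= sval t x.
    by move=> As At; have [/asboolP h|/asboolP h] := Atot _ _ As At;
      [exists t|exists s] => // x Ix; split => //; exact: h.
  have SG : gauge (fun x => inf (S x)).
    apply: gauge_inf => //.
    - move=> x y _ _ Ix Iy [s As <-] [t At <-].
      have [r Ar rP] := common _ _ As At; exists (sval r (x + y)); first by exists r.
      have [rG _] := svalP r; apply: (le_trans (gaugeD rG Ix Iy)).
      by have [rx _] := rP _ Ix; have [_ ry] := rP _ Iy; lra.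
    - move=> b x _ b0 Ix [s As <-]; exists (sval s (b *: x)); first by exists s.
      by have [sG _] := svalP s; exact: (gaugeZ sG).
    - move=> x y _ _ Ix Iy [s As <-] [t At <-].
      have [r Ar rP] := common _ _ As At.
      exists (sval r (Order.join x y)); first by exists r.
      have [rG _] := svalP r; apply: (le_trans (gauge_join rG Ix Iy)).
      have [rx _] := rP _ Ix; have [_ ry] := rP _ Iy.
      by rewrite ge_max !le_max rx ry orbT.
    - move=> x Ix; have [aG _] := svalP a.
      exact: le_trans (Sle _ _ Ix Aa) (gauge_le aG Ix).
  have SP : gauge (fun x => inf (S x)) /\ forall x, I x -> inf (S x) <= q0 x.
    split => // x Ix; have [_ aq] := svalP a.
    exact: le_trans (Sle _ _ Ix Aa) (aq _ Ix).
  by exists (exist G _ SP) => s As; apply/asboolP => x Ix /=; exact: Sle.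
- exists q; split => // r rG rq.
  have rP : gauge r /\ forall x, I x -> r x <= q0 x.
    by split => // x Ix; exact: le_trans (rq _ Ix) (qq0 _ Ix).
  have := qmin (exist G r rP); rewrite /Ord /= => h.
  by have /asboolP := h (asboolT rq).
Qed.

(** Setting the value to 0 outside the ideal makes a homomorphism determined by its restriction, so
    that homomorphisms are points of a power of the real line. *)
Record ideal_hom (w : V -> R) : Prop := {
  ideal_homP : forall a x y, I x -> I y -> w (a *: x + y) = a * w x + w y ;
  ideal_hom_join : forall x y, I x -> I y -> w (Order.join x y) = Num.max (w x) (w y) ;
  ideal_hom_unit : w e = 1 ;
  ideal_hom_out : forall x, ~ I x -> w x = 0
}.

(** A minimal gauge [q] lies below each of its own faces. For the face at [x], evaluated at [- x]
    with parameter 1, this gives [q (- x) <= - q x]; hence [q] is odd, therefore linear and a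
    homomorphism. Choosing [q] below the face of the unit gauge at [u] forces
    [q (- u) <= - unit_gauge u], which fixes the value at [u]. *)
Lemma ideal_hom_exists u : I u -> exists2 w, ideal_hom w & w u = unit_gauge u.
Proof.
move=> Iu.
have pG := unit_gauge_gauge.
have [q [qG qle qmin]] := gauge_minimal (gauge_face_gauge pG Iu).
have qN x : I x -> q (- x) = - q x.
  move=> Ix; have := qmin _ (gauge_face_gauge qG Ix).
  have qf y : I y -> gauge_face q x y <= q y.
    move=> Iy; have := gauge_face_le qG Ix Iy (lexx 0).
    by rewrite scale0r addr0 mul0r subr0.
  move=> /(_ qf _ (pidN Ix)) h1.
  have := gauge_face_le qG Ix (pidN Ix) (ler01 : 0 <= 1 :> R).
  rewrite scale1r addNr (gauge0 qG) mul1r sub0r => h2.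
  have := gaugeD qG Ix (pidN Ix); rewrite subrr (gauge0 qG); lra.
have qD x y : I x -> I y -> q (x + y) = q x + q y.
  move=> Ix Iy; apply/le_anti; rewrite (gaugeD qG)//=.
  have := gaugeD qG (pidN Ix) (pidN Iy).
  rewrite -opprD !qN//; last exact: pidD.
  lra.
have qZ a x : I x -> q (a *: x) = a * q x.
  move=> Ix; have [a0|a0] := leP 0 a; first exact: gaugeZE.
  rewrite -[a]opprK scaleNr qN; last exact: pidZ.
  by rewrite (gaugeZE qG) ?oppr_ge0 ?mulNr// ltW.
have qmono x y : I x -> I y -> x <= y -> q x <= q y.
  move=> Ix Iy xy; have := gauge_le qG (pidB Ix Iy); rewrite qD ?qN//; last exact: pidN.
  have : unit_gauge (x - y) <= 0.
    apply: unit_gauge_ub; first exact: pidB.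
    by rewrite scale0r vl_leBlDr add0r.
  lra.
have Ie := pid_unit e0.
exists (fun x => if `[< I x >] then q x else 0).
  split.
  - move=> a x y Ix Iy; rewrite !asboolT//; last exact: pidD (pidZ _ _) _.
    by rewrite qD ?qZ//; exact: pidZ.
  - move=> x y Ix Iy; rewrite !asboolT//; last exact: pid_join.
    apply/le_anti; rewrite (gauge_join qG)//= ge_max.
    by rewrite !qmono ?leUl ?leUr//; exact: pid_join.
  - rewrite asboolT//; apply/le_anti/andP; split.
      by apply: le_trans (gauge_le qG Ie) _; apply: unit_gauge_ub; rewrite ?scale1r.
    rewrite -lerN2 -qN//; apply: le_trans (gauge_le qG (pidN Ie)) _.
    by apply: unit_gauge_ub; rewrite ?scaleN1r//; exact: pidN.
  - by move=> x nIx; rewrite asboolF.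
rewrite asboolT//; apply/le_anti; rewrite (gauge_le qG)//=.
have := qle _ (pidN Iu); rewrite qN//.
have := gauge_face_le pG Iu (pidN Iu) (ler01 : 0 <= 1 :> R).
rewrite scale1r addNr (gauge0 pG) mul1r; lra.
Qed.

End Gauge.

Lemma half_pow_lt {R : realType} (d : R) : 0 < d -> exists n, 2^-1 ^+ n < d.
Proof.
move=> d0; exists (Num.bound d^-1).
have di : 0 <= d^-1 by rewrite invr_ge0 ltW.
rewrite exprVn -[ltRHS]invrK ltf_pV2 ?posrE ?exprn_gt0 ?invr_gt0//.
apply: (lt_trans (archi_boundP di)).
by rewrite -natrX ltr_nat ltn_expl.
Qed.

Lemma half_pow_gt0 {R : realType} n : 0 < 2^-1 ^+ n :> R.
Proof. by rewrite exprn_gt0// invr_gt0. Qed.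

Lemma closure_zero {R : realType} (T : topologicalType) (F : T -> R) (A : set T) :
  continuous F -> (forall w, A w -> F w = 0) -> forall w, closure A w -> F w = 0.
Proof.
move=> /continuous_closedP /(_ [set 0] (@closed_eq _ 0)) cF FA w.
have /closureS h : A `<=` F @^-1` [set 0] by move=> v /FA.
by move=> /h /cF.
Qed.

Section RealContinuity.
Context {R : realType} {T : topologicalType}.
Implicit Types f g : T -> R.

Lemma rcontinuousD f g : continuous f -> continuous g ->
  continuous (fun w => f w + g w).
Proof. by move=> cf cg w; apply: cvgD; [exact: cf|exact: cg]. Qed.

Lemma rcontinuousB f g : continuous f -> continuous g ->
  continuous (fun w => f w - g w).
Proof. by move=> cf cg w; apply: cvgB; [exact: cf|exact: cg]. Qed.

Lemma rcontinuousZ a f : continuous f -> continuous (fun w => a * f w).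
Proof. by move=> cf w; apply: cvgM; [exact: cvg_cst|exact: cf]. Qed.

Lemma rcontinuous_max f g : continuous f -> continuous g ->
  continuous (fun w => Num.max (f w) (g w)).
Proof. by move=> cf cg w; apply: continuous_max; [exact: cf|exact: cg]. Qed.

Lemma rcontinuous_cst a : continuous ((fun=> a) : T -> R).
Proof. by move=> w; exact: cvg_cst. Qed.

End RealContinuity.

(** * The compact space of homomorphisms, and lattice Stone-Weierstrass *)

Section Kakutani.
Context {R : realType} {V : vectorLatticeType R} (e : V).
Hypotheses (e0 : 0 <= e) (VA : vl_archimedean V) (VU : uniformly_complete V).
Local Notation I := (principal_ideal e).

(** The spectrum of the ideal, with the topology of pointwise convergence. *)
Definition ideal_homs : set (prod_topology (fun _ : V => R)) := ideal_hom e.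

Lemma ideal_hom0 w : ideal_hom e w -> w 0 = 0.
Proof.
move=> wP; have := ideal_homP wP 1 (pid0 e) (pid0 e).
by rewrite scale1r addr0 mul1r; lra.
Qed.

Lemma ideal_homZ w a x : ideal_hom e w -> I x -> w (a *: x) = a * w x.
Proof.
move=> wP Ix; have := ideal_homP wP a Ix (pid0 e).
by rewrite addr0 (ideal_hom0 wP) addr0.
Qed.

Lemma ideal_homD w x y : ideal_hom e w -> I x -> I y -> w (x + y) = w x + w y.
Proof.
by move=> wP Ix Iy; have := ideal_homP wP 1 Ix Iy; rewrite scale1r mul1r.
Qed.

Lemma ideal_homN w x : ideal_hom e w -> I x -> w (- x) = - w x.
Proof. by move=> wP Ix; rewrite -scaleN1r (ideal_homZ _ wP)// mulN1r. Qed.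

Lemma ideal_homB w x y : ideal_hom e w -> I x -> I y -> w (x - y) = w x - w y.
Proof.
by move=> wP Ix Iy; rewrite (ideal_homD wP)// ?(ideal_homN wP)//; exact: pidN.
Qed.

Lemma ideal_hom_le w x y : ideal_hom e w -> I x -> I y -> x <= y -> w x <= w y.
Proof.
move=> wP Ix Iy xy; have := ideal_hom_join wP Ix Iy.
by rewrite (join_r xy) => ->; rewrite le_max lexx.
Qed.

Lemma ideal_hom_meet w x y : ideal_hom e w -> I x -> I y ->
  w (Order.meet x y) = Num.min (w x) (w y).
Proof.
move=> wP Ix Iy; rewrite vl_meetE (ideal_homN wP); last exact: pid_join (pidN _) (pidN _).
by rewrite (ideal_hom_join wP) ?(ideal_homN wP)// ?oppr_max ?opprK//; exact: pidN.
Qed.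

(** Some homomorphism attains the gauge of [x - y], which is therefore at most 0, and the
    Archimedean property turns this into [x <= y]. If [e = 0] there are no homomorphisms, but the
    ideal is trivial. *)
Lemma ideal_le_homs x y : I x -> I y ->
  (forall w, ideal_hom e w -> w x <= w y) -> x <= y.
Proof.
move=> Ix Iy xy; have [ez|en0] := pselect (e = 0).
  move: Ix Iy => [n _ xn] [m _ ym]; move: xn ym; rewrite ez !scaler0.
  by move=> /vabs_le0-> /vabs_le0->.
rewrite -[x](subrK y) -[X in _ <= X]add0r vl_leD2r//.
apply: VA => d d0; apply: (unit_gauge_lt e0 en0 (pidB Ix Iy)).
have [w wP <-] := ideal_hom_exists e0 en0 (pidB Ix Iy).
apply: le_lt_trans d0; rewrite (ideal_homB wP)// subr_le0; exact: xy.
Qed.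

(** As in the Banach-Alaoglu theorem: each axiom is the vanishing of a continuous function of
    finitely many coordinates, so the set is closed, and it lies in a product of segments. *)
Lemma ideal_homs_compact : compact ideal_homs.
Proof.
have bound x : exists N : R, 0 <= N /\ (I x -> vabs x <= N *: e).
  have [[n n0 xn]|nIx] := pselect (I x); first by exists n.
  by exists 0.
pose N x := projT1 (cid (bound x)).
have NP x : 0 <= N x /\ (I x -> vabs x <= N x *: e) by rewrite /N; case: cid.
have cst x : continuous ((fun w => w x) : prod_topology (fun _ : V => R) -> R).
  exact: proj_continuous.
apply: (@subclosed_compact _ ideal_homs
  [set w : prod_topology (fun _ : V => R) | forall x, [set` `[- N x, N x]] (w x)]).
- move=> w cw.
  have clo (F : prod_topology (fun _ : V => R) -> R) : continuous F ->
      (forall v, ideal_hom e v -> F v = 0) -> F w = 0.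
    by move=> cF F0; exact: (closure_zero cF F0 cw).
  split.
  + move=> a x y Ix Iy; apply/eqP; rewrite -subr_eq0; apply/eqP.
    apply: (clo (fun w => w (a *: x + y) - (a * w x + w y))).
      by apply: rcontinuousB; [|apply: rcontinuousD; [apply: rcontinuousZ|]]; exact: cst.
    by move=> v vP; rewrite (ideal_homP vP)// subrr.
  + move=> x y Ix Iy; apply/eqP; rewrite -subr_eq0; apply/eqP.
    apply: (clo (fun w => w (Order.join x y) - Num.max (w x) (w y))).
      by apply: rcontinuousB; [|apply: rcontinuous_max]; exact: cst.
    by move=> v vP; rewrite (ideal_hom_join vP)// subrr.
  + apply/eqP; rewrite -subr_eq0; apply/eqP.
    apply: (clo (fun w => w e - 1)).
      by apply: rcontinuousB; [exact: cst|exact: rcontinuous_cst].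
    by move=> v vP; rewrite (ideal_hom_unit vP) subrr.
  + move=> x nIx; apply: (clo (fun w => w x)).
      exact: cst.
    by move=> v vP; rewrite (ideal_hom_out vP).
- apply: (@tychonoff V (fun=> R) (fun x => [set` `[- N x, N x]])) => x.
  exact: segment_compact.
- move=> w wP x /=; rewrite in_itv/=.
  have [Nx0 NPx] := NP x.
  have [Ix|nIx] := pselect (I x); last first.
    by rewrite (ideal_hom_out wP)// Nx0 andbT oppr_le0.
  have := NPx Ix; rewrite vabs_le => /andP[h1 h2].
  have Ie := pid_unit e0.
  have := ideal_hom_le wP Ix (pidZ _ Ie) h1.
  have := ideal_hom_le wP (pidN Ix) (pidZ _ Ie) h2.
  by rewrite (ideal_homN wP)// (ideal_homZ _ wP)// (ideal_hom_unit wP) mulr1 lerNl => -> ->.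
Qed.

Let Omega : topologicalType := set_type ideal_homs.
Let h (x : V) (w : Omega) : R := set_val w x.

Let homP (w : Omega) : ideal_hom e (set_val w).
Proof. exact: set_valP. Qed.

Lemma ideal_homs_val_continuous : continuous (set_val : Omega -> prod_topology (fun _ : V => R)).
Proof. exact: initial_continuous. Qed.

Let h_continuous x : continuous (h x).
Proof.
move=> w; apply: (@continuous_comp Omega (prod_topology (fun _ : V => R)) R set_val (fun v => v x)).
  exact: ideal_homs_val_continuous.
exact: proj_continuous.
Qed.

Lemma ideal_homs_hausdorff : hausdorff_space Omega.
Proof.
move=> p q pq; apply: val_inj.
apply: (@hausdorff_product V (fun=> R)); first by move=> _; exact: Rhausdorff.
move=> A B Ap Bq.
have [] := pq (set_val @^-1` A) (set_val @^-1` B).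
- exact: ideal_homs_val_continuous.
- exact: ideal_homs_val_continuous.
by move=> r [rA rB]; exists (set_val r).
Qed.

Lemma ideal_homs_compactT : compact [set: Omega].
Proof.
apply/compact_near_coveringP => J F P FF cov.
have /compact_near_coveringP nc := ideal_homs_compact.
pose Q i (w : prod_topology (fun _ : V => R)) :=
  forall wP : w \in ideal_homs, P i (exist _ w wP : Omega).
have := nc J F Q FF; have -> : (\forall i \near F, ideal_homs `<=` Q i) =
    (\forall i \near F, [set: Omega] `<=` P i).
  congr (F _); apply/seteqP; split => i /=.
    by move=> h1 [w wP] _; have := wP; rewrite inE => /h1; exact.
  by move=> h1 w _ wP; exact: h1.
apply => w wA; have wA' : w \in ideal_homs by rewrite inE.
have [[U G] /= [[U' [[W oW <-] Ww WU]] FG] UG] := cov (exist _ w wA') Logic.I.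
exists (W, G) => /=; first by split => //; exact: open_nbhs_nbhs.
move=> [v i] /= [Wv Gi] vP; apply: (UG (exist _ v vP, i)); split => //=.
exact: WU.
Qed.

Lemma homs_interpolate (f : Omega -> R) (w1 w2 : Omega) :
  exists2 x, I x & h x w1 = f w1 /\ h x w2 = f w2.
Proof.
have Ie := pid_unit e0.
have [->|ne] := pselect (w1 = w2).
  exists (f w2 *: e); first exact: pidZ.
  by rewrite /h (ideal_homZ _ (homP w2))// (ideal_hom_unit (homP w2)) mulr1.
have [u Iu uP] : exists2 u, I u & set_val w1 u <> set_val w2 u.
  apply: contrapT => nu; apply: ne; apply: val_inj; apply: funext => x.
  have [Ix|nIx] := pselect (I x).
    by apply: contrapT => nx; apply: nu; exists x.
  exact: etrans (ideal_hom_out (homP w1) nIx) (esym (ideal_hom_out (homP w2) nIx)).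
pose a := set_val w1 u; pose b := set_val w2 u.
have ab : a - b != 0 by rewrite subr_eq0; apply/eqP.
pose al := (f w1 - f w2) / (a - b); pose be := f w1 - al * a.
exists (al *: u + be *: e); first by apply: pidD; exact: pidZ.
rewrite /h !(ideal_homP (homP _))// ?(ideal_homZ _ (homP _))//; try exact: pidZ.
rewrite !(ideal_hom_unit (homP _)) mulr1 -/a -/b /be; split; first by rewrite addrC subrK.
rewrite addrCA -mulrBr -opprB mulrN /al divfK//; lra.
Qed.

(* Lattice form of Stone-Weierstrass: the elements matching f at w1 are directed
   upwards, so compactness yields one that is almost above f everywhere. *)
Lemma homs_approx_above (f : Omega -> R) (d : R) (w1 : Omega) :
  continuous f -> 0 < d ->
  exists2 y, I y & h y w1 = f w1 /\ forall w, f w - d < h y w.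
Proof.
move=> cf d0.
pose D := [set y | I y /\ h y w1 = f w1].
pose F := filter_from D (fun x => [set y | D y /\ x <= y]).
have FF : Filter F.
  apply: filter_from_filter.
    by have [x Ix [h1 _]] := homs_interpolate f w1 w1; exists x.
  move=> x y [Ix hx] [Iy hy]; exists (Order.join x y).
    split; first exact: pid_join.
    by rewrite /h (ideal_hom_join (homP w1))// -/(h x w1) -/(h y w1) hx hy maxxx.
  by move=> z [Dz /=]; rewrite leUx => /andP[].
have /compact_near_coveringP nc := ideal_homs_compactT.
have [w2 _|x [Ix hx] xP] := nc V F (fun y w => f w - d < h y w) FF.
  have [x Ix [hx1 hx2]] := homs_interpolate f w1 w2.
  exists ([set w | f w - d < h x w], [set y | D y /\ x <= y]) => /=.
    split; last by exists x.
    have cg : (fun w => h x w - f w) @ w2 --> h x w2 - f w2.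
      by apply: rcontinuousB; [exact: h_continuous|exact: cf].
    have := @cvgr_gt _ _ _ _ _ _ cg (- d); rewrite hx2 subrr oppr_lt0 => /(_ _ d0).
    by apply: filterS => w /=; lra.
  move=> [w y] /= [xw [[Iy _] xy]]; apply: (lt_le_trans xw).
  exact: (ideal_hom_le (homP w)).
by exists x => //; split => // w; exact: (xP x _ w).
Qed.

(** The dual of the previous argument: the elements above [f - d] are stable under meets, hence
    directed downwards, and compactness yields one that is also below [f + d]. *)
Lemma homs_approx (f : Omega -> R) (d : R) : continuous f -> 0 < d ->
  exists2 y, I y & forall w, `|h y w - f w| < d.
Proof.
move=> cf d0.
pose D := [set y | I y /\ forall w, f w - d < h y w].
pose F := filter_from D (fun x => [set y | D y /\ y <= x]).
have FF : Filter F.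
  apply: filter_from_filter.
    (* [Omega] may be empty, namely when [e = 0]; the filter base still needs an element. *)
    have [[w1 _]|nw] := pselect (exists w : Omega, True); last first.
      exists 0; split; first exact: pid0.
      by move=> w; exfalso; apply: nw; exists w.
    by have [x Ix [_ h1]] := homs_approx_above w1 cf d0; exists x.
  move=> x y [Ix hx] [Iy hy]; exists (Order.meet x y).
    split=> [|w]; first exact: pid_meet.
    by rewrite /h (ideal_hom_meet (homP w))// lt_min hx hy.
  by move=> z [Dz /=]; rewrite lexI => /andP[].
have /compact_near_coveringP nc := ideal_homs_compactT.
have [w1 _|x [Ix hx] xP] := nc V F (fun y w => h y w < f w + d) FF.
  have [x Ix [hx1 hx2]] := homs_approx_above w1 cf d0.
  exists ([set w | h x w < f w + d], [set y | D y /\ y <= x]) => /=.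
    split; last by exists x.
    have cg : (fun w => h x w - f w) @ w1 --> h x w1 - f w1.
      by apply: rcontinuousB; [exact: h_continuous|exact: cf].
    have := @cvgr_lt _ _ _ _ _ _ cg d; rewrite hx1 subrr => /(_ _ d0).
    by apply: filterS => w /=; lra.
  move=> [w y] /= [xw [[Iy _] xy]]; apply: le_lt_trans xw.
  exact: (ideal_hom_le (homP w)).
exists x => // w; have h1 := hx w.
have h2 : h x w < f w + d by apply: (xP x _ w).
by rewrite ltr_norml; apply/andP; split; lra.
Qed.

Lemma homs_vabs x w : I x -> h (vabs x) w = `|h x w|.
Proof.
move=> Ix; rewrite /h /vabs (ideal_hom_join (homP w)) ?(ideal_homN (homP w))//.
  have [h0|h0] := leP 0 (set_val w x); first by rewrite ger0_norm// max_l// ge0_cp.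
  by rewrite ltr0_norm// max_r// ltW// lt0_cp.
exact: pidN.
Qed.

(** Approximations within [2^-n / 4] differ by at most [2^-n] pointwise, hence in the order by
    [ideal_le_homs]; uniform completeness then produces an element representing [f]. *)
Lemma homs_surj (f : Omega -> R) : continuous f ->
  exists2 x, I x & h x = f.
Proof.
move=> cf; have d4 n : 0 < 2^-1 ^+ n / 4 :> R by rewrite divr_gt0 ?half_pow_gt0.
have ap n := homs_approx cf (d4 n).
pose u n := projT1 (cid2 (ap n)).
have uI n : I (u n) by rewrite /u; case: cid2.
have uf n w : `|h (u n) w - f w| < 2^-1 ^+ n / 4 by rewrite /u; case: cid2.
have Ie := pid_unit e0.
have ule n : vabs (u n.+1 - u n) <= 2^-1 ^+ n *: e.
  have Id := pidB (uI n.+1) (uI n).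
  apply: ideal_le_homs; [exact: pid_vabs|exact: pidZ|move=> w wP].
  have wA : w \in ideal_homs by rewrite inE.
  pose w' : Omega := exist _ w wA.
  have -> : w (vabs (u n.+1 - u n)) = `|h (u n.+1 - u n) w'|.
    by rewrite -homs_vabs.
  rewrite (ideal_homZ _ wP)// (ideal_hom_unit wP) mulr1.
  rewrite /h (ideal_homB (homP w'))// -/(h _ w') -/(h _ w').
  have := uf n w'; have := uf n.+1 w'.
  rewrite exprS; have := half_pow_gt0 (R := R) n; move: (2^-1 ^+ n) => p.
  rewrite !ltr_norml => p0 /andP[h1 h2] /andP[h3 h4].
  by rewrite ler_norml; apply/andP; split; lra.
have [x xP] := VU e0 ule.
have Ix : I x.
  have -> : x = (x - u 0%N) + u 0%N by rewrite subrK.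
  by apply: pidD => //; exists (2 * 2^-1 ^+ 0); [rewrite mulr1|exact: xP].
exists x => //; apply: funext => w.
apply/eqP; rewrite -subr_eq0 -normr_le0; apply/ler_addgt0Pr => d d0.
rewrite add0r; have d4' : 0 < d / 4 by rewrite divr_gt0.
have [n nd] := half_pow_lt d4'.
have Id := pidB Ix (uI n).
have := ideal_hom_le (homP w) (pid_vabs Id) (pidZ _ Ie) (xP n).
rewrite (ideal_homZ _ (homP w))// (ideal_hom_unit (homP w)) mulr1.
rewrite -[set_val w (vabs _)]/(h (vabs (x - u n)) w) homs_vabs//.
rewrite /h (ideal_homB (homP w))// -/(h x w) -/(h (u n) w).
have := uf n w; move: nd; move: (2^-1 ^+ n) => p.
rewrite ltr_norml !ler_norml => h0 /andP[h1 h2] /andP[h3 h4].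
by apply/andP; split; lra.
Qed.

Theorem kakutani : exists (Om : topologicalType) (k : V -> Om -> R),
  [/\ compact [set: Om], hausdorff_space Om & ideal_isomorphism e k].
Proof.
exists Omega, h; split; [exact: ideal_homs_compactT|exact: ideal_homs_hausdorff|].
split.
- split.
  + by move=> x Ix /=; exact: h_continuous.
  + move=> x y /set_mem Ix /set_mem Iy hxy; apply/le_anti.
    have hE w : ideal_hom e w -> w x = w y.
      move=> wP; have wA : w \in ideal_homs by rewrite inE.
      exact: (congr1 (fun g => g (exist _ w wA : Omega)) hxy).
    by apply/andP; split; apply: ideal_le_homs => // w /hE ->.
  + by move=> f cf; have [x Ix <-] := homs_surj cf; exists x.
- by move=> a x y w Ix Iy; exact: (ideal_homP (homP w)).
- by move=> x y w Ix Iy; exact: (ideal_hom_join (homP w)).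
- by move=> x y w Ix Iy; exact: (ideal_hom_meet (homP w)).
- by move=> w; exact: (ideal_hom_unit (homP w)).
Qed.

End Kakutani.

(** * Quasi-concave functions *)

Section QuasiConcave.
Context {R : realType} (phi : R -> R -> R).
Hypothesis phiP : class_P phi.

Lemma class_P_mono s s' t t' : 0 < s -> 0 < t -> s <= s' -> t <= t' ->
  phi s t <= phi s' t'.
Proof.
move=> s0 t0 ss tt; apply: (le_trans (class_P_homol phiP s0 t0 ss)).
exact: (class_P_homor phiP (lt_le_trans s0 ss) t0 tt).
Qed.

(** Monotonicity and homogeneity give [phi s t >= phi m m = m] for the smaller argument [m]. *)
Lemma class_P_gt0 s t : 0 < s -> 0 < t -> 0 < phi s t.
Proof.
move=> s0 t0; have m0 : 0 < Num.min s t by rewrite lt_min s0.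
apply: (lt_le_trans m0); rewrite -[leLHS]mulr1 -(class_P_normalized phiP).
rewrite -(class_P_homogeneous phiP)// mulr1.
by apply: class_P_mono => //; rewrite ge_min lexx ?orbT.
Qed.

Lemma class_P_swap : class_P (fun s t => phi t s).
Proof.
split=> [s t s0 t0|l s t l0 s0 t0|s s' t s0 t0|s t t' s0 t0|].
- exact: (class_P_ge0 phiP).
- exact: (class_P_homogeneous phiP).
- exact: (class_P_homor phiP).
- exact: (class_P_homol phiP).
- exact: (class_P_normalized phiP).
Qed.

Lemma class_P_section s t : 0 < s -> 0 < t -> phi s t = s * phi 1 (t / s).
Proof.
move=> s0 t0; rewrite -(class_P_homogeneous phiP)// ?divr_gt0// mulr1.
by rewrite mulrC divfK ?gt_eqF.
Qed.

Lemma class_P_section_mono r r' : 0 < r -> r <= r' -> phi 1 r <= phi 1 r'.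
Proof. by move=> r0; exact: (class_P_homor phiP). Qed.

(** By homogeneity [phi 1 r / r = phi r^-1 1]. Together with positivity and [class_P_section_mono],
    this is what the construction of the nodes uses of phi. *)
Lemma class_P_section_anti r r' : 0 < r -> r <= r' ->
  phi 1 r' / r' <= phi 1 r / r.
Proof.
move=> r0 rr; have r'0 := lt_le_trans r0 rr.
have E q : 0 < q -> phi 1 q / q = phi q^-1 1.
  move=> q0; rewrite mulrC -(class_P_homogeneous phiP)// ?invr_gt0// mulr1.
  by rewrite mulVf ?gt_eqF.
rewrite !E//; apply: (class_P_homol phiP); rewrite ?invr_gt0//.
by rewrite lef_pV2.
Qed.

(* The continuous extension of phi, as an infimum over interior points. *)
Definition pext s t : R := inf [set phi (s + d) (t + d) | d in [set d | 0 < d]].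

Lemma pext_has_inf s t : 0 <= s -> 0 <= t ->
  has_inf [set phi (s + d) (t + d) | d in [set d | 0 < d]].
Proof.
move=> s0 t0; split; first by exists (phi (s + 1) (t + 1)); exists 1 => /=.
exists 0 => _ [d /= d0 <-]; apply: (class_P_ge0 phiP).
  by rewrite ltr_wpDl.
by rewrite ltr_wpDl.
Qed.

(** With [pext_lb], this turns the infimum over diagonal shifts into one over all strictly larger
    points. *)
Lemma pext_ub s t s' t' : 0 <= s -> 0 <= t -> s < s' -> t < t' ->
  pext s t <= phi s' t'.
Proof.
move=> s0 t0 ss tt; pose d := Num.min (s' - s) (t' - t).
have d0 : 0 < d by rewrite lt_min !subr_gt0 ss.
have [_ lb] := pext_has_inf s0 t0.
have -> : pext s t = inf [set phi (s + d) (t + d) | d in [set d | 0 < d]] by [].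
apply: (@le_trans _ _ (phi (s + d) (t + d))); first by apply: ge_inf => //; exists d.
apply: class_P_mono; rewrite ?ltr_wpDl//.
  by rewrite -lerBrDl ge_min lexx.
by rewrite -lerBrDl ge_min lexx orbT.
Qed.

Lemma pext_lb s t l :
  (forall s' t', s < s' -> t < t' -> l <= phi s' t') -> l <= pext s t.
Proof.
move=> h; apply: lb_le_inf; first by exists (phi (s + 1) (t + 1)); exists 1 => /=.
by move=> _ [d /= d0 <-]; apply: h; rewrite ltrDl.
Qed.

Lemma pext_ge0 s t : 0 <= s -> 0 <= t -> 0 <= pext s t.
Proof.
move=> s0 t0; apply: pext_lb => s' t' ss tt.
by apply: (class_P_ge0 phiP); [exact: le_lt_trans ss|exact: le_lt_trans tt].
Qed.

Lemma pext_mono s t s' t' : 0 <= s -> 0 <= t -> s <= s' -> t <= t' ->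
  pext s t <= pext s' t'.
Proof.
move=> s0 t0 ss tt; apply: pext_lb => u v su tv.
by apply: pext_ub => //; [exact: le_lt_trans su|exact: le_lt_trans tv].
Qed.

(** Homogeneity replaces continuity: scaling both arguments by [1 + d / phi s t] raises the value by
    exactly [d]. *)
Lemma pext_interior s t : 0 < s -> 0 < t -> pext s t = phi s t.
Proof.
move=> s0 t0; apply/le_anti/andP; split; last first.
  by apply: pext_lb => s' t' /ltW ss /ltW tt; exact: class_P_mono.
apply/ler_addgt0Pr => d d0; have p0 := class_P_gt0 s0 t0.
pose k := 1 + d / phi s t; have k1 : 1 < k by rewrite ltrDl divr_gt0.
have k0 : 0 < k by rewrite (lt_trans _ k1).
have := @pext_ub s t (k * s) (k * t) (ltW s0) (ltW t0).
rewrite !ltr_pMl// => /(_ k1 k1); rewrite (class_P_homogeneous phiP)//.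
by rewrite mulrDl mul1r divfK ?gt_eqF.
Qed.

(** From above, a nearly optimal interior point eventually dominates [(a x, b x)]. From below,
    [(a x, b x)] eventually dominates [(k s, k t)] for a factor [k < 1] with [k L > L - d]; a
    vanishing coordinate is covered by nonnegativity. *)
Lemma pext_cvg (T : Type) (F : set_system T) (a b : T -> R) (s t : R) :
  Filter F -> 0 <= s -> 0 <= t -> a @ F --> s -> b @ F --> t ->
  (\forall x \near F, 0 <= a x) -> (\forall x \near F, 0 <= b x) ->
  pext (a x) (b x) @[x --> F] --> pext s t.
Proof.
move=> FF s0 t0 aF bF a0 b0; apply/cvgrPdist_lt => d d0.
set L := pext s t; have L0 : 0 <= L by exact: pext_ge0.
have [_ [eta /= eta0 <-] etaL] := inf_adherent d0 (pext_has_inf s0 t0).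
pose k := (1 + L) / (1 + L + d).
have k0 : 0 < k by rewrite divr_gt0//; lra.
have k1 : k < 1 by rewrite ltr_pdivrMr; lra.
have kL : L - d < k * L.
  rewrite /k mulrAC ltr_pdivlMr; last lra.
  nra.
have near_ge (c : T -> R) (r : R) : 0 <= r -> c @ F --> r -> (\forall x \near F, 0 <= c x) ->
    \forall x \near F, k * r <= c x.
  rewrite le_eqVlt => /orP[/eqP <-|r0] cF c0.
    by apply: filterS c0 => x; rewrite mulr0.
  have : k * r < r by rewrite gtr_pMl.
  by move=> /(cvgr_gt _ cF); apply: filterS => x /ltW.
have sE : s < s + eta by rewrite ltrDl.
have tE : t < t + eta by rewrite ltrDl.
have n1 : \forall x \near F, a x < s + eta by apply: cvgr_lt sE.
have n2 : \forall x \near F, b x < t + eta by apply: cvgr_lt tE.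
have n3 := near_ge _ _ s0 aF a0; have n4 := near_ge _ _ t0 bF b0.
near=> x.
have ax0 : 0 <= a x by near: x.
have bx0 : 0 <= b x by near: x.
have h1 : pext (a x) (b x) < L + d.
  have ax1 : a x < s + eta by near: x.
  have bx1 : b x < t + eta by near: x.
  by apply: le_lt_trans etaL; exact: pext_ub.
have h2 : k * L <= pext (a x) (b x).
  apply: pext_lb => s' t' ss tt.
  have kn0 : k != 0 by rewrite gt_eqF.
  have kax : k * s <= a x by near: x.
  have kbx : k * t <= b x by near: x.
  have s'0 : 0 < s' by exact: le_lt_trans ss.
  have t'0 : 0 < t' by exact: le_lt_trans tt.
  rewrite -(mulVKf kn0 s') -(mulVKf kn0 t') (class_P_homogeneous phiP)//; first last.
  - by rewrite mulr_gt0 ?invr_gt0.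
  - by rewrite mulr_gt0 ?invr_gt0.
  rewrite ler_pM2l//; apply: pext_ub => //.
    by rewrite ltr_pdivlMl//; exact: le_lt_trans ss.
  by rewrite ltr_pdivlMl//; exact: le_lt_trans tt.
by rewrite ltr_norml; apply/andP; split; lra.
Unshelve. all: by end_near. Qed.

Lemma extensionE (s t : R) : 0 <= s -> 0 <= t -> extension phi s t = pext s t.
Proof.
move=> s0 t0; set Q := [set z : R * R | 0 < z.1 /\ 0 < z.2].
have clQ : closure Q (s, t).
  move=> B [[B1 B2] [/= /nbhs_ballP[r1 /= r10 rB1] /nbhs_ballP[r2 /= r20 rB2]] BB].
  pose r := Num.min r1 r2; have r0 : 0 < r by rewrite lt_min r10.
  exists (s + r / 2, t + r / 2); split.
    by split => /=; rewrite ltr_wpDl// divr_gt0.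
  have rr : r / 2 < r by lra.
  have h u : `|u - (u + r / 2)| < r.
    by rewrite opprD addrA subrr add0r normrN ger0_norm// divr_ge0// ltW.
  apply: BB; split => /=.
    by apply: rB1; apply: (lt_le_trans (h s)); rewrite ge_min lexx.
  by apply: rB2; apply: (lt_le_trans (h t)); rewrite ge_min lexx orbT.
have PF : ProperFilter (within Q (nbhs (s, t))) by exact: within_nbhs_proper.
have nQ : \forall z \near within Q (nbhs (s, t)), Q z.
  exact: withinT.
have c : pext z.1 z.2 @[z --> within Q (nbhs (s, t))] --> pext s t.
  apply: pext_cvg => //.
  - by apply: cvg_within_filter; exact: cvg_fst.
  - by apply: cvg_within_filter; exact: cvg_snd.
  - by apply: filterS nQ => z [/ltW].
  - by apply: filterS nQ => z [_ /ltW].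
apply: cvg_lim; first exact: Rhausdorff.
apply: cvg_trans c; apply: near_eq_cvg.
by apply: filterS nQ => z [z1 z2]; rewrite pext_interior.
Qed.

End QuasiConcave.

(** * Cutting off large arguments of phi *)

Section Truncation.
Context {R : realType}.
Implicit Type phi : R -> R -> R.

(* Either phi(e, .) is unbounded, or r |-> phi(1, r) is almost constant near
   infinity; in both cases a large second argument may be cut off. *)
Lemma class_P_trunc_right phi (e : R) : class_P phi -> 0 < e ->
  exists2 M, 1 <= M & forall M' s t, M <= M' -> e <= s -> 0 < t ->
    1 <= phi s t -> 2^-1 <= phi s (Num.min t M').
Proof.
move=> phiP e0.
have h2 : 2^-1 <= 1 :> R by rewrite invf_le1 ?ler1n.
have [[M0 [M00 M0P]]|nM] := pselect (exists M0, 0 < M0 /\ 2^-1 <= phi e M0).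
  exists (Num.max 1 M0); first by rewrite le_max lexx.
  move=> M' s t MM es t0 st; have [tM|tM] := leP t M'.
    by rewrite (le_trans _ st).
  apply: (le_trans M0P); apply: class_P_mono => //.
  by apply: le_trans MM; rewrite le_max lexx orbT.
(* Here [phi e] stays below 1/2, so by homogeneity the section [phi 1] is bounded and has a supremum
   [L]. *)
have bnd r : 0 < r -> phi 1 r <= e^-1.
  move=> r0; have er0 : 0 < e * r by rewrite mulr_gt0.
  have [h|h] := leP 2^-1 (phi e (e * r)); first by exfalso; apply: nM; exists (e * r).
  rewrite (class_P_section phiP)// in h; rewrite mulrAC divff ?gt_eqF// mul1r in h.
  rewrite -[e^-1]mul1r ler_pdivlMr// mulrC; lra.
pose S := [set phi 1 r | r in [set r | 0 < r]].
have supS : has_sup S.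
  split; first by exists (phi 1 1); exists 1 => /=.
  by exists e^-1 => _ [r /= r0 <-]; exact: bnd.
pose L := sup S.
have LS r : 0 < r -> phi 1 r <= L.
  by move=> r0; apply: ub_le_sup; [case: supS|exists r].
have L1 : 1 <= L by rewrite -(class_P_normalized phiP) LS.
have L20 : 0 < L / 2 by rewrite divr_gt0//; lra.
have [_ [M0 /= M00 <-] M0L] := sup_adherent L20 supS.
exists (Num.max 1 M0); first by rewrite le_max lexx.
move=> M' s t MM es t0 st.
have [tM|tM] := leP t M'; first by rewrite (le_trans _ st).
have s0 : 0 < s by exact: lt_le_trans es.
have M1 : 1 <= M' by apply: le_trans MM; rewrite le_max lexx.
have MM0 : M0 <= M' by apply: le_trans MM; rewrite le_max lexx orbT.
have M'0 : 0 < M' by exact: lt_le_trans M1.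
have [s1|s1] := leP 1 s.
  apply: (le_trans h2); rewrite -(class_P_normalized phiP).
  exact: class_P_mono.
(* As [s < 1], the ratio [M' / s] is beyond [M0], where the section exceeds [L / 2], whereas
   [phi 1 (t / s)] is at most [L]. *)
rewrite (class_P_section phiP)//; rewrite (class_P_section phiP)// in st.
have h := LS (t / s) (divr_gt0 t0 s0).
have h3 : phi 1 M0 <= phi 1 (M' / s).
  apply: class_P_section_mono => //; apply: (le_trans MM0).
  by rewrite ler_pdivlMr// ler_piMr// ltW.
have h4 : L / 2 <= phi 1 (M' / s) by rewrite -/L in M0L; lra.
have h5 : s * (L / 2) <= s * phi 1 (M' / s) by rewrite ler_pM2l.
have h6 : s * phi 1 (t / s) <= s * L by rewrite ler_pM2l.
lra.
Qed.

(** The one-sided bounds hold for every larger cut-off, so the two cut-offs can be merged into their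
    maximum [M]. If both arguments exceed [M], then [phi M M >= phi 1 1 = 1]. *)
Lemma class_P_trunc phi (e : R) : class_P phi -> 0 < e ->
  exists2 M, 1 <= M & forall s t, e <= s -> e <= t ->
    1 <= phi s t -> 2^-1 <= phi (Num.min s M) (Num.min t M).
Proof.
move=> phiP e0.
have h2 : 2^-1 <= 1 :> R by rewrite invf_le1 ?ler1n.
have [M1 M11 P1] := class_P_trunc_right phiP e0.
have [M2 M21 P2] := class_P_trunc_right (class_P_swap phiP) e0.
pose M := Num.max M1 M2.
have M1M : M1 <= M by rewrite le_max lexx.
have M2M : M2 <= M by rewrite le_max lexx orbT.
have M1' := le_trans M11 M1M.
exists M => // s t es et st.
have s0 := lt_le_trans e0 es; have t0 := lt_le_trans e0 et.
have [sM|sM] := leP s M; first by have := P1 _ _ _ M1M es t0 st.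
have := P2 _ _ _ M2M et s0 st; rewrite (min_r (ltW sM)).
have [//|tM _] := leP t M.
apply: (le_trans h2); rewrite -(class_P_normalized phiP).
by apply: class_P_mono.
Qed.

End Truncation.

(** * Geometric nodes and dyadic bumps for a quasi-concave function *)

Section Nodes.
Context {R : realType} (f : R -> R) (rho : R).
Hypotheses (f_gt0 : forall r, 0 < r -> 0 < f r)
  (f_mono : forall r r', 0 < r -> r <= r' -> f r <= f r')
  (f_anti : forall r r', 0 < r -> r <= r' -> f r' / r' <= f r / r)
  (rho0 : 0 < rho).

Definition dyadic (i : nat) : R := rho * 2 ^+ i.

Lemma dyadic_gt0 i : 0 < dyadic i.
Proof. by rewrite mulr_gt0// exprn_gt0. Qed.

Lemma dyadicS i : dyadic i.+1 = 2 * dyadic i.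
Proof. by rewrite /dyadic exprS mulrCA. Qed.

Lemma dyadic_le i j : (i <= j)%N -> dyadic i <= dyadic j.
Proof. by move=> ij; rewrite ler_pM2l// ler_eXn2l// ltr1n. Qed.

Lemma dyadic_locate m r : rho <= r -> r < dyadic m ->
  exists2 i, (i < m)%N & dyadic i <= r <= dyadic i.+1.
Proof.
move=> rr; elim: m => [|m IH]; first by rewrite /dyadic expr0 mulr1 ltNge rr.
move=> rm; have [h|h] := leP (dyadic m) r; first by exists m => //; rewrite h ltW.
by have [i im ir] := IH h; exists i => //; rewrite ltnS ltnW.
Qed.

Let a i := f (dyadic i).
Let b i := f (dyadic i) / dyadic i.

Let a_gt0 i : 0 < a i. Proof. exact/f_gt0/dyadic_gt0. Qed.
Let b_gt0 i : 0 < b i. Proof. by rewrite divr_gt0 ?f_gt0 ?dyadic_gt0. Qed.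
Let a_le i j : (i <= j)%N -> a i <= a j.
Proof. by move=> ij; apply: f_mono; [exact: dyadic_gt0|exact: dyadic_le]. Qed.
Let b_le i j : (i <= j)%N -> b j <= b i.
Proof. by move=> ij; apply: f_anti; [exact: dyadic_gt0|exact: dyadic_le]. Qed.

(** Invariant of a construction running from [i0] up to [m]. The covering property and the two sums
    split at [r] are the purpose; the term [- f (dyadic i0)] and the bound on the total sum leave
    room for prepending a node. *)
Definition node_seq (m i0 : nat) (s : seq nat) : Prop :=
  [/\ all (leq i0) s /\ ((m <= i0)%N -> s = [::]),
      forall i, (i0 <= i < m)%N -> exists2 c, c \in s &
        f (dyadic i) <= 2 * f (dyadic c) * Num.min 1 (dyadic i / dyadic c),
      forall r, dyadic i0 <= r ->
        \sum_(c <- s | dyadic c <= r) f (dyadic c) <= 2 * f r - f (dyadic i0),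
      \sum_(c <- s) f (dyadic c) / dyadic c <= 2 * (f (dyadic i0) / dyadic i0) &
      forall r, 0 < r ->
        \sum_(c <- s | r < dyadic c) f (dyadic c) / dyadic c <= 3 * (f r / r)].

Lemma node_seq_nil m i0 : (m <= i0)%N -> node_seq m i0 [::].
Proof.
move=> mi; split => //.
- by move=> j /andP[ij jm]; have := leq_trans (leq_trans jm mi) ij; rewrite ltnn.
- move=> r ir; rewrite big_nil.
  have := f_mono (dyadic_gt0 i0) ir; have := f_gt0 (lt_le_trans (dyadic_gt0 i0) ir).
  lra.
- by rewrite big_nil mulr_ge0// ltW// b_gt0.
- by move=> r r0; rewrite big_nil mulr_ge0// divr_ge0// ltW// f_gt0.
Qed.

(* Greedy choice, for a i = f (dyadic i) and b i = a i / dyadic i: from the first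
   index i0 not yet covered, the node c is the last index with b i0 <= 2 b c, and
   it covers the indices up to the last e with a e <= 2 a c. Along the nodes, a
   grows and b decays geometrically. *)
Lemma node_seq_exists m n i0 : (m - i0 <= n)%N -> exists s, node_seq m i0 s.
Proof.
elim: n i0 => [|n IH] i0 mn.
   by exists [::]; apply: node_seq_nil; rewrite -subn_eq0 -leqn0.
have [mi|im] := leqP m i0; first by exists [::]; exact: node_seq_nil.
pose P k := (i0 <= k < m)%N && (b i0 <= 2 * b k).
have exP : exists k, P k.
  by exists i0; rewrite /P leqnn im /= ler_peMl ?ler1n// ltW.
have ubP k : P k -> (k <= m)%N by move=> /andP[/andP[_ /ltnW]].
have [c /andP[/andP[ic cm] bc] cmax] := ex_maxnP exP ubP.
pose Q k := (c <= k < m)%N && (a k <= 2 * a c).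
have exQ : exists k, Q k.
  by exists c; rewrite /Q leqnn cm /= ler_peMl ?ler1n// ltW.
have ubQ k : Q k -> (k <= m)%N by move=> /andP[/andP[_ /ltnW]].
have [e /andP[/andP[ce em] ae] emax] := ex_maxnP exQ ubQ.
have ci1 : (c <= e.+1)%N by rewrite ltnW.
have i01 : (i0 < e.+1)%N by rewrite ltnS (leq_trans ic).
have [s [[s1 snil] s2 s3 s4 s5]] : exists s, node_seq m e.+1 s.
  apply: IH; rewrite leq_subLR addSn -addnS.
  apply: (@leq_trans (i0 + n.+1)); first by rewrite -leq_subLR.
  by rewrite leq_add2r -ltnS.
have {}s3 : forall r, dyadic e.+1 <= r ->
    \sum_(c <- s | dyadic c <= r) a c <= 2 * f r - a e.+1 := s3.
have {}s4 : \sum_(c <- s) b c <= 2 * b e.+1 := s4.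
have {}s5 : forall r, 0 < r ->
    \sum_(c <- s | r < dyadic c) b c <= 3 * (f r / r) := s5.
(* By maximality of [c], the index [e.+1] satisfies [2 * b e.+1 < b i0], so all later nodes together
   weigh at most [b i0]. *)
have K1 : \sum_(c <- s) b c <= b i0.
  have [mi1|i1m] := leqP m e.+1; first by rewrite snil// big_nil ltW.
  apply: (le_trans s4); have [//|h] := leP (2 * b e.+1) (b i0).
  have /cmax : P e.+1 by rewrite /P i1m (ltnW i01) ltW.
  by rewrite leqNgt ltnS ce.
(* By maximality of [e], [a e.+1 > 2 * a c]; the slack of the tail then pays for the new node and
   restores the slack [a i0 <= a c]. *)
have K2 r : dyadic e.+1 <= r -> \sum_(c <- s | dyadic c <= r) a c <= 2 * f r - 2 * a c.
  move=> ir; have [mi1|i1m] := leqP m e.+1.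
    rewrite snil// big_nil; have : a c <= f r; last lra.
    by apply: f_mono; [exact: dyadic_gt0|apply: le_trans ir; exact: dyadic_le].
  apply: (le_trans (s3 _ ir)); have [h|h] := leP (a e.+1) (2 * a c); last lra.
  have /emax : Q e.+1 by rewrite /Q ci1 i1m.
  by rewrite ltnn.
have K0 r : r < dyadic e.+1 -> \sum_(c <- s | dyadic c <= r) a c = 0.
  move=> re; rewrite big_seq_cond big_pred0// => k; apply/negP => /andP[ks kr].
  have /dyadic_le h : (e.+1 <= k)%N by exact: (allP s1).
  by have := le_lt_trans (le_trans h kr) re; rewrite ltxx.
have aic : a i0 <= a c by exact: a_le.
have bic : b c <= b i0 by exact: b_le.
exists (c :: s); split.
- split; last by rewrite leqNgt im.
  rewrite /= ic /=; apply/allP => k /(allP s1) ek.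
  exact: leq_trans (ltnW i01) ek.
- move=> i /andP[ii1 iim]; have [ie|ei] := leqP i e; last first.
    have [k ks kP] := s2 i (introT andP (conj ei iim)).
    by exists k => //; rewrite inE ks orbT.
  exists c; rewrite ?mem_head// -/(a i) -/(a c).
  have dc := dyadic_gt0 c; have di := dyadic_gt0 i.
  have [cile|icle] := leqP c i.
    rewrite min_l ?mulr1; last by rewrite ler_pdivlMr// mul1r dyadic_le.
    by apply: (le_trans _ ae); exact: a_le.
  rewrite min_r; last by rewrite ler_pdivrMr// mul1r dyadic_le// ltnW.
  have h : b i <= 2 * b c by apply: (le_trans _ bc); exact: b_le.
  have -> : a i = b i * dyadic i by rewrite /b divfK// gt_eqF.
  have -> : 2 * a c * (dyadic i / dyadic c) = 2 * b c * dyadic i.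
    by rewrite /b -/(a c); field; rewrite gt_eqF.
  by rewrite ler_pM2r.
- move=> r ir; rewrite big_cons -/(a i0) -/(a c); have rpos := lt_le_trans (dyadic_gt0 i0) ir.
  have aif : a i0 <= f r by apply: f_mono => //; exact: dyadic_gt0.
  have [h|h] := leP (dyadic e.+1) r.
    rewrite (le_trans (dyadic_le ci1) h); have := K2 _ h; lra.
  rewrite (K0 _ h); case: ifP => [cr|_]; last by have := f_gt0 rpos; lra.
  have : a c <= f r by apply: f_mono => //; exact: dyadic_gt0.
  lra.
- by rewrite big_cons -/(b i0) -/(b c); lra.
(* For [r] below [dyadic e.+1], the later nodes contribute at most [2 * b e.+1 <= 2 * (f r / r)] and
   [c] at most [f r / r]: this is the constant 3. *)
- move=> r r0; rewrite big_cons -/(b c).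
  have [h|h] := leP (dyadic e.+1) r.
    rewrite ltNge (le_trans (dyadic_le ci1) h) /=; exact: s5.
  have h1 : \sum_(c <- s | r < dyadic c) b c <= \sum_(c <- s) b c.
    rewrite [leRHS](bigID (fun c => r < dyadic c))/= lerDl sumr_ge0// => k _.
    exact: ltW.
  have h2 : b e.+1 <= f r / r by apply: f_anti => //; exact: ltW.
  have h3 : 0 < f r / r by rewrite divr_gt0// f_gt0.
  case: ifP => [rc|_]; last by lra.
  have : b c <= f r / r by apply: f_anti => //; exact: ltW.
  lra.
Qed.

(** Split the sum at [r = q / p]. Below [r] the minimum is at most [p], giving [2 * (p * f r)];
    above it is at most [q / dyadic c], giving [q * (3 * (f r / r)) = 3 * (p * f r)]. Hence 5. *)
Lemma dyadic_nodes m : exists s : seq nat,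
  (forall i, (i < m)%N -> exists2 c, c \in s &
     f (dyadic i) <= 2 * f (dyadic c) * Num.min 1 (dyadic i / dyadic c)) /\
  (forall p q, 0 < p -> 0 < q ->
     \sum_(c <- s) f (dyadic c) * Num.min p (q / dyadic c) <= 5 * (p * f (q / p))).
Proof.
have [s [[s1 _] s2 s3 _ s5]] := node_seq_exists (leq_subr 0 m).
exists s; split => [i im|p q p0 q0]; first exact: s2.
pose r := q / p; have r0 : 0 < r by rewrite divr_gt0.
have fr := f_gt0 r0.
have s3' : \sum_(c <- s | dyadic c <= r) a c <= 2 * f r.
  have [h|h] := leP (dyadic 0) r; first by have := s3 _ h; have := f_gt0 (dyadic_gt0 0); lra.
  rewrite big_pred0 => [|c]; first by rewrite mulr_ge0// ltW.
  apply/negP => cr; have := le_lt_trans (le_trans (dyadic_le (leq0n c)) cr) h.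
  by rewrite ltxx.
rewrite (bigID (fun c => dyadic c <= r))/= -/r.
have h1 : \sum_(c <- s | dyadic c <= r) f (dyadic c) * Num.min p (q / dyadic c) <=
    p * (2 * f r).
  rewrite (le_trans _ (ler_wpM2l (ltW p0) s3'))// mulr_sumr ler_sum// => c _.
  by rewrite mulrC ler_wpM2r ?ge_min ?lexx// ltW// a_gt0.
have h2 : \sum_(c <- s | ~~ (dyadic c <= r)) f (dyadic c) * Num.min p (q / dyadic c) <=
    q * (3 * (f r / r)).
  under eq_bigl do rewrite -ltNge.
  rewrite (le_trans _ (ler_wpM2l (ltW q0) (s5 _ r0)))// mulr_sumr ler_sum// => c _.
  rewrite /b mulrCA ler_wpM2l ?ge_min ?lexx ?orbT// ltW//; exact: a_gt0.
have E : q * (3 * (f r / r)) = p * (3 * f r).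
  by rewrite /r; field; rewrite !gt_eqF.
by rewrite E in h2; apply: (le_trans (lerD h1 h2)); lra.
Qed.

(* bump i p q is comparable to p where q / p is about dyadic i; being a minimum of
   two telescoping differences, the bumps sum up to at most p, and their multiples
   by dyadic i to at most q. *)
Definition ramp (k : nat) (p q : R) : R := Num.min p (2 / dyadic k * q).

Definition bump (i : nat) (p q : R) : R :=
  Num.min (ramp i.+2 p q - ramp i.+3 p q) (ramp i.+1 p q - 2^-1 * ramp i p q).

Lemma ramp_coefS k (q : R) : 2 / dyadic k.+1 * q = (2 / dyadic k * q) / 2.
Proof. by rewrite dyadicS; have := dyadic_gt0 k => /gt_eqF h; field; rewrite h. Qed.

Lemma bump_ge0 i p q : 0 <= p -> 0 <= q -> 0 <= bump i p q.
Proof.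
move=> p0 q0; rewrite /bump /ramp !ramp_coefS.
have : 0 <= 2 / dyadic i * q by rewrite !mulr_ge0 ?invr_ge0// ltW// dyadic_gt0.
move: (2 / dyadic i * q) => u u0; rewrite le_min.
rewrite !minEle; do ![case: ifPn]; rewrite -?ltNge; move=> *; apply/andP; split; lra.
Qed.

(** With [u = q / dyadic i] between [p] and [2 * p], the ramps of index i, i+1, i+2, i+3 equal p, p,
    u/2, u/4, so the bump is the minimum of u/4 and p/2. *)
Lemma bump_lb i p q : 0 <= p -> dyadic i * p <= q -> q <= dyadic i.+1 * p ->
  p / 4 <= bump i p q.
Proof.
move=> p0 h1 h2; have di := dyadic_gt0 i; have dn : dyadic i != 0 by rewrite gt_eqF.
rewrite /bump /ramp !ramp_coefS.
have e : 2 / dyadic i * q = 2 * (q / dyadic i) by field.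
have l1 : p <= q / dyadic i by rewrite ler_pdivlMr// mulrC.
have l2 : q / dyadic i <= 2 * p by rewrite ler_pdivrMr// mulrAC -dyadicS.
rewrite e; move: (q / dyadic i) l1 l2 => u l1 l2; rewrite le_min.
rewrite !minEle; do ![case: ifPn]; rewrite -?ltNge; move=> *; apply/andP; split; lra.
Qed.

Lemma bump_sum m p q : 0 <= p -> 0 <= q -> \sum_(i < m) bump i p q <= p.
Proof.
move=> p0 q0.
have rge k : 0 <= ramp k p q.
  by rewrite le_min p0 !mulr_ge0 ?invr_ge0// ltW// dyadic_gt0.
suff : \sum_(i < m) bump i p q <= p - ramp m.+2 p q by have := rge m.+2; lra.
elim: m => [|m IH]; first by rewrite big_ord0 subr_ge0 ge_min lexx.
rewrite big_ord_recr /=; apply: (le_trans (lerD IH (_ : _ <= ramp m.+2 p q - ramp m.+3 p q))).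
  by rewrite ge_min lexx.
lra.
Qed.

(** Since [dyadic i.+1 = 2 * dyadic i], multiplying the second difference by [dyadic i] gives half
    the increment of [dyadic k * ramp k p q] from [k = i] to [k = i.+1], which telescopes. *)
Lemma bump_dyadic_sum m p q : 0 <= p -> 0 <= q ->
  \sum_(i < m) dyadic i * bump i p q <= q.
Proof.
move=> p0 q0.
have rge k : 0 <= ramp k p q.
  by rewrite le_min p0 !mulr_ge0 ?invr_ge0// ltW// dyadic_gt0.
suff : \sum_(i < m) dyadic i * bump i p q <= dyadic m * ramp m p q / 2.
  move=> h; apply: (le_trans h); rewrite ler_pdivrMr//.
  have dm := dyadic_gt0 m; rewrite -ler_pdivlMl//.
  have -> : (dyadic m)^-1 * (q * 2) = 2 / dyadic m * q by field; rewrite gt_eqF.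
  by rewrite ge_min lexx orbT.
elim: m => [|m IH].
  by rewrite big_ord0 divr_ge0// mulr_ge0// ltW// dyadic_gt0.
rewrite big_ord_recr /= dyadicS; have dm := dyadic_gt0 m.
have : bump m p q <= ramp m.+1 p q - 2^-1 * ramp m p q by rewrite ge_min lexx orbT.
rewrite -(ler_pM2l dm) => h; apply: (le_trans (lerD IH h)).
by rewrite le_eqVlt; apply/orP; left; apply/eqP; field.
Qed.

End Nodes.

(** * Decomposition of the unit ball of the Calderon-Lozanovskii space *)

Section Representation.
Context {R : realType} {V : vectorLatticeType R} (e : V).
Context {Om : topologicalType} (h : V -> Om -> R).
Hypothesis hP : ideal_isomorphism e h.
Local Notation I := (principal_ideal e).

(** Carrying the representing function as an explicit expression reduces order relations in [V] to
    inequalities between reals, through [rep_le]. *)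
Definition rep (x : V) (f : Om -> R) : Prop := I x /\ forall w, h x w = f w.

Lemma rep_self x : I x -> rep x (h x).
Proof. by []. Qed.

Lemma repP a x y f g : rep x f -> rep y g -> rep (a *: x + y) (fun w => a * f w + g w).
Proof.
move=> [Ix xf] [Iy yg]; split; first exact: pidD (pidZ _ _) _.
by move=> w; rewrite (ideal_iso_linear hP)// xf yg.
Qed.

Lemma rep0 : rep 0 (fun=> 0).
Proof.
split=> [|w]; first exact: pid0.
have := ideal_iso_linear hP 1 w (pid0 e) (pid0 e).
by rewrite scale1r addr0 mul1r; lra.
Qed.

Lemma repZ a x f : rep x f -> rep (a *: x) (fun w => a * f w).
Proof.
move=> xf; have [? E] := repP a xf rep0; rewrite addr0 in E *; split.
  by apply: pidZ; case: xf.
by move=> w; rewrite E addr0.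
Qed.

Lemma repD x y f g : rep x f -> rep y g -> rep (x + y) (fun w => f w + g w).
Proof.
move=> xf yg; have [Ixy E] := repP 1 xf yg; rewrite scale1r in Ixy E.
by split => // w; rewrite E mul1r.
Qed.

Lemma repB x y f g : rep x f -> rep y g -> rep (x - y) (fun w => f w - g w).
Proof.
move=> xf /(repZ (-1)) yg; have [Ixy E] := repD xf yg; rewrite scaleN1r in Ixy E.
by split => // w; rewrite E mulN1r.
Qed.

Lemma rep_join x y f g : rep x f -> rep y g ->
  rep (Order.join x y) (fun w => Num.max (f w) (g w)).
Proof.
move=> [Ix xf] [Iy yg]; split; first exact: pid_join.
by move=> w; rewrite (ideal_iso_join hP)// xf yg.
Qed.

Lemma rep_meet x y f g : rep x f -> rep y g ->
  rep (Order.meet x y) (fun w => Num.min (f w) (g w)).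
Proof.
move=> [Ix xf] [Iy yg]; split; first exact: pid_meet.
by move=> w; rewrite (ideal_iso_meet hP)// xf yg.
Qed.

Lemma rep_sum J (r : seq J) (P : pred J) (F : J -> V) (G : J -> Om -> R) :
  (forall i, P i -> rep (F i) (G i)) ->
  rep (\sum_(i <- r | P i) F i) (fun w => \sum_(i <- r | P i) G i w).
Proof.
move=> FG; elim: r => [|i r IH].
  by rewrite big_nil; have [? E] := rep0; split => // w; rewrite big_nil.
rewrite big_cons; case: ifP => Pi.
  have [? E] := repD (FG _ Pi) IH; split => // w.
  by rewrite E big_cons Pi.
by have [? E] := IH; split => // w; rewrite E big_cons Pi.
Qed.

Lemma rep_inj x y f : rep x f -> rep y f -> x = y.
Proof.
move=> [Ix xf] [Iy yf]; have [_ inj _] := ideal_iso_bij hP.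
by apply: inj; rewrite ?inE//; apply: funext => w; rewrite xf yf.
Qed.

Lemma rep_le x y f g : rep x f -> rep y g -> (forall w, f w <= g w) -> x <= y.
Proof.
move=> xf yg fg; have [Iy yh] := yg.
rewrite -(@rep_inj (Order.join x y) y g) ?leUl//.
by have [? E] := rep_join xf yg; split => // w; rewrite E max_r.
Qed.

Lemma rep_le_fun x y f g w : rep x f -> rep y g -> x <= y -> f w <= g w.
Proof.
move=> xf yg xy; have [_ /(_ w)] := rep_join xf yg.
by rewrite (join_r xy); have [_ ->] := yg => ->; rewrite le_max lexx.
Qed.

Lemma rep_ge0 x f w : rep x f -> 0 <= x -> 0 <= f w.
Proof. by move=> xf; exact: (rep_le_fun w rep0 xf). Qed.

Lemma rep_abs x f : rep x f -> rep (vabs x) (fun w => `|f w|).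
Proof.
move=> xf; have [? E] := rep_join xf (repZ (-1) xf).
rewrite scaleN1r in E; split; first by case: xf => Ix _; exact: pid_vabs.
by move=> w; rewrite E mulN1r; case: (leP 0 (f w)) => f0;
  [rewrite ger0_norm// max_l//|rewrite ltr0_norm// max_r//]; lra.
Qed.

Lemma rep_continuous x f : rep x f -> continuous f.
Proof.
move=> [Ix xf]; have <- : h x = f by apply: funext.
by have [hI _ _] := ideal_iso_bij hP; exact: hI.
Qed.

Lemma rep_exists f : continuous f -> exists x, rep x f.
Proof.
move=> cf; have [_ _ /(_ f cf) [x Ix <-]] := ideal_iso_bij hP.
by exists x.
Qed.

End Representation.

Section Decomposition.
Context {R : realType} {V : vectorLatticeType R} (phi : R -> R -> R).
Hypothesis phiP : class_P phi.
Implicit Types (x y : V).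

Lemma fc_ideal0 x0 x1 : 0 <= x0 -> 0 <= x1 -> principal_ideal (Order.join x0 x1) x0.
Proof.
move=> h0 h1; have e0 : 0 <= Order.join x0 x1 by rewrite (le_trans h0)// leUl.
by apply: (pid_le h0 (leUl _ _)); exact: pid_unit.
Qed.

Lemma fc_ideal1 x0 x1 : 0 <= x0 -> 0 <= x1 -> principal_ideal (Order.join x0 x1) x1.
Proof. by move=> h0 h1; rewrite joinC; exact: fc_ideal0. Qed.

(* Truncating x0 and x1 between multiples of |x| keeps the ratio x1 / x0 in a compact
   interval, so that finitely many dyadic bumps, grouped by nodes c j, suffice. *)
Lemma CL_decomposition (x0 x1 x y : V) (eps : R) :
  0 <= x0 -> 0 <= x1 -> functional_calculus phi x0 x1 y -> vabs x <= y ->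
  0 < eps -> eps <= 1 ->
  exists N (c : 'I_N -> R) (v : 'I_N -> V) (M : R),
  [/\ (forall j, 0 < c j) /\ x = \sum_j phi 1 (c j) *: v j,
      \sum_j vabs (v j) <= 32 *: Order.join x0 (eps *: vabs x),
      \sum_j c j *: vabs (v j) <= 32 *: Order.join x1 (eps *: vabs x),
      forall j, vabs (v j) <= M *: vabs x &
      forall p q, 0 < p -> 0 < q ->
        \sum_j phi 1 (c j) * Num.min p (q / c j) <= 5 * phi p q].
Proof.
move=> x00 x10 [Om [h [_ _ hP Iy yP]]] xy eps0 eps1.
set e := Order.join x0 x1 in hP Iy.
have e0 : 0 <= e by rewrite (le_trans x00)// leUl.
have I0 : principal_ideal e x0 by exact: fc_ideal0.
have I1 : principal_ideal e x1 by exact: fc_ideal1.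
have [M M1 MP] := class_P_trunc phiP eps0.
have M0 : 0 < M by exact: lt_le_trans M1.
(* The truncations of [x0] and [x1] will lie between [eps |x|] and [M |x|], so their ratio lies
   between [rho] and [M / eps]; [m] levels reach beyond the upper end. *)
pose rho := eps / M; have rho0 : 0 < rho by rewrite divr_gt0.
have rhon0 : rho != 0 by rewrite gt_eqF.
pose f := phi 1.
have f_gt0 r : 0 < r -> 0 < f r by move=> r0; exact: class_P_gt0.
have f_mono r r' : 0 < r -> r <= r' -> f r <= f r' by exact: class_P_section_mono.
have f_anti r r' : 0 < r -> r <= r' -> f r' / r' <= f r / r by exact: class_P_section_anti.
pose m := Num.bound (M / eps / rho).
have mP : M / eps < dyadic rho m.
  rewrite /dyadic [rho * _]mulrC -ltr_pdivrMr//.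
  have bd : 0 <= M / eps / rho by rewrite ltW// !divr_gt0.
  apply: (lt_trans (archi_boundP bd)).
  by rewrite -natrX ltr_nat ltn_expl.
have [s [sm sP]] := dyadic_nodes f_gt0 f_mono f_anti rho0 m.
have dg := dyadic_gt0 rho0.
pose N := size s; pose c (j : 'I_N) := dyadic rho (tnth (in_tuple s) j).
have c0 j : 0 < c j by exact: dg.
have /choice[kap kapP] : forall i : 'I_m, exists j : 'I_N,
    f (dyadic rho i) <= 2 * f (c j) * Num.min 1 (dyadic rho i / c j).
  move=> i; have [k ks kP] := sm i (ltn_ord i).
  have ki : (index k s < N)%N by rewrite index_mem.
  by exists (Ordinal ki); rewrite /c (tnth_nth 0%N) /= nth_index.
pose w := vabs x; have w0 : 0 <= w by exact: vabs_ge0.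
have Ix : principal_ideal e x.
  by apply: (pid_solid _ Iy); exact: le_trans xy (vabs_ge y).
pose p := Order.meet (Order.join x0 (eps *: w)) (M *: w).
pose q := Order.meet (Order.join x1 (eps *: w)) (M *: w).
have epsw0 : 0 <= eps *: w by rewrite vl_scale_ge0// ltW.
have Mw0 : 0 <= M *: w by rewrite vl_scale_ge0// ltW.
have p0 : 0 <= p by rewrite lexI Mw0 (le_trans epsw0)// leUr.
have q0 : 0 <= q by rewrite lexI Mw0 (le_trans epsw0)// leUr.
have rx := rep_self h Ix.
have rw := rep_abs hP rx.
have r0 := rep_self h I0; have r1 := rep_self h I1.
have rp : rep e h p _ :=
  rep_meet hP (rep_join hP r0 (repZ hP eps rw)) (repZ hP M rw).
have rq : rep e h q _ :=
  rep_meet hP (rep_join hP r1 (repZ hP eps rw)) (repZ hP M rw).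
set P := (fun u : Om => Num.min _ _) in rp.
set Q := (fun u : Om => Num.min _ _) in rq.
have P0 u : 0 <= P u by exact: (rep_ge0 hP u rp).
have Q0 u : 0 <= Q u by exact: (rep_ge0 hP u rq).
pose G k := Order.meet p ((2 / dyadic rho k) *: q).
have rG k : rep e h (G k) (fun u => ramp rho k (P u) (Q u)).
  exact: (rep_meet hP rp (repZ hP _ rq)).
pose th (i : 'I_m) := Order.meet (G i.+2 - G i.+3) (G i.+1 - 2^-1 *: G i).
have rth i : rep e h (th i) (fun u => bump rho i (P u) (Q u)).
  exact: (rep_meet hP (repB hP (rG _) (rG _)) (repB hP (rG _) (repZ hP _ (rG _)))).
have th0 i : 0 <= th i.
  by apply: (rep_le hP (rep0 hP) (rth i)) => u; exact: bump_ge0.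
have th_sum : \sum_i th i <= p.
  apply: (rep_le hP (rep_sum hP _ (fun i _ => rth i)) rp) => u /=.
  exact: bump_sum.
have th_sum' : \sum_(i < m) dyadic rho i *: th i <= q.
  apply: (rep_le hP (rep_sum hP _ (fun i _ => repZ hP _ (rth i))) rq) => u /=.
  exact: (bump_dyadic_sum rho0).
(* A single bump suffices at each point. The factor 16 is 2 for the truncation, 2 for replacing the
   ratio by [dyadic rho i], and 4 from [bump_lb]. *)
have wle : w <= \sum_(i < m) (16 * f (dyadic rho i)) *: th i.
  apply: (rep_le hP rw (rep_sum hP _ (fun i _ => repZ hP _ (rth i)))) => u /=.
  set W := `|h x u|.
  have term0 (i : 'I_m) : 0 <= 16 * f (dyadic rho i) * bump rho i (P u) (Q u).
    by rewrite !mulr_ge0 ?bump_ge0// ltW// f_gt0.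
  have [W0|W0] := leP W 0; first by rewrite (le_trans W0)// sumr_ge0.
  pose X0 := h x0 u; pose X1 := h x1 u.
  have X00 : 0 <= X0 by exact: (rep_ge0 hP u r0).
  have X10 : 0 <= X1 by exact: (rep_ge0 hP u r1).
  have Wle : W <= pext phi X0 X1.
    by rewrite -(extensionE phiP)// -yP; exact: (rep_le_fun hP u rw (rep_self h Iy)).
  pose s1 := Num.max X0 (eps * W); pose t1 := Num.max X1 (eps * W).
  have eW : 0 < eps * W by rewrite mulr_gt0.
  have s10 : 0 < s1 by rewrite lt_max eW orbT.
  have t10 : 0 < t1 by rewrite lt_max eW orbT.
  have W1 : W <= phi s1 t1.
    rewrite -(pext_interior phiP)//; apply: (le_trans Wle).
    by apply: pext_mono => //; rewrite le_max lexx.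
  have W' : 0 < W^-1 by rewrite invr_gt0.
  have es : eps <= W^-1 * s1 by rewrite mulrC ler_pdivlMr// le_max lexx orbT.
  have et : eps <= W^-1 * t1 by rewrite mulrC ler_pdivlMr// le_max lexx orbT.
  have := MP _ _ es et; rewrite (class_P_homogeneous phiP)//.
  rewrite mulrC ler_pdivlMr// mul1r => /(_ W1).
  have E r : Num.min (W^-1 * r) M = W^-1 * Num.min r (M * W).
    by rewrite minr_pMr ?ltW// mulrC [_ * (M * W)]mulrCA mulVf ?mulr1 // gt_eqF.
  rewrite !E -/(P u) -/(Q u).
  have PQ0 : 0 < P u /\ 0 < Q u.
    by rewrite /P /Q !lt_min !lt_max eW !orbT !mulr_gt0.
  case: PQ0 => Pu0 Qu0.
  rewrite (class_P_homogeneous phiP)// [W^-1 * _]mulrC ler_pdivlMr//.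
  rewrite (class_P_section phiP)// -/f => Wf.
  have eWM : eps * W <= M * W by rewrite ler_pM2r// (le_trans eps1).
  have bnd r : eps * W <= Num.min (Num.max r (eps * W)) (M * W) <= M * W.
    by rewrite le_min le_max lexx orbT eWM ge_min lexx orbT.
  have /andP[PuL PuU] : eps * W <= P u <= M * W by exact: bnd.
  have /andP[QuL QuU] : eps * W <= Q u <= M * W by exact: bnd.
  have rl : rho <= Q u / P u.
    rewrite ler_pdivlMr// (le_trans _ QuL)// /rho mulrAC ler_pdivrMr// -mulrA.
    by rewrite ler_pM2l// mulrC.
  have ru : Q u / P u < dyadic rho m.
    apply: le_lt_trans mP; rewrite ler_pdivrMr// (le_trans QuU)//.
    by rewrite mulrAC ler_pdivlMr// -mulrA ler_pM2l// mulrC.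
  have [i im /andP[il iu]] := dyadic_locate rl ru.
  rewrite (bigD1 (Ordinal im))//=; apply: ler_wpDr; first by apply: sumr_ge0.
  have di := dg i.
  have fi : f (Q u / P u) <= 2 * f (dyadic rho i).
    apply: (le_trans (f_mono _ _ (lt_le_trans rho0 rl) iu)).
    have := f_anti _ _ di (dyadic_le rho0 (leqnSn i)).
    have d2 : 0 < 2 * dyadic rho i by exact: mulr_gt0.
    rewrite dyadicS (ler_pdivrMr _ _ d2).
    have -> // : f (dyadic rho i) / dyadic rho i * (2 * dyadic rho i) = 2 * f (dyadic rho i).
    by field; rewrite gt_eqF.
  have bl : P u / 4 <= bump rho i (P u) (Q u).
    apply: bump_lb => //; first by rewrite -ler_pdivlMr.
    by rewrite -ler_pdivrMr.
  have fi0 := f_gt0 _ di.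
  have h1 := ler_wpM2l (ltW Pu0) fi.
  have h2 := ler_wpM2l (ltW fi0) bl.
  lra.
(* The weight makes both [mu i <= 1] and [c (kap i) * mu i <= dyadic rho i], so grouping the bumps
   by nodes preserves the bounds by [p] and by [q]. *)
pose mu (i : 'I_m) := Num.min 1 (dyadic rho i / c (kap i)).
have mu0 i : 0 <= mu i by rewrite le_min ler01 divr_ge0// ltW.
have mu1 i : mu i <= 1 by rewrite ge_min lexx.
have muc i : c (kap i) * mu i <= dyadic rho i.
  rewrite mulrC -ler_pdivlMr//; first by rewrite ge_min lexx orbT.
pose W j := \sum_(i | kap i == j) mu i *: th i.
have W0 j : 0 <= W j by apply: vl_sum_ge0 => i _; exact: vl_scale_ge0.
(* 32 is 16 times the factor 2 in the covering property of the nodes. *)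
pose pp j := (32 * f (c j)) *: W j.
have pp0 j : 0 <= pp j.
  by rewrite vl_scale_ge0// mulr_ge0// ltW// f_gt0.
have wpp : w <= \sum_j pp j.
  apply: (le_trans wle).
  rewrite (partition_big kap xpredT)//=; apply: vl_sum_le => j _.
  rewrite /pp /W scaler_sumr; apply: vl_sum_le => i /eqP ij.
  rewrite scalerA vl_leZl// /mu ij; have := kapP i; rewrite ij; lra.
(* The bumps only dominate [|x|]; the Riesz decomposition turns this into an exact expansion of [x],
   to which a linear operator can be applied. *)
have [u [xu uP]] := vl_riesz_signed pp0 wpp.
have fc0 j : 0 < f (c j) by exact: f_gt0.
pose v j := (f (c j))^-1 *: u j.
have vW j : vabs (v j) <= 32 *: W j.
  rewrite /v vabsZ gtr0_norm ?invr_gt0//.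
  have := vl_leZ _ (uP j); move=> /(_ (f (c j))^-1); rewrite invr_ge0 (ltW (fc0 j)).
  move=> /(_ isT) hle; apply: (le_trans hle).
  by rewrite /pp scalerA mulrCA mulVf ?mulr1// gt_eqF.
have Wsum : \sum_j W j <= p.
  apply: le_trans th_sum; rewrite [X in _ <= X](partition_big kap xpredT)//=.
  apply: vl_sum_le => j _; apply: vl_sum_le => i _.
  by rewrite -[X in _ <= X]scale1r vl_leZl.
have Wsum' : \sum_j c j *: W j <= q.
  apply: le_trans th_sum'; rewrite [X in _ <= X](partition_big kap xpredT)//=.
  apply: vl_sum_le => j _; rewrite scaler_sumr; apply: vl_sum_le => i /eqP ij.
  by rewrite scalerA vl_leZl// -ij.
have vsum : \sum_j vabs (v j) <= 32 *: p.
  apply: (@le_trans _ _ (\sum_j 32 *: W j)); first exact: vl_sum_le.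
  by rewrite -scaler_sumr vl_leZ.
exists N, c, v, (32 * M); split.
- split => //; rewrite xu; apply: eq_bigr => j _.
  by rewrite scalerA divff ?scale1r// gt_eqF.
- by apply: (le_trans vsum); rewrite vl_leZ// leIl.
- apply: (@le_trans _ _ (\sum_j 32 *: (c j *: W j))).
    apply: vl_sum_le => j _; apply: (le_trans (vl_leZ (ltW (c0 j)) (vW j))).
    by rewrite !scalerA mulrC.
  rewrite -scaler_sumr; apply: vl_leZ => //; apply: (le_trans Wsum').
  exact: leIl.
- move=> j; apply: (@le_trans _ _ (32 *: p)).
    apply: le_trans vsum; rewrite (bigD1 j)//= vl_leDl// vl_sum_ge0// => k _.
    exact: vabs_ge0.
  by rewrite -scalerA vl_leZ// leIr.
- move=> p' q' p'0 q'0; rewrite (class_P_section phiP p'0 q'0).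
  apply: le_trans (sP _ _ p'0 q'0).
  rewrite [leRHS](big_nth 0%N) big_mkord.
  by rewrite le_eqVlt; apply/orP; left; apply/eqP; apply: eq_bigr => j _;
    rewrite /c (tnth_nth 0%N).
Qed.

End Decomposition.

(** * Existence and comparison of values of the functional calculus *)

Section FunctionalCalculusTheory.
Context {R : realType} {V : vectorLatticeType R} (phi : R -> R -> R).
Hypothesis phiP : class_P phi.
Implicit Types (x y : V).

(** For [m] slightly above the maximum, [(s, t)] lies strictly below [(m, r * m)], where phi equals
    [m * phi 1 r]. *)
Lemma pext_le_section s t r : 0 <= s -> 0 <= t -> 0 < r ->
  pext phi s t <= phi 1 r * Num.max s (t / r).
Proof.
move=> s0 t0 r0; apply/ler_addgt0Pr => d d0.
have f0 : 0 < phi 1 r by exact: class_P_gt0.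
pose m := Num.max s (t / r) + d / phi 1 r.
have m1 : s < m by rewrite ltr_pwDr ?divr_gt0// le_max lexx.
have m2 : t / r < m by rewrite ltr_pwDr ?divr_gt0// le_max lexx orbT.
have m0 : 0 < m by exact: le_lt_trans m1.
have : pext phi s t <= phi m (r * m).
  by apply: pext_ub => //; rewrite mulrC -ltr_pdivrMr.
rewrite -[X in phi X _]mulr1 [r * m]mulrC (class_P_homogeneous phiP)//.
by rewrite mulrC mulrDr [_ * (d / _)]mulrCA divff ?mulr1// gt_eqF.
Qed.

(** For a strictly larger point [(s', t')], the choice [r = t' / s'] makes the right-hand side at
    most [s' * phi 1 r = phi s' t']. *)
Lemma pext_ge_section s t l : 0 <= s -> 0 <= t ->
  (forall r, 0 < r -> l <= phi 1 r * Num.max s (t / r)) -> l <= pext phi s t.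
Proof.
move=> s0 t0 lP; apply: pext_lb => s' t' ss tt.
have s'0 : 0 < s' by exact: le_lt_trans ss.
have t'0 : 0 < t' by exact: le_lt_trans tt.
apply: (le_trans (lP (t' / s') (divr_gt0 t'0 s'0))).
rewrite [leRHS](class_P_section phiP)// mulrC ler_pM2r; last first.
  by apply: class_P_gt0 => //; exact: divr_gt0.
rewrite ge_max (ltW ss)/= invf_div mulrCA ler_piMr ?(ltW s'0)//.
by rewrite ler_pdivrMr// mul1r ltW.
Qed.

Lemma fc_exists x0 x1 : vl_archimedean V -> uniformly_complete V ->
  0 <= x0 -> 0 <= x1 -> exists y, functional_calculus phi x0 x1 y.
Proof.
move=> VA VU x00 x10; set e := Order.join x0 x1.
have e0 : 0 <= e by rewrite (le_trans x00)// leUl.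
have [Om [h [cO hO hP]]] := kakutani e0 VA VU.
have r0 := rep_self h (fc_ideal0 x00 x10).
have r1 := rep_self h (fc_ideal1 x00 x10).
have h0 w : 0 <= h x0 w by exact: (rep_ge0 hP w r0).
have h1 w : 0 <= h x1 w by exact: (rep_ge0 hP w r1).
have cf : continuous (fun w => pext phi (h x0 w) (h x1 w)).
  move=> w; apply: pext_cvg => //.
  - exact: (rep_continuous hP r0).
  - exact: (rep_continuous hP r1).
  - exact: nearW.
  - exact: nearW.
have [y [Iy yE]] := rep_exists hP cf.
by exists y, Om, h; split => // w; rewrite yE extensionE.
Qed.

Section Comparison.
Variables (x0 x1 y : V).
Hypotheses (x00 : 0 <= x0) (x10 : 0 <= x1)
  (yP : functional_calculus phi x0 x1 y).

Lemma fc_ge0 : 0 <= y.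
Proof.
have [Om [h [_ _ hP Iy yE]]] := yP.
have r0 := rep_self h (fc_ideal0 x00 x10).
have r1 := rep_self h (fc_ideal1 x00 x10).
apply: (rep_le hP (rep0 hP) (rep_self h Iy)) => w; rewrite yE.
have h0 := rep_ge0 hP w r0 x00; have h1 := rep_ge0 hP w r1 x10.
by rewrite extensionE// pext_ge0.
Qed.

Lemma fc_le_section r : 0 < r -> y <= phi 1 r *: Order.join x0 (r^-1 *: x1).
Proof.
move=> rpos; have [Om [h [_ _ hP Iy yE]]] := yP.
have r0 := rep_self h (fc_ideal0 x00 x10).
have r1 := rep_self h (fc_ideal1 x00 x10).
apply: (rep_le hP (rep_self h Iy)
  (repZ hP _ (rep_join hP r0 (repZ hP r^-1 r1)))) => w; rewrite yE.
have h0 := rep_ge0 hP w r0 x00; have h1 := rep_ge0 hP w r1 x10.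
by rewrite extensionE// mulrC [r^-1 * _]mulrC mulrC; exact: pext_le_section.
Qed.

Lemma fc_le_join : y <= Order.join x0 x1.
Proof.
have := fc_le_section ltr01.
by rewrite (class_P_normalized phiP) invr1 !scale1r.
Qed.

Lemma fc_sum_le (N : nat) (c : 'I_N -> R) (K : R) : 0 < K ->
  (forall p q, 0 < p -> 0 < q ->
     \sum_j phi 1 (c j) * Num.min p (q / c j) <= K * phi p q) ->
  (forall j, 0 < c j) ->
  \sum_j phi 1 (c j) *: Order.meet x0 ((c j)^-1 *: x1) <= K *: y.
Proof.
move=> K0 cP c0; have [Om [h [_ _ hP Iy yE]]] := yP.
have r0 := rep_self h (fc_ideal0 x00 x10).
have r1 := rep_self h (fc_ideal1 x00 x10).
apply: (rep_le hP (rep_sum hP _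
  (fun j _ => repZ hP _ (rep_meet hP r0 (repZ hP (c j)^-1 r1))))
  (repZ hP K (rep_self h Iy))) => w /=; rewrite yE.
have h0 := rep_ge0 hP w r0 x00; have h1 := rep_ge0 hP w r1 x10.
rewrite extensionE// mulrC -ler_pdivrMr//; apply: pext_lb => s' t' ss tt.
have s'0 : 0 < s' by exact: le_lt_trans ss.
have t'0 : 0 < t' by exact: le_lt_trans tt.
rewrite ler_pdivrMr// [_ * K]mulrC; apply: le_trans (cP _ _ s'0 t'0).
apply: ler_sum => j _; rewrite ler_pM2l ?class_P_gt0//.
have hc : (c j)^-1 * h x1 w <= t' / c j.
  by rewrite [leRHS]mulrC ler_pM2l ?invr_gt0// ltW.
by rewrite le_min !ge_min (ltW ss) hc orbT.
Qed.

Lemma fc_diag_le : x0 = x1 -> x0 <= y.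
Proof.
move=> x01; have [Om [h [_ _ hP Iy yE]]] := yP.
have r0 := rep_self h (fc_ideal0 x00 x10).
apply: (rep_le hP r0 (rep_self h Iy)) => w; rewrite yE -x01.
have h0 := rep_ge0 hP w r0 x00.
rewrite extensionE//; apply: pext_lb => s' t' ss tt.
have m0 : 0 < Num.min s' t' by rewrite lt_min !(le_lt_trans h0).
apply: (@le_trans _ _ (phi (Num.min s' t' * 1) (Num.min s' t' * 1))).
  rewrite (class_P_homogeneous phiP)// (class_P_normalized phiP) mulr1.
  by rewrite le_min (ltW ss) (ltW tt).
by rewrite mulr1; apply: class_P_mono => //; rewrite ge_min lexx ?orbT.
Qed.

(* By pext_le_section and pext_ge_section, phi(x0, x1) is the infimum of the lattice
   expressions of fc_le_section, which allows comparing values of the functional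
   calculus obtained from different representations. *)
Lemma fc_le (x0' x1' y' : V) (a : R) : 0 <= x0' -> 0 <= x1' ->
  functional_calculus phi x0' x1' y' -> 0 < a ->
  x0 <= a *: x0' -> x1 <= a *: x1' -> y <= a *: y'.
Proof.
move=> x0'0 x1'0 [Om [h [_ _ hP Iy yE]]] a0 le0 le1.
have r0 := rep_self h (fc_ideal0 x0'0 x1'0).
have r1 := rep_self h (fc_ideal1 x0'0 x1'0).
have f0 r : 0 < r -> 0 < phi 1 r by move=> rpos; exact: class_P_gt0.
have yle r : 0 < r -> y <= a *: (phi 1 r *: Order.join x0' (r^-1 *: x1')).
  move=> rpos; apply: (le_trans (fc_le_section rpos)).
  rewrite scalerA mulrC -scalerA; apply: vl_leZ; first exact/ltW/f0.
  rewrite vl_scale_joinr ?(ltW a0)// leUx.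
  rewrite (le_trans le0 (leUl _ _)) /=; apply: le_trans (leUr _ _).
  by rewrite scalerA mulrC -scalerA; apply: vl_leZ; rewrite ?invr_ge0 ?(ltW rpos).
have rU r := repZ hP a (repZ hP (phi 1 r) (rep_join hP r0 (repZ hP r^-1 r1))).
(* The bound [yle] at [r = 1] places [y] in the ideal of the other pair, so both sides can be
   evaluated in the same representation. *)
have Iy' : principal_ideal (Order.join x0' x1') y.
  apply: (pid_le fc_ge0 (yle 1 ltr01)).
  by have [] := rU 1.
have ry := rep_self h Iy'.
apply: (rep_le hP ry (repZ hP a (rep_self h Iy))) => w; rewrite yE.
have h0 := rep_ge0 hP w r0 x0'0; have h1 := rep_ge0 hP w r1 x1'0.
rewrite extensionE// mulrC -ler_pdivrMr//; apply: pext_ge_section => // r rpos.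
rewrite ler_pdivrMr//.
by have := rep_le_fun hP w ry (rU r) (yle r rpos); rewrite mulrC [r^-1 * _]mulrC.
Qed.

End Comparison.

End FunctionalCalculusTheory.

(** * Order and completeness in quasi-Banach lattices *)

Section QuasiBanachBasics.
Context {R : realType} {E : quasiBanachLatticeType R}.
Implicit Types (x y : E).

Lemma qnorm0 : qnorm (0 : E) = 0.
Proof. by rewrite -(scale0r 0) qnormZ normr0 mul0r. Qed.

Lemma qnormZ_ge0 (a : R) x : 0 <= a -> qnorm (a *: x) = a * qnorm x.
Proof. by move=> a0; rewrite qnormZ ger0_norm. Qed.

Lemma qnormN x : qnorm (- x) = qnorm x.
Proof. by rewrite -scaleN1r qnormZ normrN1 mul1r. Qed.

Lemma qnorm_vabs x : qnorm (vabs x) = qnorm x.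
Proof. by apply/le_anti; rewrite !qnorm_mono// vabs_vabs. Qed.

Lemma qnorm_le x y : 0 <= x -> x <= y -> qnorm x <= qnorm y.
Proof.
by move=> x0 xy; apply: qnorm_mono; rewrite !ge0_vabs// (le_trans x0).
Qed.

Definition qnorm_cvg (u : nat -> E) (l : E) : Prop :=
  forall d : R, 0 < d -> exists N, forall n, (N <= n)%N -> qnorm (u n - l) < d.

(** The positive part of [l - v] is dominated by [|u n - l|] for large [n], so its quasi-norm
    vanishes. *)
Lemma qnorm_cvg_le u l v N : qnorm_cvg u l ->
  (forall n, (N <= n)%N -> u n <= v) -> l <= v.
Proof.
move=> ul uv; pose p := Order.join (l - v) 0.
have pz : p = 0.
  apply: qnorm_eq0; apply/le_anti; rewrite qnorm_ge0 andbT.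
  apply/ler_addgt0Pr => d d0; rewrite add0r; have [M MP] := ul d d0.
  apply: (le_trans _ (ltW (MP (maxn M N) (leq_maxl _ _)))).
  apply: qnorm_mono; rewrite ge0_vabs; last exact: leUr.
  rewrite leUx vabs_ge0 andbT vabs_distrC; apply: le_trans (vabs_ge _).
  by rewrite vl_leD// vl_leN uv// leq_maxr.
by rewrite -[l](subrK v) -[X in _ <= X]add0r vl_leD2r// -pz leUl.
Qed.

Lemma qnorm_cvg_ge u l v N : qnorm_cvg u l ->
  (forall n, (N <= n)%N -> v <= u n) -> v <= l.
Proof.
move=> ul uv; rewrite -vl_leN; apply: (@qnorm_cvg_le (fun n => - u n) _ _ N).
  move=> d /ul[M MP]; exists M => n /MP.
  by rewrite -qnormN opprB opprK addrC.
by move=> n /uv; rewrite vl_leN.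
Qed.

(** The increments are summed in the order, before taking the quasi-norm, so the quasi-triangle
    constant does not accumulate. *)
Lemma quasi_banach_uniformly_complete : uniformly_complete E.
Proof.
move=> e u e0 ue.
have dist n d : vabs (u (n + d)%N - u n) <= (2 * 2^-1 ^+ n) *: e.
  suff : vabs (u (n + d)%N - u n) <= (2 * 2^-1 ^+ n - 2 * 2^-1 ^+ (n + d)) *: e.
    move=> h; apply: (le_trans h); apply: vl_leZl => //.
    by rewrite lerBlDr lerDl mulr_ge0// ltW// half_pow_gt0.
  elim: d => [|d IH]; first by rewrite addn0 !subrr scale0r vabs0.
  have -> : u (n + d.+1)%N - u n = (u (n + d).+1 - u (n + d)%N) + (u (n + d)%N - u n).
    by rewrite addnS addrA subrK.
  apply: (le_trans (vabsD _ _)); apply: (le_trans (vl_leD (ue _) IH)).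
  by rewrite -scalerDl; apply: vl_leZl => //; rewrite addnS exprS; lra.
have qdist n m : (n <= m)%N -> qnorm (u m - u n) <= 2 * 2^-1 ^+ n * qnorm e.
  move=> nm; rewrite -qnormZ_ge0; last by rewrite mulr_ge0// ltW// half_pow_gt0.
  apply: qnorm_mono; rewrite -(subnKC nm); apply: (le_trans (dist _ _)).
  exact: vabs_ge.
have [l lP] : exists l, qnorm_cvg u l.
  apply: qnorm_complete => d d0.
  have c0 : 0 < d / (2 * (qnorm e + 1)).
    by rewrite divr_gt0// mulr_gt0// ltr_wpDl// qnorm_ge0.
  have [N NP] := half_pow_lt c0; exists N.
  have small n m : (N <= n)%N -> (n <= m)%N -> qnorm (u m - u n) < d.
    move=> Nn nm; apply: (le_lt_trans (qdist _ _ nm)).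
    have h1 : 2^-1 ^+ n <= 2^-1 ^+ N :> R.
      by rewrite ler_wiXn2l ?invr_ge0// invf_le1 ?ler1n.
    have e1 : 0 < 2 * (qnorm e + 1) by rewrite mulr_gt0// ltr_wpDl// qnorm_ge0.
    rewrite ltr_pdivlMr// in NP; apply: le_lt_trans NP.
    have qe := qnorm_ge0 e; have h2 := half_pow_gt0 (R := R) N.
    have := ler_wpM2r qe h1; nra.
  move=> m n Nm Nn; have [mn|nm] := leqP n m; first exact: small.
  by rewrite -qnormN opprB small// ltnW.
exists l => n; rewrite vabs_le; apply/andP; split.
  rewrite vl_leBlDr; apply: (qnorm_cvg_le (N := n) lP) => m nm.
  by rewrite -vl_leBlDr -(subnKC nm); apply: le_trans (dist _ _); exact: vabs_ge.
rewrite opprB vl_leBlDr addrC -vl_leBlDr.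
apply: (qnorm_cvg_ge (N := n) lP) => m nm.
rewrite vl_leBlDr addrC -vl_leBlDr -(subnKC nm).
by apply: le_trans (dist _ _); rewrite -opprB; exact: vabs_geN.
Qed.

End QuasiBanachBasics.

(** * Couples of ideals *)

Definition quasi_constant {R : realType} (E : quasiBanachLatticeType R) (C : R) : Prop :=
  1 <= C /\ forall x y : E, qnorm (x + y) <= C * (qnorm x + qnorm y).

Lemma quasi_constant_exists {R : realType} (E : quasiBanachLatticeType R) :
  exists C, quasi_constant E C.
Proof. by have [C C1 CP] := @qnormD R E; exists C. Qed.

Lemma quasi_constant_le {R : realType} (E : quasiBanachLatticeType R) (C C' : R) :
  C <= C' -> quasi_constant E C -> quasi_constant E C'.
Proof.
move=> CC [C1 CP]; split; first exact: le_trans CC.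
move=> x y; apply: (le_trans (CP x y)); apply: ler_wpM2r => //.
by rewrite addr_ge0// qnorm_ge0.
Qed.

(* The weights absorb the constant of the quasi-triangle inequality. *)
Definition series_weight {R : realType} (C : R) (k : nat) : R := (2 * C)^-1 ^+ k.+1.

(** With [q = (2 * C)^-1], peeling off the first term of a block gives
    [C * (q ^+ m.+1 + q ^+ m.+1) = q ^+ m], so the bound is independent of the length of the block.
    The final [2 * C] comes from splitting [A] into [A - S N] and [S N], each of quasi-norm at most
    1. *)
Lemma qnorm_series {R : realType} (E : quasiBanachLatticeType R) (C : R) (a : nat -> E) :
  quasi_constant E C -> (forall k, 0 <= a k) -> (forall k, qnorm (a k) <= 1) ->
  exists A, [/\ 0 <= A, forall k, series_weight C k *: a k <= A & qnorm A <= 2 * C].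
Proof.
move=> [C1 CP] a0 a1; have C0 : 0 < C by exact: lt_le_trans C1.
have C20 : 0 < 2 * C by rewrite mulr_gt0.
pose q : R := (2 * C)^-1; have q0 : 0 < q by rewrite invr_gt0.
have qC : C * q = 2^-1 by rewrite /q; field; rewrite gt_eqF.
have sw0 k : 0 <= series_weight C k by rewrite exprn_ge0// ltW.
have tail d m : qnorm (\sum_(m <= k < m + d) series_weight C k *: a k) <= q ^+ m.
  elim: d m => [|d IH] m; first by rewrite addn0 big_geq// qnorm0 exprn_ge0// ltW.
  have mm : (m < m + d.+1)%N by rewrite addnS ltnS leq_addr.
  rewrite (big_ltn mm) addnS -addSn.
  apply: (le_trans (CP _ _)).
  have h1 := IH m.+1; have h2 : qnorm (series_weight C m *: a m) <= q ^+ m.+1.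
    rewrite qnormZ_ge0// -[leRHS]mulr1 ler_wpM2l//.
  apply: (le_trans (ler_wpM2l (ltW C0) (lerD h2 h1))).
  have -> : C * (q ^+ m.+1 + q ^+ m.+1) = (C * q) * 2 * q ^+ m by rewrite exprS; ring.
  by rewrite qC mulVf ?pnatr_eq0// mul1r.
pose S n := \sum_(0 <= k < n) series_weight C k *: a k.
have SE m n : (m <= n)%N -> S n - S m = \sum_(m <= k < n) series_weight C k *: a k.
  by move=> mn; rewrite /S (big_cat_nat (n := m))//= addrAC subrr add0r.
have SD m n : (m <= n)%N -> qnorm (S n - S m) <= q ^+ m.
  by move=> mn; rewrite SE// -{1}(subnKC mn).
have qle m : q ^+ m <= 2^-1 ^+ m.
  have qh : q <= 2^-1 by rewrite /q lef_pV2 ?posrE//; lra.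
  by rewrite lerXn2r ?nnegrE ?(ltW q0)// invr_ge0.
have [A AP] : exists A, qnorm_cvg S A.
  apply: qnorm_complete => d d0; have [N NP] := half_pow_lt d0; exists N.
  have small m n : (N <= m)%N -> (m <= n)%N -> qnorm (S n - S m) < d.
    move=> Nm mn; apply: le_lt_trans NP; apply: (le_trans (SD _ _ mn)).
    apply: (le_trans (qle _)); rewrite ler_wiXn2l ?invr_ge0//.
    by rewrite invf_le1 ?ler1n.
  move=> m n Nm Nn; have [mn|nm] := leqP n m; first exact: small.
  by rewrite -qnormN opprB small// ltnW.
have Smono m n : (m <= n)%N -> S m <= S n.
  move=> mn; rewrite -vl_subr_ge0 SE//; apply: vl_sum_ge0 => k _.
  exact: vl_scale_ge0.
have SA n : S n <= A by apply: (qnorm_cvg_ge (N := n) AP) => m; exact: Smono.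
exists A; split.
- by apply: le_trans (SA 0%N); rewrite /S big_geq.
- move=> k; apply: le_trans (SA k.+1); rewrite /S big_nat_recr//=.
  by apply: vl_leDr; apply: vl_sum_ge0 => i _; exact: vl_scale_ge0.
- have [N NP] := AP 1 ltr01.
  have h1 := NP N (leqnn N); have h2 := SD 0%N N (leq0n N).
  have S0 : S 0%N = 0 by rewrite /S big_geq.
  rewrite S0 subr0 expr0 in h2; rewrite -qnormN opprB in h1.
  have -> : A = (A - S N) + S N by rewrite subrK.
  apply: (le_trans (CP _ _)); rewrite [2 * C]mulrC ler_pM2l//; lra.
Qed.

(** Stated for plain functions, since [sum_in0] and [sum_in1] carry no declared linear structure.
    The last field says that the range is an ideal. *)
Record ideal_embedding {R : realType} (E : quasiBanachLatticeType R)
    (V : vectorLatticeType R) (j : E -> V) : Prop := {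
  ideal_embP : forall a x y, j (a *: x + y) = a *: j x + j y ;
  ideal_emb_inj : injective j ;
  ideal_emb_join : forall x y, j (Order.join x y) = Order.join (j x) (j y) ;
  ideal_emb_solid : forall v x, vabs v <= j x -> exists x', v = j x'
}.

Section IdealEmbedding.
Context {R : realType} {E : quasiBanachLatticeType R} {V : vectorLatticeType R}.
Variables (j : E -> V) (jP : ideal_embedding j).

Lemma ideal_embD x y : j (x + y) = j x + j y.
Proof. by have := ideal_embP jP 1 x y; rewrite !scale1r. Qed.

Lemma ideal_emb0 : j 0 = 0.
Proof. by apply: (addrI (j 0)); rewrite -ideal_embD !addr0. Qed.

Lemma ideal_embZ a x : j (a *: x) = a *: j x.
Proof. by have := ideal_embP jP a x 0; rewrite ideal_emb0 !addr0. Qed.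

Lemma ideal_embN x : j (- x) = - j x.
Proof. by rewrite -scaleN1r ideal_embZ scaleN1r. Qed.

Lemma ideal_embB x y : j (x - y) = j x - j y.
Proof. by rewrite ideal_embD ideal_embN. Qed.

Lemma ideal_emb_vabs x : j (vabs x) = vabs (j x).
Proof. by rewrite /vabs (ideal_emb_join jP) ideal_embN. Qed.

Lemma ideal_emb_le x y : (j x <= j y) = (x <= y).
Proof.
apply/idP/idP => xy.
  by rewrite -(ideal_emb_inj jP (etrans (ideal_emb_join jP x y) (join_r xy))) leUl.
by rewrite -(join_r xy) (ideal_emb_join jP) leUl.
Qed.

Lemma ideal_emb_ge0 x : (0 <= j x) = (0 <= x).
Proof. by rewrite -ideal_emb_le ideal_emb0. Qed.

Lemma ideal_emb_sum I (r : seq I) (P : pred I) (F : I -> E) :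
  j (\sum_(i <- r | P i) F i) = \sum_(i <- r | P i) j (F i).
Proof.
elim: r => [|i r IH]; first by rewrite !big_nil ideal_emb0.
by rewrite !big_cons; case: ifP => _; rewrite ?ideal_embD IH.
Qed.

Lemma ideal_emb_solid_le v x : vabs v <= j x ->
  exists2 x', v = j x' & vabs x' <= x.
Proof.
move=> vx; have [x' v'] := ideal_emb_solid jP vx; exists x' => //.
by rewrite -ideal_emb_le ideal_emb_vabs -v'.
Qed.

End IdealEmbedding.

Lemma vl_riesz_two {R : realType} (V : vectorLatticeType R) (x p q : V) :
  0 <= p -> 0 <= q -> vabs x <= p + q ->
  exists a b, [/\ x = a + b, vabs a <= p & vabs b <= q].
Proof.
move=> p0 q0 xpq; pose F (i : 'I_2) := if i == ord0 then p else q.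
have F0 i : 0 <= F i by rewrite /F; case: ifP.
have [|u [xu uF]] := @vl_riesz_signed _ _ _ x F F0; first by rewrite big_ord_recl big_ord1.
exists (u ord0), (u (lift ord0 ord0)); split.
- by rewrite xu big_ord_recl big_ord1.
- exact: (uF ord0).
- exact: (uF (lift ord0 ord0)).
Qed.

(* X0 + X1, seen as a vector lattice in which X0 and X1 are ideals. *)
Record ideal_couple {R : realType} (X0 X1 : quasiBanachLatticeType R)
    (V : vectorLatticeType R) (j0 : X0 -> V) (j1 : X1 -> V) : Prop := {
  couple_arch : vl_archimedean V ;
  couple0 : ideal_embedding j0 ;
  couple1 : ideal_embedding j1 ;
  couple_sum : forall v, exists a b, v = j0 a + j1 b
}.

Section IdealCouple.
Context {R : realType} {X0 X1 : quasiBanachLatticeType R} {V : vectorLatticeType R}.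
Variables (j0 : X0 -> V) (j1 : X1 -> V) (jP : ideal_couple j0 j1).
Let j0P : ideal_embedding j0 := couple0 jP.
Let j1P : ideal_embedding j1 := couple1 jP.

Lemma couple_split v a b : vabs v <= j0 a + j1 b -> 0 <= a -> 0 <= b ->
  exists p q, [/\ v = j0 p + j1 q, vabs p <= a & vabs q <= b].
Proof.
move=> vab a0 b0; have [||_ [_ [-> /(ideal_emb_solid_le j0P)[p -> pa]
    /(ideal_emb_solid_le j1P)[q -> qb]]]] := vl_riesz_two _ _ vab.
- by rewrite (ideal_emb_ge0 j0P).
- by rewrite (ideal_emb_ge0 j1P).
by exists p, q.
Qed.

Lemma couple_ge0_split v : 0 <= v ->
  exists a b, [/\ v = j0 a + j1 b, 0 <= a & 0 <= b].
Proof.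
move=> v0; have [a [b vE]] := couple_sum jP v.
have [|||p [q [wE /andP[p0 pa] /andP[q0 qb]]]] :=
  @riesz_decomposition _ _ v (j0 (vabs a)) (j1 (vabs b)) v0.
- by rewrite (ideal_emb_ge0 j0P) vabs_ge0.
- by rewrite (ideal_emb_ge0 j1P) vabs_ge0.
- by rewrite vE vl_leD// ?(ideal_emb_le j0P) ?(ideal_emb_le j1P) vabs_ge.
rewrite -(ge0_vabs p0) in pa; rewrite -(ge0_vabs q0) in qb.
have [a' pE] := ideal_emb_solid j0P pa; have [b' qE] := ideal_emb_solid j1P qb.
exists a', b'; rewrite -(ideal_emb_ge0 j0P) -(ideal_emb_ge0 j1P).
by rewrite -pE -qE.
Qed.

(** Writing [e] as [j0 a + j1 b], each increment splits into parts dominated by multiples of [a] and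
    of [b]; the two series of parts converge in [X0] and in [X1] separately. *)
Lemma couple_uniformly_complete : uniformly_complete V.
Proof.
move=> e u e0 ue; have [a [b [eE a0 b0]]] := couple_ge0_split e0.
have step n : exists pq : X0 * X1, [/\ u n.+1 - u n = j0 pq.1 + j1 pq.2,
    vabs pq.1 <= 2^-1 ^+ n *: a & vabs pq.2 <= 2^-1 ^+ n *: b].
  have h0 := ltW (half_pow_gt0 (R := R) n).
  have [|||p [q [H1 H2 H3]]] := @couple_split (u n.+1 - u n) (2^-1 ^+ n *: a) (2^-1 ^+ n *: b).
  - by rewrite (ideal_embZ j0P) (ideal_embZ j1P) -scalerDr -eE.
  - exact: vl_scale_ge0.
  - exact: vl_scale_ge0.
  by exists (p, q).
have /choice[pq pqP] := step.
pose P n := \sum_(0 <= k < n) (pq k).1; pose Q n := \sum_(0 <= k < n) (pq k).2.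
have [p pP] : exists x, forall n, vabs (x - P n) <= (2 * 2^-1 ^+ n) *: a.
  apply: quasi_banach_uniformly_complete => // n.
  by rewrite /P big_nat_recr//= addrAC subrr add0r; have [_ ? _] := pqP n.
have [q qP] : exists x, forall n, vabs (x - Q n) <= (2 * 2^-1 ^+ n) *: b.
  apply: quasi_banach_uniformly_complete => // n.
  by rewrite /Q big_nat_recr//= addrAC subrr add0r; have [_ _ ?] := pqP n.
have uE n : u n = u 0%N + (j0 (P n) + j1 (Q n)).
  elim: n => [|n IH].
    by rewrite /P /Q !big_geq// (ideal_emb0 j0P) (ideal_emb0 j1P) !addr0.
  rewrite /P /Q !big_nat_recr//= (ideal_embD j0P) (ideal_embD j1P) [X in _ + X]addrACA.
  have [<- _ _] := pqP n.
  by rewrite addrA -IH addrC subrK.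
exists (u 0%N + (j0 p + j1 q)) => n.
have -> : u 0%N + (j0 p + j1 q) - u n = j0 (p - P n) + j1 (q - Q n).
  rewrite (uE n) opprD addrACA subrr add0r opprD addrACA.
  by rewrite (ideal_embB j0P) (ideal_embB j1P).
apply: (le_trans (vabsD _ _)); rewrite eE scalerDr.
rewrite -(ideal_emb_vabs j0P) -(ideal_emb_vabs j1P) -(ideal_embZ j0P) -(ideal_embZ j1P).
by apply: vl_leD; rewrite ?(ideal_emb_le j0P) ?(ideal_emb_le j1P).
Qed.

(** Smallness in quasi-norm becomes smallness in the order: bounds of rapidly decreasing quasi-norm
    are rescaled and summed into [A] and [B], whence [w <= 2^-1 ^+ k *: (j0 A + j1 B)] for every
    [k], and the Archimedean property applies. *)
Lemma couple_null w :
  (forall d, 0 < d -> exists p q,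
     [/\ w <= j0 p + j1 q, qnorm p <= d & qnorm q <= d]) -> w <= 0.
Proof.
move=> wP.
have [C0 C0P] := quasi_constant_exists X0; have [C1 C1P] := quasi_constant_exists X1.
pose C := Num.max C0 C1.
have CP0 : quasi_constant X0 C by apply: quasi_constant_le C0P; rewrite le_max lexx.
have CP1 : quasi_constant X1 C by apply: quasi_constant_le C1P; rewrite le_max lexx orbT.
have Cpos : 0 < 2 * C by rewrite mulr_gt0//; case: CP0 => C1' _; exact: lt_le_trans C1'.
have sw k : 0 < series_weight C k by rewrite exprn_gt0// invr_gt0.
have d0 k : 0 < 2^-1 ^+ k * series_weight C k by rewrite mulr_gt0// half_pow_gt0.
have /choice[pq pqP] : forall k, exists pq : X0 * X1,
    [/\ w <= j0 pq.1 + j1 pq.2, qnorm pq.1 <= 2^-1 ^+ k * series_weight C k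
      & qnorm pq.2 <= 2^-1 ^+ k * series_weight C k].
  by move=> k; have [p [q H]] := wP _ (d0 k); exists (p, q).
pose r k := (2^-1 ^+ k * series_weight C k)^-1.
have r0 k : 0 < r k by rewrite invr_gt0.
have [|A [A0 AP _]] := @qnorm_series _ _ _ (fun k => r k *: vabs (pq k).1) CP0
  (fun k => vl_scale_ge0 (ltW (r0 k)) (vabs_ge0 _)).
  move=> k; rewrite qnormZ_ge0 ?(ltW (r0 k))// qnorm_vabs mulrC ler_pdivrMr// mul1r.
  by have [] := pqP k.
have [|B [B0 BP _]] := @qnorm_series _ _ _ (fun k => r k *: vabs (pq k).2) CP1
  (fun k => vl_scale_ge0 (ltW (r0 k)) (vabs_ge0 _)).
  move=> k; rewrite qnormZ_ge0 ?(ltW (r0 k))// qnorm_vabs mulrC ler_pdivrMr// mul1r.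
  by have [] := pqP k.
apply: (couple_arch jP (z := j0 A + j1 B)) => d dpos.
have [k kd] := half_pow_lt dpos.
have [wk _ _] := pqP k.
have E : 2^-1 ^+ k * series_weight C k * r k = 1 by rewrite divff// gt_eqF.
have hk := ltW (half_pow_gt0 (R := R) k).
have hp : (pq k).1 <= 2^-1 ^+ k *: A.
  apply: le_trans (vl_leZ hk (AP k)).
  by rewrite !scalerA E scale1r vabs_ge.
have hq : (pq k).2 <= 2^-1 ^+ k *: B.
  apply: le_trans (vl_leZ hk (BP k)).
  by rewrite !scalerA E scale1r vabs_ge.
apply: (le_trans wk); apply: (@le_trans _ _ (2^-1 ^+ k *: (j0 A + j1 B))).
  rewrite scalerDr -(ideal_embZ j0P) -(ideal_embZ j1P).
  by apply: vl_leD; rewrite ?(ideal_emb_le j0P) ?(ideal_emb_le j1P).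
apply: vl_leZl; last exact: ltW.
by apply: vl_add_ge0; rewrite ?(ideal_emb_ge0 j0P) ?(ideal_emb_ge0 j1P).
Qed.

End IdealCouple.

(** * The sum of a compatible pair as a couple of ideals *)

(** The positive part of [x] is below every small positive multiple of [|z|]; these multiples tend
    to 0, so solid neighbourhoods put it in every neighbourhood of 0. *)
Lemma topological_lattice_archimedean {R : realType} (X : topVectorLatticeType R) :
  hausdorff_space X -> vl_archimedean X.
Proof.
move=> hX x z xz; pose p : X := Order.join x 0.
have pz : p = 0.
  apply: hX => A B pA B0.
  have [W [W0 Wsolid WB]] := locally_solid _ B0.
  have cW : (fun a : R => a *: vabs z) @ (0 : R) --> (0 : X).
    have : (fun a : R => a *: vabs z) @ (0 : R) --> (0 : R) *: (vabs z : X).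
      have h1 : (fun a : R => (a : R^o, vabs z : X)) @ (0 : R) -->
          nbhs ((0 : R^o), (vabs z : X)).
        move=> C [[A1 A2] [/= A10 A2z] A12].
        by apply: filterS A10 => a A1a; apply: A12; split => //; exact: (nbhs_singleton A2z).
      exact: (cvg_comp _ _ h1 (@scale_continuous R X ((0 : R^o), (vabs z : X)))).
    by rewrite scale0r.
  have /nbhs_ballP[d /= d0 dW] : nbhs (0 : R) [set a | W (a *: vabs z)] by exact: cW.
  have d2 : 0 < d / 2 by rewrite divr_gt0.
  have Wd : W ((d / 2) *: vabs z).
    by apply: dW => /=; rewrite /ball/= sub0r normrN gtr0_norm//; lra.
  have Wp : W p.
    apply: (Wsolid _ _ Wd).
    have zd : (d / 2) *: vabs z = vabs ((d / 2) *: vabs z).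
      by rewrite vabsZ vabs_vabs gtr0_norm.
    rewrite -zd ge0_vabs ?leUr// leUx vl_scale_ge0 ?vabs_ge0 ?(ltW d2)// andbT.
    by apply: (le_trans (xz _ d2)); rewrite vl_leZ ?(ltW d2)// vabs_ge.
  by exists p; split; [exact: nbhs_singleton|exact: WB].
by rewrite -pz leUl.
Qed.

Section LatticeEmbedding.
Context {R : realType} {E : quasiBanachLatticeType R} {X : topVectorLatticeType R}.
Variables (j : {linear E -> X}) (jP : lattice_embedding j).

Lemma lattice_embedding_pos_range (u : X) (x : E) : 0 <= u -> u <= j x ->
  exists x', u = j x'.
Proof.
move=> u0 ux.
have : [set` `[0, j (vabs x)]] u.
  rewrite /= in_itv /= u0 (le_trans ux)// /vabs (embedding_join jP).
  exact: leUl.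
rewrite -(embedding_interval jP) ?vabs_ge0// => -[x' _ <-].
by exists x'.
Qed.

(** Preservation of intervals, applied to the positive and negative parts of [v], makes the range an
    ideal. *)
Lemma lattice_embedding_solid (v : X) (x : E) : vabs v <= j x ->
  exists x', v = j x'.
Proof.
move=> vx; pose p : X := Order.join v 0; pose q : X := Order.join (- v) 0.
have le0 u : u <= vabs v -> Order.join u 0 <= j x.
  by move=> uv; apply: le_trans vx; rewrite leUx uv vabs_ge0.
have [a pE] := lattice_embedding_pos_range (leUr _ _ : 0 <= p) (le0 v (vabs_ge v)).
have [b qE] := lattice_embedding_pos_range (leUr _ _ : 0 <= q) (le0 (- v) (vabs_geN v)).
exists (a - b); rewrite linearB -pE -qE.
have <- : q + v = p by rewrite /q vl_joinDr addNr add0r joinC.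
by rewrite addrAC subrr add0r.
Qed.

End LatticeEmbedding.

Section SumSpaceCouple.
Context {R : realType} {X0 X1 : quasiBanachLatticeType R} (XX : compatible_pair X0 X1).

Lemma sum_space_archimedean : vl_archimedean (sum_space XX).
Proof.
move=> x z xz.
have := @topological_lattice_archimedean R (ambient XX) (@ambient_hausdorff _ _ _ XX)
  (sum_val x) (sum_val z).
move=> h; apply: h => e e0; exact: (xz e e0).
Qed.

Lemma sum_in0_ideal_embedding : ideal_embedding (sum_in0 XX).
Proof.
have P := emb0P XX; split.
- by move=> a x y; apply: val_inj; rewrite /= linearP.
- by move=> x y /(congr1 (@sum_val _ _ _ _)) /= /(embedding_inj P).
- by move=> x y; apply: val_inj; rewrite /= (embedding_join P).
- move=> v x vx; have [|x' E] := @lattice_embedding_solid _ _ _ _ P (sum_val v) x.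
    exact: vx.
  by exists x'; apply: val_inj.
Qed.

Lemma sum_in1_ideal_embedding : ideal_embedding (sum_in1 XX).
Proof.
have P := emb1P XX; split.
- by move=> a x y; apply: val_inj; rewrite /= linearP.
- by move=> x y /(congr1 (@sum_val _ _ _ _)) /= /(embedding_inj P).
- by move=> x y; apply: val_inj; rewrite /= (embedding_join P).
- move=> v x vx; have [|x' E] := @lattice_embedding_solid _ _ _ _ P (sum_val v) x.
    exact: vx.
  by exists x'; apply: val_inj.
Qed.

Lemma sum_space_couple : ideal_couple (sum_in0 XX) (sum_in1 XX).
Proof.
split.
- exact: sum_space_archimedean.
- exact: sum_in0_ideal_embedding.
- exact: sum_in1_ideal_embedding.
- move=> v; have /sum_predP[a [b vE]] := sum_valP v.
  by exists a, b; apply: val_inj.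
Qed.

End SumSpaceCouple.

(** * Operators on Calderon-Lozanovskii spaces *)

Section Balls.
Context {R : realType} (phi : R -> R -> R) (phiP : class_P phi).
Context {X0 X1 : quasiBanachLatticeType R} {V : vectorLatticeType R}.
Variables (j0 : X0 -> V) (j1 : X1 -> V) (jP : ideal_couple j0 j1).
Let j0P : ideal_embedding j0 := couple0 jP.
Let j1P : ideal_embedding j1 := couple1 jP.

(** The sets over which [CL_qnorm] takes its infimum; keeping the witnesses explicit frees the
    estimates from infima. *)
Definition CL_ball (l : R) (x : V) : Prop := exists (x0 : X0) (x1 : X1) (y : V),
  [/\ 0 <= x0, 0 <= x1, qnorm x0 <= 1 /\ qnorm x1 <= 1,
      functional_calculus phi (j0 x0) (j1 x1) y & vabs x <= l *: y].

Definition couple_cap (x : V) : Prop := (exists a, x = j0 a) /\ (exists b, x = j1 b).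

Lemma couple_fc_exists x0 x1 : 0 <= x0 -> 0 <= x1 ->
  exists y, functional_calculus phi (j0 x0) (j1 x1) y.
Proof.
move=> x00 x10; apply: fc_exists => //.
- exact: couple_arch jP.
- exact: couple_uniformly_complete jP.
- by rewrite (ideal_emb_ge0 j0P).
- by rewrite (ideal_emb_ge0 j1P).
Qed.

Lemma couple_fc_le x0 x1 y x0' x1' y' a :
  0 <= x0 -> 0 <= x1 -> 0 <= x0' -> 0 <= x1' ->
  functional_calculus phi (j0 x0) (j1 x1) y ->
  functional_calculus phi (j0 x0') (j1 x1') y' ->
  0 < a -> x0 <= a *: x0' -> x1 <= a *: x1' -> y <= a *: y'.
Proof.
move=> x00 x10 x0'0 x1'0 yP y'P a0 h0 h1.
apply: (fc_le phiP _ _ yP _ _ y'P a0).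
- by rewrite (ideal_emb_ge0 j0P).
- by rewrite (ideal_emb_ge0 j1P).
- by rewrite (ideal_emb_ge0 j0P).
- by rewrite (ideal_emb_ge0 j1P).
- by rewrite -(ideal_embZ j0P) (ideal_emb_le j0P).
- by rewrite -(ideal_embZ j1P) (ideal_emb_le j1P).
Qed.

Lemma couple_fc_ge0 x0 x1 y : 0 <= x0 -> 0 <= x1 ->
  functional_calculus phi (j0 x0) (j1 x1) y -> 0 <= y.
Proof.
by move=> x00 x10; apply: fc_ge0;
  rewrite ?(ideal_emb_ge0 j0P) ?(ideal_emb_ge0 j1P).
Qed.

Lemma CL_ball_le l l' x : l <= l' -> CL_ball l x -> CL_ball l' x.
Proof.
move=> ll [x0 [x1 [y [x00 x10 xn yP xy]]]]; exists x0, x1, y; split => //.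
by apply: (le_trans xy); apply: vl_leZl => //; exact: couple_fc_ge0 yP.
Qed.

Lemma CL_ballN l x : CL_ball l x -> CL_ball l (- x).
Proof.
move=> [x0 [x1 [y [x00 x10 xn yP xy]]]]; exists x0, x1, y; split => //.
by rewrite vabsN.
Qed.

Lemma CL_ball_normalize (l a : R) x x0 x1 y : 0 <= l -> 0 < a ->
  0 <= x0 -> 0 <= x1 -> qnorm x0 <= a -> qnorm x1 <= a ->
  functional_calculus phi (j0 x0) (j1 x1) y -> vabs x <= l *: y -> CL_ball (l * a) x.
Proof.
move=> l0 a0 x00 x10 xa0 xa1 yP xy.
have ai : 0 <= a^-1 by rewrite invr_ge0 ltW.
have h0 := vl_scale_ge0 ai x00; have h1 := vl_scale_ge0 ai x10.
have [z zP] := couple_fc_exists h0 h1.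
exists (a^-1 *: x0), (a^-1 *: x1), z; split => //.
  by rewrite !qnormZ_ge0// ![a^-1 * _]mulrC !ler_pdivrMr// !mul1r.
apply: (le_trans xy); rewrite -scalerA; apply: vl_leZ => //.
apply: (couple_fc_le x00 x10 h0 h1 yP zP a0).
  by rewrite scalerA divff ?scale1r// gt_eqF.
by rewrite scalerA divff ?scale1r// gt_eqF.
Qed.

(** By monotonicity, both witnesses are dominated by the value at the sums [x0 + x0'] and
    [x1 + x1'], whose quasi-norms are at most [2 * C]. *)
Lemma CL_ballD : exists2 C, 1 <= C & forall l l' x x', 0 <= l -> 0 <= l' ->
  CL_ball l x -> CL_ball l' x' -> CL_ball (C * (l + l')) (x + x').
Proof.
have [C0 C0P] := quasi_constant_exists X0; have [C1 C1P] := quasi_constant_exists X1.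
pose C := Num.max C0 C1.
have [C1' CP0] : quasi_constant X0 C by apply: quasi_constant_le C0P; rewrite le_max lexx.
have [_ CP1] : quasi_constant X1 C by apply: quasi_constant_le C1P; rewrite le_max lexx orbT.
have Cpos : 0 < C by exact: lt_le_trans C1'.
exists (2 * C); first by lra.
move=> l l' x x' l0 l'0 [x0 [x1 [y [x00 x10 [n0 n1] yP xy]]]].
move=> [x0' [x1' [y' [x0'0 x1'0 [n0' n1'] y'P xy']]]].
have s0 := vl_add_ge0 x00 x0'0; have s1 := vl_add_ge0 x10 x1'0.
have [z zP] := couple_fc_exists s0 s1.
rewrite mulrC; apply: (CL_ball_normalize (y := z) _ _ s0 s1 _ _ zP).
- exact: addr_ge0.
- by rewrite mulr_gt0.
- by apply: (le_trans (CP0 _ _)); rewrite [2 * C]mulrC ler_pM2l//; lra.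
- by apply: (le_trans (CP1 _ _)); rewrite [2 * C]mulrC ler_pM2l//; lra.
apply: (le_trans (vabsD _ _)); rewrite scalerDl; apply: vl_leD.
  apply: (le_trans xy); apply: vl_leZ => //.
  rewrite -[X in _ <= X]scale1r.
  apply: (couple_fc_le x00 x10 s0 s1 yP zP ltr01); rewrite scale1r; exact: vl_leDl.
apply: (le_trans xy'); apply: vl_leZ => //.
rewrite -[X in _ <= X]scale1r.
apply: (couple_fc_le x0'0 x1'0 s0 s1 y'P zP ltr01); rewrite scale1r; exact: vl_leDr.
Qed.

Lemma couple_cap_CL_ball z : couple_cap z -> exists2 l, 0 < l & CL_ball l z.
Proof.
move=> [[a za] [b zb]].
have a0 := vabs_ge0 a; have b0 := vabs_ge0 b.
have [y yP] := couple_fc_exists a0 b0.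
have E : j0 (vabs a) = j1 (vabs b).
  by rewrite (ideal_emb_vabs j0P) (ideal_emb_vabs j1P) -za -zb.
pose n := 1 + qnorm a + qnorm b.
have qa := qnorm_ge0 a; have qb := qnorm_ge0 b.
have n0 : 0 < n by rewrite /n; lra.
exists (1 * n); first by rewrite mul1r.
apply: (CL_ball_normalize (y := y) ler01 n0 a0 b0 _ _ yP).
- by rewrite qnorm_vabs /n; lra.
- by rewrite qnorm_vabs /n; lra.
rewrite scale1r [X in vabs X]za -(ideal_emb_vabs j0P).
apply: (fc_diag_le phiP _ _ yP E).
  by rewrite (ideal_emb_ge0 j0P).
by rewrite (ideal_emb_ge0 j1P).
Qed.

(** The bounded inclusion into the sum, from [phi(x0, x1) <= x0 + x1]; it serves to identify
    limits. *)
Lemma CL_ball_split l x : 0 <= l -> CL_ball l x ->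
  exists p q, [/\ x = j0 p + j1 q, qnorm p <= l & qnorm q <= l].
Proof.
move=> l0 [x0 [x1 [y [x00 x10 [n0 n1] yP xy]]]].
have lx0 := vl_scale_ge0 l0 x00; have lx1 := vl_scale_ge0 l0 x10.
have [|//|//|p [q [xE pl ql]]] := @couple_split _ _ _ _ _ _ jP x (l *: x0) (l *: x1).
  apply: (le_trans xy); rewrite (ideal_embZ j0P) (ideal_embZ j1P) -scalerDr.
  apply: vl_leZ => //.
  have h0 : 0 <= j0 x0 by rewrite (ideal_emb_ge0 j0P).
  have h1 : 0 <= j1 x1 by rewrite (ideal_emb_ge0 j1P).
  apply: (le_trans (fc_le_join phiP h0 h1 yP)).
  by rewrite leUx vl_leDl// vl_leDr.
exists p, q; split => //.
  rewrite -qnorm_vabs; apply: (le_trans (qnorm_le (vabs_ge0 _) pl)).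
  by rewrite qnormZ_ge0// ler_piMr.
rewrite -qnorm_vabs; apply: (le_trans (qnorm_le (vabs_ge0 _) ql)).
by rewrite qnormZ_ge0// ler_piMr.
Qed.

Lemma couple_capB x y : couple_cap x -> couple_cap y -> couple_cap (x - y).
Proof.
move=> [[a ->] [b ab]] [[a' ->] [b' ab']]; split.
  by exists (a - a'); rewrite (ideal_embB j0P).
by exists (b - b'); rewrite ab ab' (ideal_embB j1P).
Qed.

End Balls.

Lemma regular_bounded {R : realType} (E F : quasiBanachLatticeType R)
    (S : {linear E -> F}) (K : R) :
  regular_infty1_constant S K -> forall x, qnorm (S x) <= K * qnorm x.
Proof.
move=> SK x; have := SK 1%N (fun=> x); rewrite !big_ord1 !big_ord_recl !big_ord0.
rewrite qnorm_vabs join_l ?vabs_ge0// qnorm_vabs; exact.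
Qed.

Lemma vl_bigjoin_ge {R : realType} (U : vectorLatticeType R) n (F : 'I_n -> U) i :
  F i <= \big[Order.join/0]_(k < n) F k.
Proof.
have : i \in index_enum 'I_n by rewrite mem_index_enum.
elim: (index_enum _) => // k s IH; rewrite inE big_cons => /orP[/eqP->|/IH h].
  exact: leUl.
exact: le_trans h (leUr _ _).
Qed.

Lemma vl_bigjoin_ge0 {R : realType} (U : vectorLatticeType R) n (F : 'I_n -> U) :
  0 <= \big[Order.join/0]_(k < n) F k.
Proof.
elim: (index_enum _) => [|k s IH]; first by rewrite big_nil.
by rewrite big_cons; exact: le_trans IH (leUr _ _).
Qed.

(** * Boundedness of the operator on the intersection and on its closure *)

Section CoupleOperator.
Context {R : realType} (phi : R -> R -> R) (phiP : class_P phi).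
Context {X0 X1 : quasiBanachLatticeType R} {V : vectorLatticeType R}.
Context {Y0 Y1 : quasiBanachLatticeType R} {W : vectorLatticeType R}.
Variables (j0 : X0 -> V) (j1 : X1 -> V) (jP : ideal_couple j0 j1).
Variables (i0 : Y0 -> W) (i1 : Y1 -> W) (iP : ideal_couple i0 i1).
Let j0P : ideal_embedding j0 := couple0 jP.
Let j1P : ideal_embedding j1 := couple1 jP.
Let i0P : ideal_embedding i0 := couple0 iP.
Let i1P : ideal_embedding i1 := couple1 iP.
Variables (T : V -> W) (T0 : {linear X0 -> Y0}) (T1 : {linear X1 -> Y1}).
Hypotheses (TP : forall a x y, T (a *: x + y) = a *: T x + T y)
  (T0P : forall x, T (j0 x) = i0 (T0 x)) (T1P : forall x, T (j1 x) = i1 (T1 x)).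
Variables (K0 K1 : R).
Hypotheses (K00 : 0 < K0) (K10 : 0 < K1)
  (T0K : regular_infty1_constant T0 K0) (T1K : regular_infty1_constant T1 K1).

Lemma coupleT0 : T 0 = 0.
Proof. by rewrite -(ideal_emb0 j0P) T0P linear0 (ideal_emb0 i0P). Qed.

Lemma coupleTD x y : T (x + y) = T x + T y.
Proof. by have := TP 1 x y; rewrite !scale1r. Qed.

Lemma coupleTZ a x : T (a *: x) = a *: T x.
Proof. by have := TP a x 0; rewrite coupleT0 !addr0. Qed.

Lemma coupleTB x y : T (x - y) = T x - T y.
Proof. by rewrite coupleTD -scaleN1r coupleTZ scaleN1r. Qed.

Lemma coupleT_sum I (r : seq I) (F : I -> V) :
  T (\sum_(i <- r) F i) = \sum_(i <- r) T (F i).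
Proof.
elim: r => [|i r IH]; first by rewrite !big_nil coupleT0.
by rewrite !big_cons coupleTD IH.
Qed.

Lemma coupleT_cap x : couple_cap j0 j1 x -> couple_cap i0 i1 (T x).
Proof.
move=> [[a xa] [b xb]]; split.
  by exists (T0 a); rewrite -T0P xa.
by exists (T1 b); rewrite -T1P xb.
Qed.

(** The number of pieces, [eps] and [M] all depend on [x], but [L] involves only the regularity
    constants and the quasi-triangle constants of [X0] and [X1], and the factor 5 comes from the
    nodes. *)
Lemma coupleT_ball_cap : exists2 K, 0 < K & forall l x, 0 < l ->
  couple_cap j0 j1 x -> CL_ball phi j0 j1 l x -> CL_ball phi i0 i1 (K * l) (T x).
Proof.
have [C0 [C01 C0P]] := quasi_constant_exists X0.
have [C1 [C11 C1P]] := quasi_constant_exists X1.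
pose L := 1 + K0 * (64 * C0) + K1 * (64 * C1).
have C00 : 0 < C0 by exact: lt_le_trans C01.
have C10 : 0 < C1 by exact: lt_le_trans C11.
have KC0 : 0 < K0 * (64 * C0) by rewrite !mulr_gt0.
have KC1 : 0 < K1 * (64 * C1) by rewrite !mulr_gt0.
have L0 : 0 < L by rewrite /L; lra.
exists (5 * L); first by rewrite mulr_gt0.
move=> l x l0 [[a' xa'] [b' xb']] [x0 [x1 [y [x00 x10 [n0 n1] yP xy]]]].
have li0 : 0 <= l^-1 by rewrite invr_ge0 ltW.
pose x' := l^-1 *: x; pose a := l^-1 *: a'; pose b := l^-1 *: b'.
have xa : x' = j0 a by rewrite /x' xa' (ideal_embZ j0P).
have xb : x' = j1 b by rewrite /x' xb' (ideal_embZ j1P).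
have x'y : vabs x' <= y.
  rewrite /x' vabsZ ger0_norm//; apply: (le_trans (vl_leZ li0 xy)).
  by rewrite scalerA mulVf ?scale1r// gt_eqF.
have qa := qnorm_ge0 a; have qb := qnorm_ge0 b.
(* Makes [eps *: x'] of quasi-norm at most 1 in both [X0] and [X1], so joining its modulus to [x0]
   and [x1] keeps them bounded. *)
pose eps := (1 + qnorm a + qnorm b)^-1.
have d0 : 0 < 1 + qnorm a + qnorm b by lra.
have eps0 : 0 < eps by rewrite invr_gt0.
have eps1 : eps <= 1 by rewrite invf_le1//; lra.
have epsa : eps * qnorm a <= 1 by rewrite mulrC ler_pdivrMr// mul1r; lra.
have epsb : eps * qnorm b <= 1 by rewrite mulrC ler_pdivrMr// mul1r; lra.
have j00 : 0 <= j0 x0 by rewrite (ideal_emb_ge0 j0P).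
have j10 : 0 <= j1 x1 by rewrite (ideal_emb_ge0 j1P).
have [N [c [v [M [[c0 xE] v0 v1 vM cP]]]]] :=
  CL_decomposition phiP j00 j10 yP x'y eps0 eps1.
(* Being dominated by a multiple of [|x'|], each piece lies in both ideals, so [T0] and [T1] apply
   to the same piece. *)
have /choice[av avP] : forall j, exists u, v j = j0 u.
  move=> j; apply: (ideal_emb_solid j0P (x := M *: vabs a)).
  by rewrite (ideal_embZ j0P) (ideal_emb_vabs j0P) -xa.
have /choice[bv bvP] : forall j, exists u, v j = j1 u.
  move=> j; apply: (ideal_emb_solid j1P (x := M *: vabs b)).
  by rewrite (ideal_embZ j1P) (ideal_emb_vabs j1P) -xb.
(* The bound is 32 from the decomposition times [C0 * (1 + 1)] from the quasi-triangle
   inequality. *)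
have sum_a : qnorm (\sum_j vabs (av j)) <= 64 * C0.
  have h : \sum_j vabs (av j) <= 32 *: (x0 + eps *: vabs a).
    rewrite -(ideal_emb_le j0P) (ideal_emb_sum j0P) (ideal_embZ j0P) (ideal_embD j0P).
    rewrite (ideal_embZ j0P) (ideal_emb_vabs j0P) -xa.
    have -> : \sum_j j0 (vabs (av j)) = \sum_j vabs (v j).
      by apply: eq_bigr => j _; rewrite (ideal_emb_vabs j0P) -avP.
    apply: (le_trans v0); apply: vl_leZ => //.
    by rewrite leUx vl_leDl ?vl_leDr// vl_scale_ge0 ?vabs_ge0// ltW.
  apply: (le_trans (qnorm_le (vl_sum_ge0 _ (fun j _ => vabs_ge0 (av j))) h)).
  rewrite qnormZ_ge0//; apply: (le_trans (ler_wpM2l _ (C0P _ _))) => //.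
  rewrite (qnormZ_ge0 _ (ltW eps0)) qnorm_vabs.
  have : C0 * (qnorm x0 + eps * qnorm a) <= C0 * 2 by rewrite ler_pM2l//; lra.
  lra.
have sum_b : qnorm (\sum_j vabs (c j *: bv j)) <= 64 * C1.
  have h : \sum_j vabs (c j *: bv j) <= 32 *: (x1 + eps *: vabs b).
    rewrite -(ideal_emb_le j1P) (ideal_emb_sum j1P) (ideal_embZ j1P) (ideal_embD j1P).
    rewrite (ideal_embZ j1P) (ideal_emb_vabs j1P) -xb.
    have -> : \sum_j j1 (vabs (c j *: bv j)) = \sum_j c j *: vabs (v j).
      apply: eq_bigr => j _; rewrite (ideal_emb_vabs j1P) (ideal_embZ j1P) -bvP.
      by rewrite vabsZ gtr0_norm.
    apply: (le_trans v1); apply: vl_leZ => //.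
    by rewrite leUx vl_leDl ?vl_leDr// vl_scale_ge0 ?vabs_ge0// ltW.
  apply: (le_trans (qnorm_le (vl_sum_ge0 _ (fun j _ => vabs_ge0 (c j *: bv j))) h)).
  rewrite qnormZ_ge0//; apply: (le_trans (ler_wpM2l _ (C1P _ _))) => //.
  rewrite (qnormZ_ge0 _ (ltW eps0)) qnorm_vabs.
  have : C1 * (qnorm x1 + eps * qnorm b) <= C1 * 2 by rewrite ler_pM2l//; lra.
  lra.
pose y0 := \big[Order.join/0]_j vabs (T0 (av j)).
pose y1 := \big[Order.join/0]_j vabs (T1 (c j *: bv j)).
have y00 : 0 <= y0 by exact: vl_bigjoin_ge0.
have y10 : 0 <= y1 by exact: vl_bigjoin_ge0.
have y0L : qnorm y0 <= L.
  apply: (le_trans (T0K av)); apply: (le_trans (ler_wpM2l (ltW K00) sum_a)).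
  by rewrite /L; lra.
have y1L : qnorm y1 <= L.
  apply: (le_trans (T1K _)); apply: (le_trans (ler_wpM2l (ltW K10) sum_b)).
  by rewrite /L; lra.
have [z zP] := couple_fc_exists phiP iP y00 y10.
have -> : 5 * L * l = (5 * l) * L by ring.
apply: (CL_ball_normalize phiP iP (y := z) _ L0 y00 y10 y0L y1L zP).
  by rewrite mulr_ge0// ltW.
have -> : T x = l *: T x'.
  by rewrite -coupleTZ /x' scalerA divff ?scale1r// gt_eqF.
rewrite vabsZ gtr0_norm// [5 * l]mulrC -scalerA; apply: vl_leZ; first exact: ltW.
have h0 : 0 <= i0 y0 by rewrite (ideal_emb_ge0 i0P).
have h1 : 0 <= i1 y1 by rewrite (ideal_emb_ge0 i1P).
have f5 : 0 < 5 :> R by [].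
apply: le_trans (fc_sum_le phiP h0 h1 zP f5 cP c0).
rewrite xE coupleT_sum; apply: (le_trans (vabs_sum _ _ _)); apply: vl_sum_le => j _.
have fj : 0 < phi 1 (c j) by exact: class_P_gt0.
rewrite coupleTZ vabsZ gtr0_norm//; apply: vl_leZ; first exact: ltW.
rewrite lexI; apply/andP; split.
  rewrite avP T0P -(ideal_emb_vabs i0P) (ideal_emb_le i0P).
  exact: (vl_bigjoin_ge (fun k => vabs (T0 (av k)))).
have -> : vabs (T (v j)) = (c j)^-1 *: i1 (vabs (T1 (c j *: bv j))).
  rewrite linearZ /= vabsZ gtr0_norm// (ideal_embZ i1P) scalerA mulVf ?gt_eqF//.
  by rewrite scale1r (ideal_emb_vabs i1P) -T1P -bvP.
apply: vl_leZ; first by rewrite invr_ge0 ltW.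
rewrite (ideal_emb_le i1P).
exact: (vl_bigjoin_ge (fun k => vabs (T1 (c k *: bv k)))).
Qed.

Definition CL_closure (x : V) : Prop := forall d : R, 0 < d ->
  exists2 z, couple_cap j0 j1 z & CL_ball phi j0 j1 d (x - z).

(* The differences T z_(k+1) - T z_k of a fast approximating sequence are dominated
   by 2^-k phi(A, B), for A and B the sums of their weighted witnesses. *)
Lemma coupleT_ball_closure : exists2 K, 0 < K & forall x e, 0 < e -> CL_closure x ->
  exists z, [/\ couple_cap j0 j1 z, CL_ball phi j0 j1 e (x - z) &
                CL_ball phi i0 i1 (K * e) (T (x - z))].
Proof.
have [KT KT0 KTP] := coupleT_ball_cap.
have [CX CX1 CXP] := CL_ballD phiP jP.
have [C0 C0P] := quasi_constant_exists Y0; have [C1 C1P] := quasi_constant_exists Y1.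
pose C := Num.max C0 C1.
have CP0 : quasi_constant Y0 C by apply: quasi_constant_le C0P; rewrite le_max lexx.
have CP1 : quasi_constant Y1 C by apply: quasi_constant_le C1P; rewrite le_max lexx orbT.
have C1' : 1 <= C by case: CP0.
have Cpos : 0 < 2 * C by lra.
have CX0 : 0 < CX by exact: lt_le_trans CX1.
have sw0 k : 0 < series_weight C k by rewrite exprn_gt0// invr_gt0.
have sw1 k : series_weight C k <= 1.
  by rewrite exprn_ile1 ?invr_ge0 ?invf_le1 ?(ltW Cpos)//; lra.
have swS k : series_weight C k.+1 <= series_weight C k.
  by rewrite /series_weight [leLHS]exprS ler_piMl ?(ltW (sw0 _)) ?invf_le1//; lra.
exists (8 * C * KT * CX); first by rewrite !mulr_gt0//; lra.
move=> x e e0 xcl.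
(* The power of 1/2 makes the differences summable in the order; the factor [series_weight C k] is
   cancelled in [diff], when the k-th witnesses are replaced by the common [A] and [B]. *)
pose d k := e * 2^-1 ^+ k * series_weight C k.
have d0 k : 0 < d k by rewrite !mulr_gt0// half_pow_gt0.
have dS k : d k.+1 <= d k.
  rewrite /d -!mulrA ler_pM2l//; apply: ler_pM => //.
  - by rewrite ltW// half_pow_gt0.
  - exact: ltW.
  - by rewrite exprS ler_piMl ?invf_le1 ?ler1n// ltW// half_pow_gt0.
have /choice[z zP] : forall k, exists z, couple_cap j0 j1 z /\ CL_ball phi j0 j1 (d k) (x - z).
  by move=> k; have [z zc zb] := xcl _ (d0 k); exists z.
pose mu := 2 * KT * CX * e.
have mu0 : 0 < mu by rewrite !mulr_gt0.
have step k : CL_ball phi i0 i1 (mu * 2^-1 ^+ k * series_weight C k) (T (z k.+1) - T (z k)).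
  have [zc zb] := zP k; have [zc' zb'] := zP k.+1.
  have zz : CL_ball phi j0 j1 (CX * (2 * d k)) (z k.+1 - z k).
    have := CXP _ _ _ _ (ltW (d0 k)) (ltW (d0 k.+1)) zb (CL_ballN zb').
    have -> : x - z k - (x - z k.+1) = z k.+1 - z k.
      by rewrite opprB [LHS]addrC addrA subrK.

    by apply: (CL_ball_le phiP jP); rewrite ler_pM2l//; have := dS k; lra.
  have Cd : 0 < CX * (2 * d k) by apply: mulr_gt0 => //; exact: mulr_gt0.
  have := KTP _ _ Cd (couple_capB jP zc' zc) zz; rewrite coupleTB.
  by congr (CL_ball _ _ _ _ _); rewrite /mu /d; ring.
have /choice[w wP] : forall k, exists w : Y0 * Y1 * W,
    [/\ 0 <= w.1.1, 0 <= w.1.2, qnorm w.1.1 <= 1 /\ qnorm w.1.2 <= 1,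
        functional_calculus phi (i0 w.1.1) (i1 w.1.2) w.2 &
        vabs (T (z k.+1) - T (z k)) <= (mu * 2^-1 ^+ k * series_weight C k) *: w.2].
  by move=> k; have [a [b [y H]]] := step k; exists (a, b, y).
have [||A [A0 AP An]] := @qnorm_series _ _ C (fun k => (w k).1.1) CP0.
- by move=> k; have [] := wP k.
- by move=> k; have [_ _ []] := wP k.
have [||B [B0 BP Bn]] := @qnorm_series _ _ C (fun k => (w k).1.2) CP1.
- by move=> k; have [] := wP k.
- by move=> k; have [_ _ []] := wP k.
have [y yP] := couple_fc_exists phiP iP A0 B0.
have y0 := couple_fc_ge0 phiP iP A0 B0 yP.
have diff k : vabs (T (z k.+1) - T (z k)) <= (mu * 2^-1 ^+ k) *: y.
  have [w0 w1 _ wf wT] := wP k; apply: (le_trans wT).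
  have swn : series_weight C k != 0 by rewrite gt_eqF.
  have swi : 0 < (series_weight C k)^-1 by rewrite invr_gt0.
  have wy : (w k).2 <= (series_weight C k)^-1 *: y.
    apply: (couple_fc_le phiP iP w0 w1 A0 B0 wf yP swi).
      have := vl_leZ (ltW swi) (AP k).
      by rewrite scalerA mulVf// scale1r.
    have := vl_leZ (ltW swi) (BP k).
    by rewrite scalerA mulVf// scale1r.
  apply: (le_trans (vl_leZ _ wy)); last by rewrite scalerA mulfK.
  by rewrite !mulr_ge0// ltW// half_pow_gt0.
have part n : vabs (T (z n) - T (z 0%N)) <= (2 * mu - 2 * mu * 2^-1 ^+ n) *: y.
  elim: n => [|n IH]; first by rewrite subrr vabs0 expr0 mulr1 subrr scale0r.
  have -> : T (z n.+1) - T (z 0%N) = (T (z n.+1) - T (z n)) + (T (z n) - T (z 0%N)).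
    by rewrite addrA subrK.
  apply: (le_trans (vabsD _ _)); apply: (le_trans (vl_leD (diff n) IH)).
  by rewrite -scalerDl; apply: vl_leZl => //; rewrite exprS; lra.
have part2 n : vabs (T (z n) - T (z 0%N)) <= (2 * mu) *: y.
  apply: (le_trans (part n)); apply: vl_leZl => //.
  by rewrite gerBl mulr_ge0// ?mulr_ge0// ltW// half_pow_gt0.
(* The excess over the bound is at most [|T (x - z n)|], which is small in [Y0 + Y1] because
   [x - z n] is small in [X0 + X1] and [T0], [T1] are bounded; [couple_null] then removes it. *)
have lim : vabs (T (x - z 0%N)) <= (2 * mu) *: y.
  rewrite -[vabs _](subrK ((2 * mu) *: y)) -[X in _ <= X]add0r; apply: vl_leD => //.
  apply: (couple_null iP) => dd dd0.
  have c0 : 0 < dd / (e * (K0 + K1)) by rewrite !(divr_gt0, mulr_gt0, addr_gt0).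
  have [n nP] := half_pow_lt c0.
  have [_ zb] := zP n.
  have [p [q [xE pn qn]]] := CL_ball_split phiP jP (ltW (d0 n)) zb.
  have dn : (K0 + K1) * d n <= dd.
    have eK : 0 < e * (K0 + K1) by rewrite mulr_gt0// addr_gt0.
    rewrite ltr_pdivlMr// in nP; apply/ltW; apply: le_lt_trans nP.
    have -> : (K0 + K1) * d n = 2^-1 ^+ n * (e * (K0 + K1)) * series_weight C n.
      by rewrite /d; ring.
    by rewrite ler_piMr// mulr_ge0// ltW// half_pow_gt0.
  have K0d := mulr_gt0 K00 (d0 n); have K1d := mulr_gt0 K10 (d0 n).
  rewrite mulrDl in dn.
  exists (vabs (T0 p)), (vabs (T1 q)); split.
  - rewrite vl_leBlDr; have -> : T (x - z 0%N) = T (x - z n) + (T (z n) - T (z 0%N)).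
      by rewrite -!coupleTB -coupleTD addrA subrK.
    apply: (le_trans (vabsD _ _)); apply: vl_leD => //.
    rewrite xE coupleTD T0P T1P (ideal_emb_vabs i0P) (ideal_emb_vabs i1P).
    exact: vabsD.
  - rewrite qnorm_vabs; apply: (le_trans (regular_bounded T0K p)).
    by have := ler_wpM2l (ltW K00) pn; lra.
  - rewrite qnorm_vabs; apply: (le_trans (regular_bounded T1K q)).
    by have := ler_wpM2l (ltW K10) qn; lra.
have [zc zb] := zP 0%N.
exists (z 0%N); split => //.
  apply: (CL_ball_le phiP jP) zb; rewrite /d expr0 mulr1 ler_piMr// ltW//.
have -> : 8 * C * KT * CX * e = (2 * mu) * (2 * C) by rewrite /mu; ring.
by apply: (CL_ball_normalize phiP iP (y := y) _ Cpos A0 B0 An Bn yP lim); rewrite mulr_ge0// ltW.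
Qed.

(** Split [x] as [z + (x - z)] with [z] in the intersection and [x - z] in the ball of radius [l]:
    the two previous estimates treat one summand each. *)
Lemma coupleT_ball : exists2 K, 0 < K & forall l x, 0 < l -> CL_closure x ->
  CL_ball phi j0 j1 l x -> CL_ball phi i0 i1 (K * l) (T x).
Proof.
have [KT KT0 KTP] := coupleT_ball_cap.
have [CX CX1 CXP] := CL_ballD phiP jP.
have [CY CY1 CYP] := CL_ballD phiP iP.
have [KC KC0 KCP] := coupleT_ball_closure.
have CX0 : 0 < CX by exact: lt_le_trans CX1.
have CY0 : 0 < CY by exact: lt_le_trans CY1.
have KX0 : 0 < KT * (CX * 2) by rewrite !mulr_gt0.
exists (CY * (KT * (CX * 2) + KC)); first by rewrite mulr_gt0// addr_gt0.
move=> l x l0 xcl xl; have [z [zc zb Tz]] := KCP _ _ l0 xcl.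
have zl : CL_ball phi j0 j1 (CX * (l + l)) z.
  have := CXP _ _ _ _ (ltW l0) (ltW l0) xl (CL_ballN zb).
  by have -> : x - (x - z) = z by rewrite opprB addrC subrK.
have Cl0 : 0 < CX * (l + l) by rewrite mulr_gt0// addr_gt0.
have h1 := KTP _ _ Cl0 zc zl.
have h2 := CYP _ _ _ _ (ltW (mulr_gt0 KT0 Cl0)) (ltW (mulr_gt0 KC0 l0)) h1 Tz.
rewrite -coupleTD [z + _]addrC subrK in h2.
have -> // : CY * (KT * (CX * 2) + KC) * l = CY * (KT * (CX * (l + l)) + KC * l).
by ring.
Qed.

End CoupleOperator.

(** * From balls back to the quasi-norm, and conclusion *)

Section CLSpace.
Context {R : realType} (phi : R -> R -> R) (phiP : class_P phi).
Context {X0 X1 : quasiBanachLatticeType R} (XX : compatible_pair X0 X1).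
Local Notation ball := (CL_ball phi (sum_in0 XX) (sum_in1 XX)).
Let jP := sum_space_couple XX.

Lemma CL_spaceP (x : sum_space XX) : CL_space phi x <-> exists2 l, 0 < l & ball l x.
Proof.
split=> [[x0 [x1 [y [x00 x10 yP xy]]]]|[l l0 [x0 [x1 [y [x00 x10 _ yP xy]]]]]].
  have q0 := qnorm_ge0 x0; have q1 := qnorm_ge0 x1.
  have n0 : 0 < 1 + qnorm x0 + qnorm x1 by lra.
  exists (1 * (1 + qnorm x0 + qnorm x1)); first by rewrite mul1r.
  have h0 : qnorm x0 <= 1 + qnorm x0 + qnorm x1 by lra.
  have h1 : qnorm x1 <= 1 + qnorm x0 + qnorm x1 by lra.
  by apply: (CL_ball_normalize phiP jP ler01 n0 x00 x10 h0 h1 yP); rewrite scale1r.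
have lx0 := vl_scale_ge0 (ltW l0) x00; have lx1 := vl_scale_ge0 (ltW l0) x10.
have [z zP] := couple_fc_exists phiP jP lx0 lx1.
exists (l *: x0), (l *: x1), z; split => //.
apply: (le_trans xy).
have li : 0 < l^-1 by rewrite invr_gt0.
have := vl_leZ (ltW l0) (couple_fc_le phiP jP x00 x10 lx0 lx1 yP zP li _ _).
rewrite !scalerA mulVf ?gt_eqF// divff ?gt_eqF// !scale1r.
by apply.
Qed.

Lemma CL_qnorm_le (x : sum_space XX) l : 0 < l -> ball l x -> CL_qnorm phi x <= l.
Proof.
move=> l0 xl; apply: ge_inf; last by split.
by exists 0 => r [/ltW].
Qed.

Lemma CL_qnorm_lt (x : sum_space XX) l : CL_space phi x -> CL_qnorm phi x < l ->
  0 < l /\ ball l x.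
Proof.
move=> /CL_spaceP[l1 l10 xl1]; rewrite -subr_gt0 => d0.
have hi : has_inf [set l : R | 0 < l /\ ball l x].
  by split; [exists l1|exists 0 => r [/ltW]].
have [r [r0 xr]] := inf_adherent d0 hi.
rewrite -/(CL_qnorm phi x) addrC subrK => rl.
by split; [exact: lt_trans rl|exact: (CL_ball_le phiP jP (ltW rl) xr)].
Qed.

Lemma pair_capP (z : sum_space XX) :
  pair_cap z <-> couple_cap (sum_in0 XX) (sum_in1 XX) z.
Proof.
split=> [[[a _ <-] [b _ ba]]|[[a ->] [b ab]]].
  by split; [exists a|exists b].
by split; [exists a|exists b].
Qed.

Lemma CL0_spaceP (x : sum_space XX) :
  CL0_space phi x <-> CL_closure phi (sum_in0 XX) (sum_in1 XX) x.
Proof.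
have [C C1 CP] := CL_ballD phiP jP; have C0 : 0 < C by exact: lt_le_trans C1.
split=> [[/CL_spaceP[l l0 xl] xcl] d d0|xcl].
  have [z /pair_capP zc zd] := xcl d d0; exists z => //.
  have [m m0 zm] := couple_cap_CL_ball phiP jP zc.
  (* For elements outside the space, [CL_qnorm] is the infimum of an empty set and its smallness
     carries no information; membership has to be checked before a ball can be extracted. *)
  have xz : CL_space phi (x - z).
    apply/CL_spaceP; exists (C * (l + m)); first by rewrite mulr_gt0// addr_gt0.
    by apply: CP; [exact: ltW|exact: ltW|exact: xl|exact: CL_ballN].
  by have [] := CL_qnorm_lt xz zd.
split.
  have [z zc z1] := xcl 1 ltr01; have [m m0 zm] := couple_cap_CL_ball phiP jP zc.
  apply/CL_spaceP; exists (C * (1 + m)); first by rewrite mulr_gt0// addr_gt0.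
  by rewrite -[x](subrK z); apply: CP => //; exact: ltW.
move=> e e0; have e2 : 0 < e / 2 by rewrite divr_gt0.
have [z zc ze] := xcl _ e2; exists z; first exact/pair_capP.
by apply: le_lt_trans (CL_qnorm_le e2 ze) _; lra.
Qed.

End CLSpace.

(** The values chosen in [Y] are unique because [i] is injective, so the choice function is
    linear. *)
Lemma pair_operator_restrict {R : realType} (X Y : quasiBanachLatticeType R)
    (V W : vectorLatticeType R) (j : X -> V) (i : Y -> W) (T : V -> W) :
  ideal_embedding j -> ideal_embedding i ->
  (forall a x y, T (a *: x + y) = a *: T x + T y) ->
  (exists K, forall x, exists2 y, T (j x) = i y & qnorm y <= K * qnorm x) ->
  exists2 S : {linear X -> Y}, forall x, T (j x) = i (S x) & bounded_operator S.
Proof.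
move=> jP iP TP [K TK].
have /choice[S SP] : forall x, exists y, T (j x) = i y /\ qnorm y <= K * qnorm x.
  by move=> x; have [y ? ?] := TK x; exists y.
have Slin : linear S.
  move=> a x y; apply: (ideal_emb_inj iP).
  rewrite (ideal_embP iP); have [<- _] := SP x; have [<- _] := SP y.
  by have [<- _] := SP (a *: x + y); rewrite (ideal_embP jP) TP.
pose SL := GRing.isLinear.Build R X Y *:%R S Slin.
pose S' : {linear X -> Y} := HB.pack S SL.
exists S'; first by move=> x; have [] := SP x.
by exists K => x; have [] := SP x.
Qed.

Theorem corollary5p6 (R : realType) (X0 X1 Y0 Y1 : quasiBanachLatticeType R)
    (XX : compatible_pair X0 X1) (YY : compatible_pair Y0 Y1)
    (HY0 : K_infty1_property Y0) (HY1 : K_infty1_property Y1)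
    (T : {linear sum_space XX -> sum_space YY}) (HT : pair_operator T)
    (phi : R -> R -> R) (Hphi : class_P phi) :
  (forall x, CL0_space phi x -> CL0_space phi (T x)) /\
  (exists K : R, forall x, CL0_space phi x ->
    CL_qnorm phi (T x) <= K * CL_qnorm phi x).
Proof.
have jP := sum_space_couple XX; have iP := sum_space_couple YY.
have TP a (x y : sum_space XX) : T (a *: x + y) = a *: T x + T y by rewrite linearP.
have [T0 T0P T0b] := pair_operator_restrict (couple0 jP) (couple0 iP) TP
  (pair_operator_bounded0 HT).
have [T1 T1P T1b] := pair_operator_restrict (couple1 jP) (couple1 iP) TP
  (pair_operator_bounded1 HT).
have [C0 _ HY0'] := HY0; have [[K0 K00 T0K] _] := HY0' _ _ T0b.
have [C1 _ HY1'] := HY1; have [[K1 K10 T1K] _] := HY1' _ _ T1b.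
have [K Kpos KP] := coupleT_ball Hphi jP iP TP T0P T1P K00 K10 T0K T1K.
have [KC KC0 KCP] := coupleT_ball_closure Hphi jP iP TP T0P T1P K00 K10 T0K T1K.
(* The element [z] given by [KCP] approximates [x] while [T z] approximates [T x], and [T z] stays
   in the intersection. *)
have Tcl x : CL0_space phi x -> CL0_space phi (T x).
  move=> /(CL0_spaceP Hphi) xcl; apply/(CL0_spaceP Hphi) => d d0.
  have dK : 0 < d / KC by rewrite divr_gt0.
  have [z [zc _ Tz]] := KCP _ _ dK xcl.
  exists (T z); first exact: (coupleT_cap T0P T1P).
  have KdE : KC * (d / KC) = d by rewrite mulrCA divff ?mulr1// gt_eqF.
  by rewrite -(coupleTB jP iP TP T0P) -KdE.
split=> //; exists K => x x0; apply/ler_addgt0Pr => d d0.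
have xcl := (CL0_spaceP Hphi x).1 x0; have [xs _] := x0.
have dK : CL_qnorm phi x < CL_qnorm phi x + d / K by rewrite ltrDl divr_gt0.
have [l0 xl] := CL_qnorm_lt Hphi xs dK.
have := CL_qnorm_le (mulr_gt0 Kpos l0) (KP _ _ l0 xcl xl).
by rewrite mulrDr [K * (d / K)]mulrC divfK ?gt_eqF.
Qed.
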